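(* Let $b\in\mathbb{N}$ and let $\theta\in\mathbb{R}$ be fixed with $0<\theta\le 1/2$. (i) If $b>1$, then as $T\to\infty$ $$M_{1,b,1}^{\theta}(T)=T\,K_b(\log T)-C_{1,b,1}T^{1-\theta(1/2-1/(2b))}+O\big(T^{1-\theta/2}(\log T)^2\big).$$ (ii) If $b=1$, then $$M_{1,1,1}^{\theta}(T)=\frac{\theta^2}{2}T(\log T)^2+c_1T\log T+c_0T+O\big(T^{1-\theta/2}(\log T)^2\big).$$
   Context: For $\theta>0$ and real $\sigma$, $\tau>0$, let $D_\theta(\sigma+i\tau)=\sum_{1\le n\le (\tau/2\pi)^{\theta}} n^{-\sigma-i\tau}$, and $$M_{1,b,1}^{\theta}(T)=\int_0^T D_\theta(1/2+it)\,\zeta(1/2-ibt)\,\zeta(1/2-it)\,dt.$$ Let $\gamma$ be Euler's constant, $\gamma_1=\frac12\lim_{s\to1}\frac{d^2}{ds^2}\big((s-1)\zeta(s)\big)$, and $\lambda_\theta=2/\theta-1$. For $b>1$ let $E_b=\zeta((b+1)/2)\gamma+b\,\zeta'((b+1)/2)$ and define the linear polynomial $$K_b(x)=\theta\zeta\Big(\frac{b+1}{2}\Big)x+E_b-\theta\zeta\Big(\frac{b+1}{2}\Big)-\theta\zeta\Big(\frac{b+1}{2}\Big)\log 2\pi,$$ and $$C_{1,b,1}=\frac{4b}{\theta(b-1)(\lambda_\theta b+1)}\,\zeta\Big(\frac{1}{2b}+\frac12\Big)(2\pi)^{\theta(1/2-1/(2b))}.$$ Let $F_{0,1}=\frac{4\gamma}{\lambda_\theta+1}-\frac{4}{(\lambda_\theta+1)^2}$,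 $F_{1,1}=\frac{2}{\lambda_\theta+1}$, and $$c_1=\theta(2\gamma-F_{1,1})-\theta^2\log 2\pi,\qquad c_0=\gamma^2+2\gamma_1-F_{0,1}-\theta(2\gamma-F_{1,1})\log 2\pi+\frac{\theta^2}{2}(\log 2\pi)^2.$$ Implied constants depend on $b,\theta$. *)

(* Defs.v *)
From Stdlib Require Import Reals ZArith.
From Coquelicot Require Export Coquelicot.
Open Scope R_scope.

(* n^{-s} for a natural n >= 1 and complex s = σ + iτ :  n^{-σ} e^{-iτ log n} *)
Definition npow (n : nat) (s : C) : C :=
  let r := exp (- (fst s) * ln (INR n)) in
  (r * cos (snd s * ln (INR n)), - (r * sin (snd s * ln (INR n)))).

Fixpoint csum (f : nat -> C) (N : nat) : C :=
  match N with
  | O => RtoC 0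
  | S k => Cplus (csum f k) (f (S k))
  end.

(* Dirichlet eta function  η(s) = Σ_{n>=1} (-1)^{n-1} n^{-s}  (convergent for Re s > 0) *)
Definition eta (s : C) : C :=
  (Series (fun n => (-1) ^ n * fst (npow (S n) s)),
   Series (fun n => (-1) ^ n * snd (npow (S n) s))).

(* Riemann zeta on Re s > 0, s <> 1:  ζ(s) = η(s) / (1 - 2^{1-s}) *)
Definition zeta (s : C) : C :=
  Cdiv (eta s) (Cminus (RtoC 1) (npow 2 (Cminus s (RtoC 1)))).

Definition zetaR (x : R) : R := fst (zeta (RtoC x)).

Definition zeta'R (x : R) : R := Derive zetaR x.

Definition euler_gamma : R :=
  Lim_seq (fun n => sum_f_R0 (fun k => / INR (S k)) n - ln (INR (S n))).

Definition gamma1 : R :=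
  / 2 * real (Lim (fun s => Derive_n (fun u => (u - 1) * zetaR u) 2 s) 1).

Definition Dlen (theta tau : R) : nat :=
  if Rlt_dec 0 tau then Z.to_nat (Int_part (Rpower (tau / (2 * PI)) theta)) else O.

Definition Dtheta (theta : R) (s : C) : C :=
  csum (fun n => npow n s) (Dlen theta (snd s)).

Definition M1b1 (theta b T : R) : C :=
  RInt (V := C_R_CompleteNormedModule)
    (fun t => Cmult (Cmult (Dtheta theta (/2, t)) (zeta (/2, - (b * t)))) (zeta (/2, - t)))
    0 T.

Definition lambda_theta (theta : R) : R := 2 / theta - 1.

Definition E_b (b : R) : R :=
  zetaR ((b + 1) / 2) * euler_gamma + b * zeta'R ((b + 1) / 2).

Definition K_b (theta b x : R) : R :=
  theta * zetaR ((b + 1) / 2) * x + E_b b - theta * zetaR ((b + 1) / 2)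
  - theta * zetaR ((b + 1) / 2) * ln (2 * PI).

Definition C_1b1 (theta b : R) : R :=
  4 * b / (theta * (b - 1) * (lambda_theta theta * b + 1))
  * zetaR (1 / (2 * b) + 1 / 2) * Rpower (2 * PI) (theta * (1 / 2 - 1 / (2 * b))).

Definition F01 (theta : R) : R :=
  4 * euler_gamma / (lambda_theta theta + 1) - 4 / (lambda_theta theta + 1) ^ 2.
Definition F11 (theta : R) : R := 2 / (lambda_theta theta + 1).

Definition c1_theta (theta : R) : R :=
  theta * (2 * euler_gamma - F11 theta) - theta ^ 2 * ln (2 * PI).
Definition c0_theta (theta : R) : R :=
  euler_gamma ^ 2 + 2 * gamma1 - F01 theta
  - theta * (2 * euler_gamma - F11 theta) * ln (2 * PI) + theta ^ 2 / 2 * (ln (2 * PI)) ^ 2.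

(* Main.v *)
Require Import Defs.
From Stdlib Require Import Reals Lra Lia Psatz ZArith FunctionalExtensionality.
From Coquelicot Require Import Coquelicot.
Open Scope R_scope.

(** Write [T_n = 2 pi n^(1/theta)] for the time at which the n-th term enters the Dirichlet polynomial, so that
    the moment is the sum over [n <= (T/2pi)^theta] of [n^(-1/2)] times the integral over [[T_n, T]] of
    [n^(-i t) zeta(1/2 - i b t) zeta(1/2 - i t)].  Its integrand is the value at [w = 1/2 - i t] of the holomorphic
    function [n^(w - 1/2) zeta(1/2 + b (w - 1/2)) zeta(w)], and we move the line of integration to [Re w = 3/2].
    On the horizontal sides the convexity bound [zeta(s) << t^((1 - s)/2) log t] (van der Corput's second derivative
    test) costs [T^(1/2) log^2 T] for each [n], in total [T^(1/2 + theta/2) log^2 T]; this is admissible exactly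
    because [theta <= 1/2].  On [Re w = 3/2] both Dirichlet series converge absolutely: the terms with
    [n <> k^b m] contribute [O(N^(3/2) log N)] where [N = (T/2pi)^theta], and the terms with [n = k^b m] give the
    Riesz mean [sum_(k^b m <= N) k^(-(b+1)/2) m^(-1) (T - T_(k^b m))].  Dirichlet's hyperbola method evaluates
    [sum_(k^b m <= x) k^(-(b+1)/2) m^(-1)] up to [O(x^(-1/2) log x)], and integrating over [x = (t/2pi)^theta]
    yields the main terms.  To avoid analytic continuation, zeta is replaced throughout by the truncation
    [sum_(n <= X) n^(-s) - X^(1-s)/(1-s)] with [X] large in terms of [T]. *)

(** * Finite sums and Euler-Maclaurin summation *)

(** The line [Re w = 3/2] is far enough right for every [b]: the first zeta argument then has real
    part [b + 1/2 >= 3/2]. No residue is picked up, because all poles lie on the real axis of [w]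
    while the rectangles live at heights [t >= T_n >= 2 pi]. The horizontal sides rely on
    [n <= sqrt t] for [t >= T_n], another consequence of [theta <= 1/2]: the growth of [n^(x - 1/2)]
    is offset by the decay of the two zeta bounds, so the product stays below [t^(1/2)] up to
    logarithms. The obstacle is that zeta on the critical line is given only as a quotient involving
    a conditionally convergent series. The truncations are elementary functions, differentiable by
    inspection, and their bounds are uniform in large [X]; so [X] may be chosen after [T], beyond
    any power of it, and it disappears from the final estimate. The term with [zeta(1/2 + 1/(2b))]
    does not appear as a residue: it arises in the hyperbola method from cutting the sum over [k] at
    [(x/m)^(1/b)]. *)

Fixpoint rsum (f : nat -> R) (N : nat) : R :=
  match N with
  | O => 0
  | S k => rsum f k + f (S k)
  end.

Lemma rsum_ext f g N : (forall n, (1 <= n <= N)%nat -> f n = g n) -> rsum f N = rsum g N.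
Proof.
induction N as [|N IH]; intros H; simpl; auto.
rewrite IH, H; auto; [lia | intros; apply H; lia].
Qed.

Lemma rsum_le f g N : (forall n, (1 <= n <= N)%nat -> f n <= g n) -> rsum f N <= rsum g N.
Proof.
induction N as [|N IH]; intros H; simpl; [lra|].
apply Rplus_le_compat; [apply IH; intros; apply H; lia | apply H; lia].
Qed.

Lemma rsum_0 N : rsum (fun _ => 0) N = 0.
Proof. induction N; simpl; lra. Qed.

Lemma rsum_const c N : rsum (fun _ => c) N = INR N * c.
Proof. induction N; [simpl; lra|]. cbn [rsum]. rewrite IHN, S_INR; ring. Qed.

Lemma rsum_plus f g N : rsum (fun n => f n + g n) N = rsum f N + rsum g N.
Proof. induction N; simpl; [lra|]. rewrite IHN; ring. Qed.

Lemma rsum_minus f g N : rsum (fun n => f n - g n) N = rsum f N - rsum g N.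
Proof. induction N; simpl; [lra|]. rewrite IHN; ring. Qed.

Lemma rsum_scal c f N : rsum (fun n => c * f n) N = c * rsum f N.
Proof. induction N; simpl; [lra|]. rewrite IHN; ring. Qed.

Lemma rsum_nonneg f N : (forall n, (1 <= n <= N)%nat -> 0 <= f n) -> 0 <= rsum f N.
Proof. intros H. rewrite <- (rsum_0 N). now apply rsum_le. Qed.

Lemma rsum_trunc (f g : nat -> R) M N : (M <= N)%nat ->
  (forall n, (1 <= n <= M)%nat -> g n = f n) -> (forall n, (M < n <= N)%nat -> g n = 0) ->
  rsum g N = rsum f M.
Proof.
induction 1 as [|N H IH]; intros H1 H2; [now apply rsum_ext|].
cbn [rsum]. rewrite IH, H2; [ring | lia | auto | intros; apply H2; lia].
Qed.

Lemma rsum_swap f N M :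
  rsum (fun n => rsum (fun m => f n m) M) N = rsum (fun m => rsum (fun n => f n m) N) M.
Proof.
induction N; simpl; [now rewrite rsum_0|].
now rewrite IHN, rsum_plus.
Qed.

Lemma Rabs_rsum f N : Rabs (rsum f N) <= rsum (fun n => Rabs (f n)) N.
Proof.
induction N; simpl; [rewrite Rabs_R0; lra|].
eapply Rle_trans; [apply Rabs_triang|]. lra.
Qed.

Lemma csum_ext f g N : (forall n, (1 <= n <= N)%nat -> f n = g n) -> csum f N = csum g N.
Proof.
induction N as [|N IH]; intros H; simpl; auto.
rewrite IH, H; auto; [lia | intros; apply H; lia].
Qed.

Lemma csum_minus f g N : csum (fun n => f n - g n)%C N = (csum f N - csum g N)%C.
Proof. induction N; cbn [csum]; [ring|]. rewrite IHN; ring. Qed.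

Lemma csum_scal c f N : csum (fun n => c * f n)%C N = (c * csum f N)%C.
Proof. induction N; cbn [csum]; [ring|]. rewrite IHN; ring. Qed.

Lemma csum_mult f g N M :
  (csum f N * csum g M)%C = csum (fun n => csum (fun m => f n * g m)%C M) N.
Proof.
transitivity (csum (fun n => csum g M * f n)%C N).
- rewrite csum_scal; ring.
- apply csum_ext; intros n _. rewrite csum_scal; ring.
Qed.

Lemma Cmod_csum f N : Cmod (csum f N) <= rsum (fun n => Cmod (f n)) N.
Proof.
induction N; simpl; [rewrite Cmod_0; lra|].
eapply Rle_trans; [apply Cmod_triangle|]. lra.
Qed.

Lemma csum_RtoC f N : csum (fun n => RtoC (f n)) N = RtoC (rsum f N).
Proof. induction N; simpl; auto. now rewrite IHN, RtoC_plus. Qed.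

Lemma fst_csum f N : fst (csum f N) = rsum (fun n => fst (f n)) N.
Proof. induction N; simpl; auto. now rewrite IHN. Qed.

Lemma snd_csum f N : snd (csum f N) = rsum (fun n => snd (f n)) N.
Proof. induction N; simpl; auto. now rewrite IHN. Qed.

(** * Calculus for complex-valued functions of a real variable *)

Lemma derR_minus (f g : R -> R) (x l m : R) : is_derive f x l -> is_derive g x m ->
  is_derive (fun y => f y - g y) x (l - m).
Proof. intros H1 H2. exact (is_derive_minus f g x l m H1 H2). Qed.

Lemma derR_plus (f g : R -> R) (x l m : R) : is_derive f x l -> is_derive g x m ->
  is_derive (fun y => f y + g y) x (l + m).
Proof. intros H1 H2. exact (is_derive_plus f g x l m H1 H2). Qed.

Lemma derR_scal (f : R -> R) (c x l : R) : is_derive f x l ->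
  is_derive (fun y => c * f y) x (c * l).
Proof. intros H1. exact (is_derive_scal f x c l H1). Qed.

Lemma derR_opp (f : R -> R) (x l : R) : is_derive f x l -> is_derive (fun y => - f y) x (- l).
Proof. intros H1. exact (is_derive_opp f x l H1). Qed.

Lemma derR_const (c x : R) : is_derive (fun _ : R => c) x 0.
Proof. exact (is_derive_const c x). Qed.

Lemma derR_mult (f g : R -> R) (x l m : R) : is_derive f x l -> is_derive g x m ->
  is_derive (fun y => f y * g y) x (l * g x + f x * m).
Proof. intros H1 H2. exact (is_derive_mult f g x l m H1 H2 Rmult_comm). Qed.

(** Componentwise, so that each rule below reduces to the real derivative rules. *)
Definition is_dC (f : R -> C) (x : R) (l : C) : Prop :=
  is_derive (fun y => fst (f y)) x (fst l) /\ is_derive (fun y => snd (f y)) x (snd l).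

Lemma Rabs_fst_Cmod z : Rabs (fst z) <= Cmod z.
Proof. eapply Rle_trans; [|apply Rmax_Cmod]. apply Rmax_l. Qed.

Lemma Rabs_snd_Cmod z : Rabs (snd z) <= Cmod z.
Proof. eapply Rle_trans; [|apply Rmax_Cmod]. apply Rmax_r. Qed.

Lemma Cmod_le_abs z : Cmod z <= Rabs (fst z) + Rabs (snd z).
Proof.
replace z with (RtoC (fst z) + Ci * RtoC (snd z))%C at 1.
- eapply Rle_trans; [apply Cmod_triangle|].
  rewrite Cmod_mult, !Cmod_R. replace (Cmod Ci) with 1; [lra|].
  unfold Cmod, Ci; simpl. replace (0 * (0*1) + 1 * (1*1)) with 1 by ring. now rewrite sqrt_1.
- destruct z; unfold Ci, RtoC, Cplus, Cmult; simpl. f_equal; ring.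
Qed.

Lemma Cmod_sqr_eq z : Cmod z * Cmod z = fst z * fst z + snd z * snd z.
Proof. unfold Cmod. rewrite sqrt_sqrt; [ring | nra]. Qed.

Lemma Cmod_dot_le u z : fst u * fst z + snd u * snd z <= Cmod u * Cmod z.
Proof.
assert (H1 := Cmod_sqr_eq u). assert (H2 := Cmod_sqr_eq z).
assert (H3 := Cmod_ge_0 u). assert (H4 := Cmod_ge_0 z).
apply Rsqr_incr_0_var; [|now apply Rmult_le_pos]. unfold Rsqr.
replace (Cmod u * Cmod z * (Cmod u * Cmod z)) with ((Cmod u * Cmod u) * (Cmod z * Cmod z)) by ring.
rewrite H1, H2. assert (X := Rle_0_sqr (fst u * snd z - snd u * fst z)). unfold Rsqr in X. lra.
Qed.

Lemma nondecr_of_derive (h h' : R -> R) (a b : R) : a <= b ->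
  (forall x, a <= x <= b -> is_derive h x (h' x)) ->
  (forall x, a <= x <= b -> 0 <= h' x) -> h a <= h b.
Proof.
intros Hab Hd Hp.
destruct (MVT_gen h a b h') as [c [Hc E]].
- intros x Hx. rewrite Rmin_left, Rmax_right in Hx by lra. apply Hd; lra.
- intros x Hx. rewrite Rmin_left, Rmax_right in Hx by lra.
  apply derivable_continuous_pt. exists (h' x). apply is_derive_Reals, Hd; lra.
- rewrite Rmin_left, Rmax_right in Hc by lra.
  assert (0 <= h' c) by (apply Hp; lra). nra.
Qed.

(** Mean value inequality. Complex functions have no mean value theorem, so [f] is projected on the
    fixed direction [d = f b - f a]: the real function [|d| h - <d, f>] has nonnegative derivative
    by Cauchy-Schwarz, and comparing its end values gives [|d|^2 <= |d| (h b - h a)]. *)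
Lemma Cmod_incr_le (f f' : R -> C) (h h' : R -> R) (a b : R) : a <= b ->
  (forall x, a <= x <= b -> is_dC f x (f' x)) ->
  (forall x, a <= x <= b -> is_derive h x (h' x)) ->
  (forall x, a <= x <= b -> Cmod (f' x) <= h' x) ->
  Cmod (f b - f a)%C <= h b - h a.
Proof.
intros Hab Hf Hh Hle.
set (d := (f b - f a)%C).
assert (Hmono : h a <= h b).
{ apply nondecr_of_derive with h'; auto. intros x Hx. specialize (Hle x Hx).
  assert (H := Cmod_ge_0 (f' x)). lra. }
destruct (Req_dec (Cmod d) 0) as [E|E]; [lra|].
assert (Hp : 0 < Cmod d) by (assert (H := Cmod_ge_0 d); lra).
set (rho := fun x => Cmod d * h x - (fst d * fst (f x) + snd d * snd (f x))).
assert (rho a <= rho b).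
{ apply nondecr_of_derive with
    (fun x => Cmod d * h' x - (fst d * fst (f' x) + snd d * snd (f' x))); auto.
  - intros x Hx. destruct (Hf x Hx) as [H1 H2]. specialize (Hh x Hx). unfold rho.
    apply derR_minus.
    + now apply derR_scal.
    + apply derR_plus; now apply derR_scal.
  - intros x Hx. assert (H := Cmod_dot_le d (f' x)). specialize (Hle x Hx). nra. }
unfold rho in H.
assert (E2 := Cmod_sqr_eq d).
assert (fst d = fst (f b) - fst (f a)) by (unfold d; simpl; ring).
assert (snd d = snd (f b) - snd (f a)) by (unfold d; simpl; ring).
nra.
Qed.

Lemma Rabs_incr_le (f f' h h' : R -> R) (a b : R) : a <= b ->
  (forall x, a <= x <= b -> is_derive f x (f' x)) ->
  (forall x, a <= x <= b -> is_derive h x (h' x)) ->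
  (forall x, a <= x <= b -> Rabs (f' x) <= h' x) ->
  Rabs (f b - f a) <= h b - h a.
Proof.
intros Hab Hf Hh Hle.
rewrite <- Cmod_R, RtoC_minus.
apply (Cmod_incr_le (fun x => RtoC (f x)) (fun x => RtoC (f' x)) h h'); auto.
- intros x Hx. split; simpl; [now apply Hf | apply derR_const].
- intros x Hx. rewrite Cmod_R. now apply Hle.
Qed.

Lemma is_dC_minus f g x l m : is_dC f x l -> is_dC g x m ->
  is_dC (fun y => f y - g y)%C x (l - m)%C.
Proof. intros [H1 H2] [H3 H4]; split; simpl; now apply derR_minus. Qed.

Lemma is_dC_plus f g x l m : is_dC f x l -> is_dC g x m ->
  is_dC (fun y => f y + g y)%C x (l + m)%C.
Proof. intros [H1 H2] [H3 H4]; split; simpl; now apply derR_plus. Qed.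

Lemma is_dC_const c x : is_dC (fun _ => c) x (RtoC 0).
Proof. split; simpl; apply derR_const. Qed.

Lemma is_dC_RtoC f x l : is_derive f x l -> is_dC (fun y => RtoC (f y)) x (RtoC l).
Proof. intros H; split; simpl; [auto | apply derR_const]. Qed.

Lemma is_dC_mult f g x l m : is_dC f x l -> is_dC g x m ->
  is_dC (fun y => f y * g y)%C x (l * g x + f x * m)%C.
Proof.
intros [H1 H2] [H3 H4]; split; simpl.
- replace (fst l * fst (g x) - snd l * snd (g x) + (fst (f x) * fst m - snd (f x) * snd m)) with
   ((fst l * fst (g x) + fst (f x) * fst m) - (snd l * snd (g x) + snd (f x) * snd m)) by ring.
  apply derR_minus; apply derR_mult; auto.
- replace (fst l * snd (g x) + snd l * fst (g x) + (fst (f x) * snd m + snd (f x) * fst m)) with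
   ((fst l * snd (g x) + fst (f x) * snd m) + (snd l * fst (g x) + snd (f x) * fst m)) by ring.
  apply derR_plus; apply derR_mult; auto.
Qed.

(* First-order Euler-Maclaurin summation, with [psi] majorizing the total variation of [f]. *)
Section EulerMaclaurin.
Variables (f f' Phi : R -> C) (psi psi' : R -> R).
Hypothesis HPhi : forall x, 1 <= x -> is_dC Phi x (f x).
Hypothesis Hf : forall x, 1 <= x -> is_dC f x (f' x).
Hypothesis Hpsi : forall x, 1 <= x -> is_derive psi x (psi' x).
Hypothesis Hle : forall x, 1 <= x -> Cmod (f' x) <= - psi' x.

Lemma EM_var a b : 1 <= a <= b -> Cmod (f b - f a)%C <= psi a - psi b.
Proof.
intros Hab.
replace (psi a - psi b) with (- psi b - - psi a) by ring.
apply (Cmod_incr_le f f' (fun x => - psi x) (fun x => - psi' x)); try lra.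
- intros; apply Hf; lra.
- intros; apply derR_opp. apply Hpsi; lra.
- intros; apply Hle; lra.
Qed.

(** The derivative of [x f(b) - Phi(x)] is [f(b) - f(x)], which the variation of [f] over [[a, b]]
    bounds. Working with the primitive [Phi] keeps integrals out of the summation formula. *)
Lemma EM_step a b : 1 <= a <= b ->
  Cmod (RtoC (b - a) * f b - (Phi b - Phi a))%C <= (b - a) * (psi a - psi b).
Proof.
intros Hab.
replace (RtoC (b - a) * f b - (Phi b - Phi a))%C with
  ((RtoC b * f b - Phi b) - (RtoC a * f b - Phi a))%C by (rewrite RtoC_minus; ring).
replace ((b - a) * (psi a - psi b)) with (b * (psi a - psi b) - a * (psi a - psi b)) by ring.
apply (Cmod_incr_le (fun x => RtoC x * f b - Phi x)%C (fun x => f b - f x)%C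
  (fun x => x * (psi a - psi b)) (fun x => psi a - psi b)); try lra.
- intros x Hx. apply is_dC_minus; [|apply HPhi; lra].
  split; simpl; auto_derive; auto; ring.
- intros x Hx. auto_derive; auto; ring.
- intros x Hx. eapply Rle_trans; [apply EM_var; lra|].
  assert (H : Cmod (f x - f a)%C <= psi a - psi x) by (apply EM_var; lra).
  assert (H2 := Cmod_ge_0 (f x - f a)%C). lra.
Qed.

(** Over unit steps the errors [psi n - psi (n + 1)] telescope. *)
Lemma EM_sum M N : (1 <= M <= N)%nat ->
  Cmod ((csum (fun n => f (INR n)) N - Phi (INR N))
        - (csum (fun n => f (INR n)) M - Phi (INR M)))%C <= psi (INR M) - psi (INR N).
Proof.
intros [HM HN].
induction HN as [|N HN IH].
- match goal with |- Cmod ?z <= _ => replace z with (RtoC 0) by ring end.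
  rewrite Cmod_0; lra.
- change (csum (fun n => f (INR n)) (S N)) with
    (csum (fun n => f (INR n)) N + f (INR (S N)))%C.
  assert (H1 : 1 <= INR N) by (apply (le_INR 1); lia).
  assert (H := EM_step (INR N) (INR (S N))).
  rewrite S_INR in *.
  assert (H2 : 1 <= INR N <= INR N + 1) by lra. specialize (H H2).
  replace (INR N + 1 - INR N) with 1 in H by ring.
  match goal with |- Cmod ?z <= _ => replace z with
   (((csum (fun n => f (INR n)) N - Phi (INR N)) - (csum (fun n => f (INR n)) M - Phi (INR M)))
   + (1 * f (INR N + 1) - (Phi (INR N + 1) - Phi (INR N))))%C by ring end.
  eapply Rle_trans; [apply Cmod_triangle|]. lra.
Qed.
End EulerMaclaurin.

(** The Cauchy estimate holds at rate [e M] uniformly in [N], so letting [N] tend to infinity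
    transfers the same rate to the limit. Convergence is proved for one coordinate [p] at a time,
    using only that [p] is subtractive and bounded by [Cmod]. *)
Lemma Clim_exists (z : nat -> C) (e : nat -> R) :
  (forall M N, (1 <= M <= N)%nat -> Cmod (z N - z M)%C <= e M) ->
  is_lim_seq e 0 ->
  exists l : C, forall M, (1 <= M)%nat -> Cmod (l - z M)%C <= e M.
Proof.
intros H He.
assert (Hc : forall p : C -> R, (forall a, Rabs (p a) <= Cmod a) ->
   (forall a b, p (a - b)%C = p a - p b) -> exists l, is_lim_seq (fun n => p (z n)) (Finite l)).
{ intros p Hp Hm.
  assert (Hex : ex_finite_lim_seq (fun n => p (z n))).
  { apply ex_lim_seq_cauchy_corr. intros eps.
    apply is_lim_seq_spec in He. 
    assert (Heps : 0 < eps / 2) by (destruct eps; simpl; lra).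
    destruct (He (mkposreal _ Heps)) as [N0 HN0]. simpl in HN0.
    exists (S N0). intros n m Hn Hm'.
    assert (HK : forall k, (S N0 <= k)%nat -> Rabs (p (z k) - p (z (S N0))) < eps/2).
    { intros k Hk. rewrite <- Hm. eapply Rle_lt_trans; [apply Hp|].
      eapply Rle_lt_trans; [apply H; lia|].
      assert (X := HN0 (S N0)). rewrite Rminus_0_r in X.
      eapply Rle_lt_trans; [apply Rle_abs|]. apply X; lia. }
    replace (p (z n) - p (z m)) with ((p (z n) - p (z (S N0))) - (p (z m) - p (z (S N0)))) by ring.
    eapply Rle_lt_trans; [apply Rabs_triang|]. rewrite Rabs_Ropp.
    assert (X1 := HK n Hn). assert (X2 := HK m Hm'). lra. }
  destruct Hex as [l Hl]. now exists l. }
destruct (Hc fst Rabs_fst_Cmod) as [l1 H1]; [intros; simpl; ring|].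
destruct (Hc snd Rabs_snd_Cmod) as [l2 H2]; [intros; simpl; ring|].
exists (l1, l2). intros M HM.
assert (Hl : is_lim_seq (fun n => Cmod (z n - z M)%C) (Cmod ((l1,l2) - z M)%C)).
{ unfold Cmod. simpl.
  apply (is_lim_seq_continuous sqrt
   (fun n => (fst (z n) + - fst (z M)) * ((fst (z n) + - fst (z M)) * 1)
     + (snd (z n) + - snd (z M)) * ((snd (z n) + - snd (z M)) * 1))).
  - apply continuity_pt_filterlim. exact (continuous_sqrt _).
  - apply is_lim_seq_plus'; repeat apply is_lim_seq_mult'; try apply is_lim_seq_const;
    apply is_lim_seq_plus'; auto; apply is_lim_seq_const. }
assert (X := is_lim_seq_le_loc _ (fun _ => e M) _ (Finite (e M)) 
   (ex_intro _ M (fun n Hn => H M n (conj HM Hn))) Hl (is_lim_seq_const _)).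
exact X.
Qed.

(** * Truncations of the zeta function *)

Definition cexp (z : C) : C := (exp (fst z) * cos (snd z), exp (fst z) * sin (snd z)).

Lemma cexp_plus z w : cexp (z + w)%C = (cexp z * cexp w)%C.
Proof.
unfold cexp, Cmult, Cplus; simpl. rewrite exp_plus, cos_plus, sin_plus. f_equal; ring.
Qed.

Lemma cexp_0 : cexp (RtoC 0) = RtoC 1.
Proof. unfold cexp, RtoC; simpl. rewrite exp_0, cos_0, sin_0. f_equal; ring. Qed.

Lemma Cmod_cexp z : Cmod (cexp z) = exp (fst z).
Proof.
assert (H := Cmod_sqr_eq (cexp z)). unfold cexp in H at 3 4 5 6; simpl in H.
assert (H2 := sin2_cos2 (snd z)). unfold Rsqr in H2.
assert (H3 : Cmod (cexp z) * Cmod (cexp z) = exp (fst z) * exp (fst z)).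
{ rewrite H. replace (exp (fst z) * cos (snd z) * (exp (fst z) * cos (snd z)) +
   exp (fst z) * sin (snd z) * (exp (fst z) * sin (snd z))) with
   (exp (fst z) * exp (fst z) * (sin (snd z) * sin (snd z) + cos (snd z) * cos (snd z))) by ring.
  rewrite H2; ring. }
assert (H4 := Cmod_ge_0 (cexp z)). assert (H5 := exp_pos (fst z)). nra.
Qed.

Lemma cexp_RtoC x : cexp (RtoC x) = RtoC (exp x).
Proof. unfold cexp, RtoC; simpl. rewrite cos_0, sin_0. f_equal; ring. Qed.

Lemma is_dC_cexp g x l : is_dC g x l -> is_dC (fun y => cexp (g y)) x (l * cexp (g x))%C.
Proof.
intros [H1 H2]. unfold cexp; split; simpl.
- replace (fst l * (exp (fst (g x)) * cos (snd (g x))) - snd l * (exp (fst (g x)) * sin (snd (g x))))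
  with ((fst l * exp (fst (g x))) * cos (snd (g x)) + exp (fst (g x)) * (snd l * - sin (snd (g x)))) by ring.
  apply (derR_mult (fun y => exp (fst (g y))) (fun y => cos (snd (g y)))).
  + exact (is_derive_comp exp (fun y => fst (g y)) x _ _ (is_derive_exp _) H1).
  + exact (is_derive_comp cos (fun y => snd (g y)) x _ _ (is_derive_cos _) H2).
- replace (fst l * (exp (fst (g x)) * sin (snd (g x))) + snd l * (exp (fst (g x)) * cos (snd (g x))))
  with ((fst l * exp (fst (g x))) * sin (snd (g x)) + exp (fst (g x)) * (snd l * cos (snd (g x)))) by ring.
  apply (derR_mult (fun y => exp (fst (g y))) (fun y => sin (snd (g y)))).
  + exact (is_derive_comp exp (fun y => fst (g y)) x _ _ (is_derive_exp _) H1).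
  + exact (is_derive_comp sin (fun y => snd (g y)) x _ _ (is_derive_sin _) H2).
Qed.

Definition cpow (x : R) (s : C) : C := cexp (- RtoC (ln x) * s)%C.

Lemma npow_cpow n s : npow n s = cpow (INR n) s.
Proof.
unfold npow, cpow, cexp; simpl.
replace ((- ln (INR n)) * fst s - -0 * snd s) with (- fst s * ln (INR n)) by ring.
replace (- ln (INR n) * snd s + -0 * fst s) with (- (snd s * ln (INR n))) by ring.
rewrite cos_neg, sin_neg. f_equal; ring.
Qed.

Lemma cpow_plus x s w : cpow x (s + w)%C = (cpow x s * cpow x w)%C.
Proof. unfold cpow. rewrite <- cexp_plus. f_equal; ring. Qed.

Lemma cpow_1l s : cpow 1 s = RtoC 1.
Proof. unfold cpow. rewrite ln_1. replace (- RtoC 0 * s)%C with (RtoC 0) by ring. apply cexp_0. Qed.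

Lemma cpow_mult x y s : 0 < x -> 0 < y -> cpow (x * y) s = (cpow x s * cpow y s)%C.
Proof.
intros Hx Hy. unfold cpow. rewrite <- cexp_plus, ln_mult, RtoC_plus by auto. f_equal; ring.
Qed.

Lemma Cmod_cpow x s : Cmod (cpow x s) = Rpower x (- fst s).
Proof. unfold cpow. rewrite Cmod_cexp. unfold Rpower; simpl. f_equal; ring. Qed.

Lemma cpow_RtoC x a : cpow x (RtoC a) = RtoC (Rpower x (- a)).
Proof.
unfold cpow. rewrite <- RtoC_opp, <- RtoC_mult, cexp_RtoC. unfold Rpower. do 2 f_equal; ring.
Qed.

Lemma cpow_m1 x : 0 < x -> cpow x (- RtoC 1)%C = RtoC x.
Proof.
intros Hx. rewrite <- RtoC_opp, cpow_RtoC, Ropp_involutive, Rpower_1; auto.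
Qed.

Lemma cpow_pred x s : 0 < x -> cpow x (s - 1)%C = (RtoC x * cpow x s)%C.
Proof. intros Hx. unfold Cminus. rewrite cpow_plus, cpow_m1 by auto. ring. Qed.

Lemma cpow_succ x s : 0 < x -> cpow x (s + 1)%C = (RtoC (/ x) * cpow x s)%C.
Proof.
intros Hx. rewrite cpow_plus. rewrite (cpow_RtoC x 1), Rpower_Ropp, Rpower_1 by auto. ring.
Qed.

Lemma is_dC_cpow x s : 0 < x -> is_dC (fun y => cpow y s) x (- s * cpow x (s + 1))%C.
Proof.
intros Hx. unfold cpow at 1.
assert (H : is_dC (fun y => - RtoC (ln y) * s)%C x (- RtoC (/ x) * s)%C).
{ split; simpl; auto_derive; auto; field; lra. }
apply is_dC_cexp in H.
replace (- s * cpow x (s + 1))%C with (- RtoC (/ x) * s * cexp (- RtoC (ln x) * s))%C; auto.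
rewrite cpow_succ by auto. unfold cpow. ring.
Qed.

Lemma is_derive_Rpower x a : 0 < x -> is_derive (fun y => Rpower y a) x (a * Rpower x (a - 1)).
Proof.
intros Hx. unfold Rpower. auto_derive; auto.
replace ((a - 1) * ln x) with (a * ln x + - ln x) by ring.
rewrite exp_plus, exp_Ropp, exp_ln by auto. field; lra.
Qed.

Lemma C1_minus_neq0 (s : C) : s <> RtoC 1 -> (1 - s)%C <> RtoC 0.
Proof. intros H E. apply H. replace s with (1 - (1 - s))%C by ring. rewrite E. ring. Qed.

(* Converges to [zeta s] for [Re s > 0], [s <> 1], with error [O(|s| X^(-Re s))]. *)
Definition Zeta_ps (X : nat) (s : C) : C :=
  (csum (fun n => npow n s) X - cpow (INR X) (s - 1) / (1 - s))%C.

(** Euler-Maclaurin for [x^(-s)] with primitive [x^(1-s)/(1-s)]. The majorant [|s|/sigma x^(-sigma)]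
    is exact: minus its derivative equals the modulus of the derivative of [x^(-s)]. *)
Lemma Zeta_ps_diff X Y (s : C) : 0 < fst s -> s <> RtoC 1 -> (1 <= X <= Y)%nat ->
  Cmod (Zeta_ps Y s - Zeta_ps X s)%C <=
  Cmod s / fst s * (Rpower (INR X) (- fst s) - Rpower (INR Y) (- fst s)).
Proof.
intros Hs Hs1 HXY.
assert (H1s := C1_minus_neq0 s Hs1).
assert (H := EM_sum (fun x => cpow x s) (fun x => - s * cpow x (s + 1))%C
  (fun x => cpow x (s - 1) / (1 - s))%C
  (fun x => Cmod s / fst s * Rpower x (- fst s))
  (fun x => Cmod s / fst s * (- fst s * Rpower x (- fst s - 1)))).
unfold Zeta_ps.
rewrite (csum_ext (fun n => npow n s) (fun n => cpow (INR n) s) Y) by (intros; apply npow_cpow).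
rewrite (csum_ext (fun n => npow n s) (fun n => cpow (INR n) s) X) by (intros; apply npow_cpow).
rewrite Rmult_minus_distr_l.
apply H; auto; clear H.
- intros x Hx.
  assert (D := is_dC_mult _ _ _ _ _ (is_dC_cpow x (s - 1) ltac:(lra)) (is_dC_const (/ (1 - s))%C x)).
  replace (cpow x s) with (- (s - 1) * cpow x (s - 1 + 1) * / (1 - s) + cpow x (s - 1) * RtoC 0)%C.
  { exact D. }
  replace (s - 1 + 1)%C with s by ring. field. auto.
- intros x Hx. apply is_dC_cpow. lra.
- intros x Hx. apply derR_scal. apply is_derive_Rpower. lra.
- intros x Hx. rewrite Cmod_mult, Cmod_opp, Cmod_cpow. simpl.
  replace (- (fst s + 1)) with (- fst s - 1) by ring.
  right. field. lra.
Qed.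

Lemma is_lim_seq_Rpower_neg a : 0 < a -> is_lim_seq (fun n => Rpower (INR n) (- a)) 0.
Proof.
intros Ha. unfold Rpower.
apply (is_lim_comp_seq exp (fun n => - a * ln (INR n)) m_infty).
- exact is_lim_exp_m.
- exists O; intros; discriminate.
- replace m_infty with (Rbar_mult (Finite (- a)) p_infty).
  + apply is_lim_seq_scal_l.
    apply (is_lim_comp_seq ln INR p_infty).
    * exact is_lim_ln_p.
    * exists O; intros; discriminate.
    * apply is_lim_seq_INR.
  + simpl. destruct (Rle_dec 0 (-a)); [exfalso; lra | reflexivity].
Qed.

Lemma Zeta_ps_lim (s : C) : 0 < fst s -> s <> RtoC 1 ->
  exists l : C, forall X, (1 <= X)%nat ->
    Cmod (l - Zeta_ps X s)%C <= Cmod s / fst s * Rpower (INR X) (- fst s).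
Proof.
intros Hs Hs1.
apply (Clim_exists (fun X => Zeta_ps X s) (fun X => Cmod s / fst s * Rpower (INR X) (- fst s))).
- intros M N H. eapply Rle_trans; [apply Zeta_ps_diff; auto|].
  apply Rmult_le_compat_l.
  + apply Rdiv_le_0_compat; [apply Cmod_ge_0 | auto].
  + assert (H2 : 0 < Rpower (INR N) (- fst s)) by apply exp_pos. lra.
- replace (Finite 0) with (Rbar_mult (Cmod s / fst s) 0) by (simpl; f_equal; ring).
  apply is_lim_seq_scal_l, is_lim_seq_Rpower_neg; auto.
Qed.

(** * From the alternating series to the truncations *)

Lemma eta_partial_sum s N :
  csum (fun n => RtoC ((-1) ^ (pred n)) * npow n s)%C (2 * N) =
  (csum (fun n => npow n s) (2 * N) - 2 * npow 2 s * csum (fun n => npow n s) N)%C.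
Proof.
induction N as [|N IH]; [simpl; ring|].
replace (2 * S N)%nat with (S (S (2 * N))) by lia.
cbn [csum]. rewrite IH.
change (pred (S (S (2 * N)))) with (S (2 * N)). change (pred (S (2 * N))) with (2 * N)%nat.
rewrite pow_1_odd, pow_1_even.
assert (E : npow (S (S (2 * N))) s = (npow 2 s * npow (S N) s)%C).
{ rewrite !npow_cpow, <- cpow_mult; [|simpl; lra | apply lt_0_INR; lia].
  f_equal. rewrite <- mult_INR. f_equal. lia. }
rewrite E. replace (RtoC (-1)) with (- RtoC 1)%C by (rewrite <- RtoC_opp; f_equal; lra). ring.
Qed.

(** The two boundary terms cancel, since [2^(1-s) N^(1-s) = (2N)^(1-s)]. The even partial sums of
    the eta series are thus expressed by truncations alone, which links the quotient defining [zeta]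
    to [Zeta_ps]. *)
Lemma Zeta_ps_double (s : C) N : (1 <= N)%nat -> s <> RtoC 1 ->
  csum (fun n => RtoC ((-1) ^ (pred n)) * npow n s)%C (2 * N) =
  (Zeta_ps (2 * N) s - npow 2 (s - 1) * Zeta_ps N s)%C.
Proof.
intros HN Hs1. rewrite eta_partial_sum. unfold Zeta_ps.
assert (H1s := C1_minus_neq0 s Hs1).
rewrite !npow_cpow.
replace (INR (2 * N)) with (INR 2 * INR N) by (now rewrite mult_INR).
assert (0 < INR N) by (apply lt_0_INR; lia).
rewrite cpow_mult; [|simpl; lra | auto].
rewrite (cpow_pred (INR 2)) by (simpl; lra).
replace (INR 2) with 2 by (simpl; lra). field. auto.
Qed.

Lemma is_lim_seq_even_odd (u : nat -> R) l :
  is_lim_seq (fun n => u (2 * n)%nat) l -> is_lim_seq (fun n => u (S (2 * n))) l -> is_lim_seq u l.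
Proof.
intros H1 H2. 
intros P HP. destruct (H1 P HP) as [N1 HN1]. destruct (H2 P HP) as [N2 HN2].
exists (2 * (N1 + N2))%nat. intros n Hn.
destruct (Nat.Even_or_Odd n) as [[k Hk]|[k Hk]].
- rewrite Hk. apply HN1. lia.
- replace n with (S (2 * k)) by lia. apply HN2. lia.
Qed.

Lemma rsum_sum_n f N : rsum f (S N) = sum_n (fun n => f (S n)) N.
Proof.
induction N.
- simpl. rewrite sum_O. ring.
- rewrite sum_Sn. rewrite <- IHN. reflexivity.
Qed.

Lemma Cmod_lim_comp (z : nat -> C) (l : C) (e : nat -> R) (N0 : nat) :
  (forall n, (N0 <= n)%nat -> Cmod (z n - l)%C <= e n) -> is_lim_seq e 0 ->
  is_lim_seq (fun n => fst (z n)) (fst l) /\ is_lim_seq (fun n => snd (z n)) (snd l).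
Proof.
intros H He.
assert (G : forall p : C -> R, (forall a, Rabs (p a) <= Cmod a) ->
   (forall a b, p (a - b)%C = p a - p b) -> is_lim_seq (fun n => p (z n)) (p l)).
{ intros p Hp Hm. apply is_lim_seq_spec. intros eps. apply is_lim_seq_spec in He.
  destruct (He eps) as [N HN]. exists (N0 + N)%nat. intros n Hn.
  rewrite <- Hm. eapply Rle_lt_trans; [apply Hp|]. eapply Rle_lt_trans; [apply H; lia|].
  assert (X := HN n ltac:(lia)). rewrite Rminus_0_r in X.
  eapply Rle_lt_trans; [apply Rle_abs | apply X]. }
split; apply G; auto using Rabs_fst_Cmod, Rabs_snd_Cmod; intros; simpl; ring.
Qed.

Lemma is_lim_seq_subseq_double (u : nat -> R) l : is_lim_seq u l -> is_lim_seq (fun n => u (2 * n)%nat) l.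
Proof.
intros H. apply (is_lim_seq_subseq u l (fun n => (2 * n)%nat)); auto.
intros P [N HN]. exists N. intros n Hn. apply HN. lia.
Qed.

(** Even partial sums converge by [Zeta_ps_double]; an odd one differs from the next even one by a
    single term that tends to 0. The two subsequences together give convergence of the series,
    coordinate by coordinate. *)
Lemma eta_zeta (s l : C) : 0 < fst s -> s <> RtoC 1 ->
  (forall X, (1 <= X)%nat -> Cmod (l - Zeta_ps X s)%C <= Cmod s / fst s * Rpower (INR X) (- fst s)) ->
  eta s = ((1 - npow 2 (s - 1)) * l)%C.
Proof.
intros Hs Hs1 Hl.
set (a := fun n => (RtoC ((-1) ^ (pred n)) * npow n s)%C).
set (L := ((1 - npow 2 (s - 1)) * l)%C).
set (q := npow 2 (s - 1)) in *.
set (c := Cmod s / fst s).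
assert (Hdec : is_lim_seq (fun n => Rpower (INR n) (- fst s)) 0) by (apply is_lim_seq_Rpower_neg; auto).
assert (Hdec2 := is_lim_seq_subseq_double _ _ Hdec).
assert (HE : forall n, (1 <= n)%nat -> Cmod (csum a (2 * n) - L)%C <=
   c * Rpower (INR (2 * n)) (- fst s) + Cmod q * (c * Rpower (INR n) (- fst s))).
{ intros n Hn. unfold a. rewrite Zeta_ps_double by auto. fold q.
  replace (Zeta_ps (2 * n) s - q * Zeta_ps n s - L)%C with
   (- (l - Zeta_ps (2 * n) s) + q * (l - Zeta_ps n s))%C by (unfold L; ring).
  eapply Rle_trans; [apply Cmod_triangle|]. rewrite Cmod_opp, Cmod_mult.
  apply Rplus_le_compat.
  - apply Hl; lia.
  - apply Rmult_le_compat_l; [apply Cmod_ge_0 | apply Hl; lia]. }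
set (e1 := fun n => c * Rpower (INR (2 * n)) (- fst s) + Cmod q * (c * Rpower (INR n) (- fst s))).
assert (He1 : is_lim_seq e1 0).
{ replace (Finite 0) with (Finite (c * 0 + Cmod q * (c * 0))) by (f_equal; ring).
  apply is_lim_seq_plus'.
  - now apply (is_lim_seq_scal_l _ c (Finite 0)).
  - apply (is_lim_seq_scal_l _ (Cmod q) (Finite (c * 0))).
    now apply (is_lim_seq_scal_l _ c (Finite 0)). }
set (e2 := fun n => e1 (S n) + Rpower (INR (2 * S n)) (- fst s)).
assert (He2 : is_lim_seq e2 0).
{ replace (Finite 0) with (Finite (0 + 0)) by (f_equal; ring).
  apply is_lim_seq_plus'.
  - now apply (is_lim_seq_incr_1 e1).
  - now apply (is_lim_seq_incr_1 (fun n => Rpower (INR (2 * n)) (- fst s))). }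
assert (HO : forall n, (0 <= n)%nat -> Cmod (csum a (S (2 * n)) - L)%C <= e2 n).
{ intros n _.
  replace (csum a (S (2 * n)) - L)%C with ((csum a (2 * S n) - L) - a (2 * S n)%nat)%C.
  2:{ replace (2 * S n)%nat with (S (S (2 * n))) by lia. cbn [csum]. ring. }
  unfold Cminus at 1.
  eapply Rle_trans; [apply Cmod_triangle|]. apply Rplus_le_compat; [apply HE; lia|].
  rewrite Cmod_opp. unfold a. rewrite Cmod_mult, npow_cpow, Cmod_cpow, Cmod_R, pow_1_abs. lra. }
destruct (Cmod_lim_comp (fun n => csum a (2 * n)) L e1 1 HE He1) as [F1 F2].
destruct (Cmod_lim_comp (fun n => csum a (S (2 * n))) L e2 0 HO He2) as [F3 F4].
assert (G1 := is_lim_seq_even_odd (fun n => fst (csum a n)) _ F1 F3).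
assert (G2 := is_lim_seq_even_odd (fun n => snd (csum a n)) _ F2 F4).
rewrite is_lim_seq_incr_1 in G1. rewrite is_lim_seq_incr_1 in G2.
unfold eta. rewrite (surjective_pairing L). f_equal.
- apply is_series_unique.
  apply (is_lim_seq_ext _ (sum_n (fun n => (-1) ^ n * fst (npow (S n) s))) (fst L)) in G1; [exact G1|].
  intros n. rewrite fst_csum, rsum_sum_n.
  apply sum_n_ext. intros k. unfold a. simpl. ring.
- apply is_series_unique.
  apply (is_lim_seq_ext _ (sum_n (fun n => (-1) ^ n * snd (npow (S n) s))) (snd L)) in G2; [exact G2|].
  intros n. rewrite snd_csum, rsum_sum_n.
  apply sum_n_ext. intros k. unfold a. simpl. ring.
Qed.

(** The third hypothesis excludes the points [1 + 2 pi i k / log 2], where the quotient defining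
    [zeta] is [0/0]. On the critical line and on the real axis away from 1 it follows from
    [|2^(1-s)| <> 1]. *)
Lemma zeta_approx (s : C) X : 0 < fst s -> s <> RtoC 1 -> (1 - npow 2 (s - 1))%C <> RtoC 0 ->
  (1 <= X)%nat ->
  Cmod (zeta s - Zeta_ps X s)%C <= Cmod s / fst s * Rpower (INR X) (- fst s).
Proof.
intros Hs Hs1 Hq HX.
destruct (Zeta_ps_lim s Hs Hs1) as [l Hl].
assert (E : zeta s = l).
{ unfold zeta. rewrite (eta_zeta s l Hs Hs1 Hl). field. auto. }
rewrite E. auto.
Qed.

Lemma zeta_approx_half (t : R) X : (1 <= X)%nat ->
  Cmod (zeta ((/2)%R, t) - Zeta_ps X ((/2)%R, t))%C <= 2 * Cmod ((/2)%R, t) * Rpower (INR X) (- / 2).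
Proof.
intros HX.
replace (2 * Cmod ((/2)%R, t) * Rpower (INR X) (- / 2)) with
  (Cmod ((/2)%R, t) / fst ((/2)%R, t) * Rpower (INR X) (- fst ((/2)%R, t))) by (simpl; field).
apply zeta_approx; simpl; auto; try lra.
- intros E. apply (f_equal fst) in E. simpl in E. lra.
- intros E. assert (E2 : npow 2 (((/2)%R, t) - 1)%C = RtoC 1).
  { replace (npow 2 (((/2)%R, t) - 1)%C) with (1 - (1 - npow 2 (((/2)%R, t) - 1)))%C by ring. rewrite E. ring. }
  apply (f_equal Cmod) in E2. rewrite npow_cpow, Cmod_cpow, Cmod_1 in E2. simpl in E2.
  assert (1 < Rpower (1 + 1) (- (/ 2 + -(1)))); [|lra].
  rewrite <- (Rpower_O (1 + 1)) at 1 by lra. apply Rpower_lt; lra.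
Qed.

Lemma zetaR_approx x X : 0 < x -> x <> 1 -> (1 <= X)%nat ->
  Rabs (zetaR x - (rsum (fun n => Rpower (INR n) (- x)) X - Rpower (INR X) (1 - x) / (1 - x)))
  <= Rpower (INR X) (- x).
Proof.
intros Hx Hx1 HX.
assert (Hn1 : RtoC x <> RtoC 1) by (intros E; apply (f_equal fst) in E; simpl in E; lra).
assert (H : Cmod (zeta (RtoC x) - Zeta_ps X (RtoC x))%C <= Cmod (RtoC x) / x * Rpower (INR X) (- x)).
{ apply (zeta_approx (RtoC x)); auto.
  intros E. assert (E2 : npow 2 (RtoC x - 1)%C = RtoC 1).
  { replace (npow 2 (RtoC x - 1)%C) with (1 - (1 - npow 2 (RtoC x - 1)))%C by ring. rewrite E. ring. }
  rewrite npow_cpow, <- RtoC_minus, cpow_RtoC in E2. apply (f_equal fst) in E2. simpl in E2.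
  destruct (Rlt_or_le x 1).
  - assert (1 < Rpower (1 + 1) (- (x - 1))); [|lra].
    rewrite <- (Rpower_O (1 + 1)) at 1 by lra. apply Rpower_lt; lra.
  - assert (Hlt := Rpower_lt (1 + 1) (- (x - 1)) 0 ltac:(lra) ltac:(lra)).
    rewrite Rpower_O in Hlt by lra. lra. }
rewrite Cmod_R, Rabs_pos_eq in H by lra.
replace (x / x * Rpower (INR X) (- x)) with (Rpower (INR X) (- x)) in H by (field; lra).
eapply Rle_trans; [|exact H].
eapply Rle_trans; [|apply Rabs_fst_Cmod]. right. f_equal.
unfold zetaR, Zeta_ps.
rewrite (csum_ext _ (fun n => RtoC (Rpower (INR n) (- x)))).
2:{ intros n _. now rewrite npow_cpow, cpow_RtoC. }
rewrite csum_RtoC, <- !RtoC_minus, cpow_RtoC, <- RtoC_div by lra.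
simpl. replace (- (x - 1)) with (1 - x) by ring. ring.
Qed.

(** * Exponential sums *)

Definition cis (x : R) : C := (cos x, sin x).

Lemma Cmod_cis x : Cmod (cis x) = 1.
Proof.
unfold cis, Cmod; simpl. assert (H := sin2_cos2 x). unfold Rsqr in H.
replace (cos x * (cos x * 1) + sin x * (sin x * 1)) with 1 by lra. apply sqrt_1.
Qed.

Lemma cis_plus x y : cis (x + y) = (cis x * cis y)%C.
Proof. unfold cis, Cmult; simpl. rewrite cos_plus, sin_plus. f_equal; ring. Qed.

Lemma cis_period x (k : nat) : cis (x - 2 * INR k * PI) = cis x.
Proof.
unfold cis. rewrite <- (cos_period (x - 2 * INR k * PI) k), <- (sin_period (x - 2 * INR k * PI) k).
f_equal; f_equal; ring.
Qed.

Lemma sin_ge_half x : 0 <= x <= 1 -> x / 2 <= sin x.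
Proof.
intros Hx. assert (HPI := PI2_3_2).
assert (H : 0 <= sin x - x / 2); [|lra].
replace 0 with (sin 0 - 0 / 2) by (rewrite sin_0; lra).
apply (nondecr_of_derive (fun x => sin x - x / 2) (fun x => cos x - /2)); try lra.
- intros y Hy. auto_derive; auto; lra.
- intros y Hy. assert (cos (PI / 3) <= cos y) by (apply cos_decr_1; lra).
  rewrite cos_PI3 in H. lra.
Qed.

Lemma sin_half_lower x d : 0 < d <= 1 -> d <= x <= 2 * PI - d -> d / 4 <= sin (x / 2).
Proof.
intros Hd Hx. 
assert (H : d / 4 <= sin (d / 2)) by (assert (X := sin_ge_half (d/2)); lra).
destruct (Rle_or_lt (x / 2) (PI / 2)).
- assert (sin (d / 2) <= sin (x / 2)) by (apply sin_incr_1; lra). lra.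
- rewrite <- sin_PI_x. assert (sin (d / 2) <= sin (PI - x / 2)) by (apply sin_incr_1; lra). lra.
Qed.

(* [1 / (1 - cis x) = 1/2 + (i/2) cot (x/2)] *)
Definition kl_coef (x : R) : C := (/ 2, / 2 * (cos (x / 2) / sin (x / 2))).

Lemma kl_coef_spec x : sin (x / 2) <> 0 -> (kl_coef x * (1 - cis x))%C = RtoC 1.
Proof.
intros Hs. assert (H := sin2_cos2 (x / 2)). unfold Rsqr in H.
assert (Hc : cos x = 1 - 2 * sin (x / 2) * sin (x / 2)) by (rewrite <- cos_2a_sin; f_equal; field).
assert (Hx : sin x = 2 * sin (x / 2) * cos (x / 2)) by (rewrite <- sin_2a; f_equal; field).
unfold kl_coef, cis, Cmult, Cminus, Copp, Cplus, RtoC; cbn [fst snd]. rewrite Hc, Hx.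
f_equal; [|field; auto].
transitivity (sin (x/2) * sin (x/2) + cos (x/2) * cos (x/2)); [|auto]. field. auto.
Qed.

Lemma cot_bound x d : 0 < d <= 1 -> d <= x <= 2 * PI - d ->
  Rabs (cos (x / 2) / sin (x / 2)) <= 4 / d.
Proof.
intros Hd Hx. assert (H := sin_half_lower x d Hd Hx).
unfold Rdiv. rewrite Rabs_mult, Rabs_inv.
rewrite (Rabs_pos_eq (sin _)) by lra.
assert (H1 : Rabs (cos (x * / 2)) <= 1) by (apply Rabs_le; apply COS_bound).
assert (/ sin (x / 2) <= / (d / 4)) by (apply Rinv_le_contravar; lra).
replace (4 * / d) with (1 * / (d / 4)) by (field; lra).
apply Rmult_le_compat; auto using Rabs_pos.
left; apply Rinv_0_lt_compat. unfold Rdiv in H; lra.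
Qed.

Lemma kl_coef_bound x d : 0 < d <= 1 -> d <= x <= 2 * PI - d -> Cmod (kl_coef x) <= 4 / d.
Proof.
intros Hd Hx. eapply Rle_trans; [apply Cmod_le_abs|]. unfold kl_coef; simpl.
rewrite Rabs_mult, Rabs_pos_eq by lra.
assert (H := cot_bound x d Hd Hx).
assert (1 <= / d) by (rewrite <- Rinv_1; apply Rinv_le_contravar; lra).
unfold Rdiv in *. lra.
Qed.

Lemma cot_decr x y d : 0 < d <= 1 -> d <= x -> x <= y -> y <= 2 * PI - d ->
  cos (y / 2) / sin (y / 2) <= cos (x / 2) / sin (x / 2).
Proof.
intros Hd Hx Hxy Hy.
assert (H1 := sin_half_lower x d Hd ltac:(lra)). assert (H2 := sin_half_lower y d Hd ltac:(lra)).
assert (H3 : 0 <= sin (y / 2 - x / 2)) by (apply sin_ge_0; lra).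
rewrite sin_minus in H3.
assert (E : cos (x / 2) / sin (x / 2) - cos (y / 2) / sin (y / 2) =
  (sin (y / 2) * cos (x / 2) - cos (y / 2) * sin (x / 2)) / (sin (x / 2) * sin (y / 2))).
{ field. lra. }
assert (0 <= (sin (y / 2) * cos (x / 2) - cos (y / 2) * sin (x / 2)) / (sin (x / 2) * sin (y / 2))).
{ apply Rdiv_le_0_compat; [lra | nra]. }
lra.
Qed.

Section ExponentialSums.
Variables (z : nat -> C) (g : nat -> R).
Hypothesis Hz1 : forall n, Cmod (z n) = 1.
Hypothesis Hzg : forall n, (1 <= n)%nat -> z (S n) = (z n * cis (g n))%C.

(** From [z (n+1) = z n cis(g n)] follows [z n = (z n - z (n+1)) kl_coef (g n)]. Summation by parts
    moves the differences onto [kl_coef], whose real part is constant and whose imaginary part is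
    monotone because [g] decreases; the variation therefore telescopes to a difference of
    cotangents. The boundary term stays on the left so that the induction closes. *)
Lemma kusmin_landau_aux d A k : 0 < d <= 1 ->
  (forall n, (A < n <= A + S k)%nat -> d <= g n <= 2 * PI - d) ->
  (forall n, (A < n < A + S k)%nat -> g (S n) <= g n) ->
  Cmod (csum z (A + S k) - csum z A + z (S (A + S k)) * kl_coef (g (A + S k)%nat))%C <=
  4 / d + (cos (g (A + S k)%nat / 2) / sin (g (A + S k)%nat / 2) -
           cos (g (S A) / 2) / sin (g (S A) / 2)) / 2.
Proof.
intros Hd. 
assert (Hz : forall n, (1 <= n)%nat -> d <= g n <= 2 * PI - d ->
   (z n + z (S n) * kl_coef (g n))%C = (z n * kl_coef (g n))%C).
{ intros n Hn Hg. rewrite Hzg by auto.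
  assert (Hs : sin (g n / 2) <> 0).
  { assert (X := sin_half_lower (g n) d Hd Hg). lra. }
  replace (z n) with (z n * (kl_coef (g n) * (1 - cis (g n))))%C at 1.
  - ring.
  - rewrite kl_coef_spec by auto. ring. }
induction k as [|k IH]; intros Hg Hdec.
- replace (A + 1)%nat with (S A) by lia. cbn [csum].
  replace (csum z A + z (S A) - csum z A + z (S (S A)) * kl_coef (g (S A)))%C with
    (z (S A) + z (S (S A)) * kl_coef (g (S A)))%C by ring.
  rewrite Hz; [|lia|apply Hg; lia]. rewrite Cmod_mult, Hz1.
  assert (X := kl_coef_bound (g (S A)) d Hd (Hg (S A) ltac:(lia))). lra.
- replace (A + S (S k))%nat with (S (A + S k)) in * by lia. 
  set (B := (A + S k)%nat) in *. cbn [csum].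
  replace (csum z B + z (S B) - csum z A + z (S (S B)) * kl_coef (g (S B)))%C with
    ((csum z B - csum z A + z (S B) * kl_coef (g B)) + 
      ((z (S B) + z (S (S B)) * kl_coef (g (S B))) - z (S B) * kl_coef (g B)))%C by ring.
  rewrite Hz; [|lia|apply Hg; lia].
  replace (z (S B) * kl_coef (g (S B)) - z (S B) * kl_coef (g B))%C with
   (z (S B) * (kl_coef (g (S B)) - kl_coef (g B)))%C by ring.
  eapply Rle_trans; [apply Cmod_triangle|].
  rewrite Cmod_mult, Hz1.
  assert (H1 := IH ltac:(intros; apply Hg; lia) ltac:(intros; apply Hdec; lia)).
  assert (H2 : cos (g B / 2) / sin (g B / 2) <= cos (g (S B) / 2) / sin (g (S B) / 2)).
  { apply (cot_decr (g (S B)) (g B) d); auto.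
    - apply Hg; lia.
    - apply Hdec; lia.
    - apply Hg; lia. }
  assert (H3 : Cmod (kl_coef (g (S B)) - kl_coef (g B))%C <=
    (cos (g (S B) / 2) / sin (g (S B) / 2) - cos (g B / 2) / sin (g B / 2)) / 2).
  { eapply Rle_trans; [apply Cmod_le_abs|]. unfold kl_coef. cbn [fst snd Cminus Cplus Copp].
    replace (/ 2 + - / 2) with 0 by ring. rewrite Rabs_R0.
    rewrite Rabs_pos_eq; lra. }
  lra.
Qed.

(** Three contributions of [4/d]: the initial term of the summation by parts, half the difference of
    two cotangents, and the boundary term. *)
Lemma kusmin_landau d A B : 0 < d <= 1 -> (A <= B)%nat ->
  (forall n, (A < n <= B)%nat -> d <= g n <= 2 * PI - d) ->
  (forall n, (A < n < B)%nat -> g (S n) <= g n) ->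
  Cmod (csum z B - csum z A)%C <= 12 / d.
Proof.
intros Hd HAB Hg Hdec.
destruct (Nat.eq_dec A B) as [E|E].
- subst. replace (csum z B - csum z B)%C with (RtoC 0) by ring. rewrite Cmod_0.
  apply Rdiv_le_0_compat; lra.
- assert (HB : B = (A + S (B - A - 1))%nat) by lia.
  set (j := (B - A - 1)%nat) in *. clearbody j. subst B.
  assert (H := kusmin_landau_aux d A j Hd Hg Hdec).
  replace (csum z (A + S j) - csum z A)%C with
   ((csum z (A + S j) - csum z A + z (S (A + S j)) * kl_coef (g (A + S j)%nat)) +
     - (z (S (A + S j)) * kl_coef (g (A + S j)%nat)))%C by ring.
  eapply Rle_trans; [apply Cmod_triangle|].
  rewrite Cmod_opp, Cmod_mult, Hz1.
  assert (K1 := kl_coef_bound _ d Hd (Hg (A + S j)%nat ltac:(lia))).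
  assert (K2 := cot_bound _ d Hd (Hg (A + S j)%nat ltac:(lia))).
  assert (K3 := cot_bound _ d Hd (Hg (S A) ltac:(lia))).
  apply Rabs_le_between in K2. apply Rabs_le_between in K3.
  unfold Rdiv in *. lra.
Qed.

Lemma csum_trivial A B : (A <= B)%nat -> Cmod (csum z B - csum z A)%C <= INR (B - A).
Proof.
intros H. induction H as [|B H IH].
- replace (csum z A - csum z A)%C with (RtoC 0) by ring. rewrite Cmod_0. apply pos_INR.
- cbn [csum]. replace (csum z B + z (S B) - csum z A)%C with
   ((csum z B - csum z A) + z (S B))%C by ring.
  eapply Rle_trans; [apply Cmod_triangle|]. rewrite Hz1.
  replace (S B - A)%nat with (S (B - A)) by lia. rewrite S_INR. lra.
Qed.

Lemma slow_count lo d la A B : 0 < la -> 0 <= d -> (A <= B)%nat ->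
  (forall n, (A < n <= B)%nat -> lo <= g n <= lo + d) ->
  (forall n, (A < n < B)%nat -> g (S n) + la <= g n) ->
  INR (B - A) <= d / la + 1.
Proof.
intros Hla Hd HAB Hg Hdec.
assert (H0 : 0 <= d / la) by (apply Rdiv_le_0_compat; auto).
destruct (Nat.eq_dec A B) as [E|E].
- subst. rewrite Nat.sub_diag. simpl. lra.
- assert (H : forall k, (A + S k <= B)%nat -> g (A + S k)%nat + INR k * la <= g (S A)).
  { induction k; intros Hk.
    - simpl INR. replace (A + 1)%nat with (S A) by lia. lra.
    - assert (X := Hdec (A + S k)%nat ltac:(lia)). assert (Y := IHk ltac:(lia)).
      replace (S (A + S k)) with (A + S (S k))%nat in X by lia. rewrite S_INR. lra. }
  assert (X := H (B - A - 1)%nat ltac:(lia)).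
  replace (A + S (B - A - 1))%nat with B in X by lia.
  assert (Y1 := Hg B ltac:(lia)). assert (Y2 := Hg (S A) ltac:(lia)).
  rewrite !minus_INR in * by lia. simpl (INR 1) in *.
  apply Rmult_le_reg_r with la; auto.
  replace ((d / la + 1) * la) with (d + la) by (field; lra). nra.
Qed.

(** Locates the single index at which a monotone quantity, usually the phase increment, crosses a
    threshold. *)
Lemma monotone_split (P : nat -> Prop) A B : (A <= B)%nat ->
  (forall n, P n \/ ~ P n) -> (forall n, (A < n < B)%nat -> P n -> P (S n)) ->
  exists m, (A <= m <= B)%nat /\ (forall n, (A < n <= m)%nat -> ~ P n) /\
    (forall n, (m < n <= B)%nat -> P n).
Proof.
intros HAB HP. induction HAB as [|B HAB IH]; intros Hm.
- exists A. repeat split; auto; intros; lia.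
- destruct IH as [m [H1 [H2 H3]]]; [intros; apply Hm; auto; lia|].
  destruct (HP (S B)) as [Y|N].
  + exists m. repeat split; try lia; auto. intros n Hn.
    destruct (Nat.eq_dec n (S B)); [now subst|]. apply H3; lia.
  + exists (S B). repeat split; try lia. intros n Hn.
    destruct (Nat.eq_dec n (S B)); [now subst|].
    destruct (le_lt_dec n m); [apply H2; lia|].
    exfalso. apply N. 
    assert (HPB : P B) by (apply H3; lia). apply Hm; auto; lia.
Qed.

(** Within [d] of an endpoint of the period the Kusmin-Landau bound is lost; but the increments are
    spaced by at least [la], so at most [d/la + 1] terms fall near each endpoint and they are
    bounded trivially. The middle stretch gives [12/d]. *)
Lemma window_bound d la A B : 0 < d <= 1 -> 0 < la -> (A <= B)%nat ->
  (forall n, (A < n <= B)%nat -> 0 <= g n <= 2 * PI) ->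
  (forall n, (A < n < B)%nat -> g (S n) + la <= g n) ->
  Cmod (csum z B - csum z A)%C <= 2 * (d / la + 1) + 12 / d.
Proof.
intros Hd Hla HAB Hg Hdec.
destruct (monotone_split (fun n => g n <= 2 * PI - d) A B HAB) as [m1 [Hm1 [Hn1 Hp1]]].
{ intros n. destruct (Rle_dec (g n) (2 * PI - d)); auto. }
{ intros n Hn H. assert (X := Hdec n Hn). lra. }
destruct (monotone_split (fun n => g n < d) m1 B) as [m2 [Hm2 [Hn2 Hp2]]].
{ lia. }
{ intros n. destruct (Rlt_dec (g n) d); auto. }
{ intros n Hn H. assert (X := Hdec n ltac:(lia)). lra. }
replace (csum z B - csum z A)%C with
  ((csum z m1 - csum z A) + ((csum z m2 - csum z m1) + (csum z B - csum z m2)))%C by ring.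
assert (B1 : Cmod (csum z m1 - csum z A)%C <= d / la + 1).
{ eapply Rle_trans; [apply csum_trivial; lia|].
  apply (slow_count (2 * PI - d)); auto; try lra; try lia.
  - intros n Hn. assert (X := Hn1 n Hn). assert (Y := Hg n ltac:(lia)). lra.
  - intros n Hn. apply Hdec; lia. }
assert (B3 : Cmod (csum z B - csum z m2)%C <= d / la + 1).
{ eapply Rle_trans; [apply csum_trivial; lia|].
  apply (slow_count 0); auto; try lra; try lia.
  - intros n Hn. assert (X := Hp2 n Hn). assert (Y := Hg n ltac:(lia)). lra.
  - intros n Hn. apply Hdec; lia. }
assert (B2 : Cmod (csum z m2 - csum z m1)%C <= 12 / d).
{ apply kusmin_landau; auto; try lia.
  - intros n Hn. assert (X := Hn2 n Hn). assert (Y := Hp1 n ltac:(lia)). lra.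
  - intros n Hn. assert (X := Hdec n ltac:(lia)). lra. }
eapply Rle_trans; [apply Cmod_triangle|].
assert (T := Cmod_triangle (csum z m2 - csum z m1)%C (csum z B - csum z m2)%C). lra.
Qed.
End ExponentialSums.

(** Summation by parts: the weights decrease, so their increments telescope against the uniform
    bound [M] on the unweighted sums. The induction keeps the last weight times the unweighted sum
    apart. Nonnegativity at [S A] is a separate hypothesis in order to cover the empty range. *)
Lemma abel_bound (a : nat -> R) (z : nat -> C) (M : R) A B : (A <= B)%nat -> 0 <= M ->
  (forall n, (A < n <= B)%nat -> 0 <= a n) ->
  (forall n, (A < n < B)%nat -> a (S n) <= a n) ->
  (forall m, (A <= m <= B)%nat -> Cmod (csum z m - csum z A)%C <= M) -> 0 <= a (S A) ->
  Cmod (csum (fun n => RtoC (a n) * z n)%C B - csum (fun n => RtoC (a n) * z n)%C A)%C <= a (S A) * M.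
Proof.
intros HAB HM Ha Hdec Hb HaA.
set (s := csum (fun n => RtoC (a n) * z n)%C).
destruct (Nat.eq_dec A B) as [E|E].
{ subst. replace (s B - s B)%C with (RtoC 0) by ring. rewrite Cmod_0. nra. }
assert (H : forall B', (A < B' <= B)%nat -> 
  Cmod (s B' - s A - RtoC (a B') * (csum z B' - csum z A))%C <= (a (S A) - a B') * M).
{ intros B' HB'. destruct HB' as [H1 H2]. revert H2. induction H1 as [|B' H1 IH]; intros H2.
  - unfold s. cbn [csum]. match goal with |- Cmod ?w <= _ => replace w with (RtoC 0) by ring end.
    rewrite Cmod_0. lra.
  - unfold s in *. cbn [csum].
    match goal with |- Cmod ?w <= _ => replace w with 
     ((csum (fun n => RtoC (a n) * z n) B' - csum (fun n => RtoC (a n) * z n) A 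
        - RtoC (a B') * (csum z B' - csum z A)) +
      RtoC (a B' - a (S B')) * (csum z B' - csum z A))%C by (rewrite RtoC_minus; ring) end.
    eapply Rle_trans; [apply Cmod_triangle|]. rewrite Cmod_mult, Cmod_R.
    assert (X := Hdec B' ltac:(lia)). rewrite Rabs_pos_eq by lra.
    assert (Y := Hb B' ltac:(lia)). specialize (IH ltac:(lia)). 
    nra. }
specialize (H B ltac:(lia)).
replace (s B - s A)%C with ((s B - s A - RtoC (a B) * (csum z B - csum z A)) + 
  RtoC (a B) * (csum z B - csum z A))%C by ring.
eapply Rle_trans; [apply Cmod_triangle|]. rewrite Cmod_mult, Cmod_R.
assert (X := Ha B ltac:(lia)). rewrite Rabs_pos_eq by lra.
assert (Y := Hb B ltac:(lia)). nra.
Qed.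

(** * The convexity bound *)

Lemma ln_1p_upper x : 0 <= x -> ln (1 + x) <= x.
Proof.
intros Hx. rewrite <- (ln_exp x) at 2. destruct Hx as [Hx| <-].
- left. apply ln_increasing; [lra|]. now apply exp_ineq1, Rgt_not_eq.
- rewrite Rplus_0_r, exp_0. lra.
Qed.

Lemma ln_lower x : 0 < x -> 1 - / x <= ln x.
Proof.
intros Hx. assert (Hi := Rinv_0_lt_compat x Hx).
assert (H : ln (/ x) <= / x - 1).
{ destruct (Rle_or_lt 1 (/ x)).
  - replace (/ x) with (1 + (/ x - 1)) at 1 by ring. apply ln_1p_upper. lra.
  - rewrite <- (ln_exp (/ x - 1)). left. apply ln_increasing; auto.
    assert (X := exp_ineq1 (/ x - 1) ltac:(lra)). lra. }
rewrite ln_Rinv in H by auto. lra.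
Qed.

Lemma ln_le_lin x : 0 < x -> ln x <= x - 1.
Proof.
intros Hx. assert (H := ln_lower (/ x) (Rinv_0_lt_compat _ Hx)).
rewrite Rinv_inv, ln_Rinv in H by lra. lra.
Qed.

Lemma harmonic_le N : (1 <= N)%nat -> rsum (fun n => / INR n) N <= 1 + ln (INR N).
Proof.
induction 1 as [|N H IH].
- simpl. rewrite ln_1. lra.
- cbn [rsum].
  assert (HN : 0 < INR N) by (apply lt_0_INR; lia).
  assert (HS : 0 < INR (S N)) by (apply lt_0_INR; lia).
  assert (X := ln_lower (INR (S N) / INR N) ltac:(apply Rdiv_lt_0_compat; auto)).
  rewrite ln_div in X by auto.
  replace (1 - / (INR (S N) / INR N)) with (/ INR (S N)) in X; [lra|].
  rewrite S_INR in *. field. lra.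
Qed.

Lemma nat_ceil x : 0 <= x -> exists n : nat, x <= INR n < x + 1.
Proof.
intros Hx. destruct (archimed x) as [H1 H2].
assert (0 <= up x)%Z by (apply le_IZR; lra).
destruct (Req_dec (IZR (up x)) (x + 1)).
- exists (Z.to_nat (up x - 1)).
  rewrite INR_IZR_INZ, Z2Nat.id, minus_IZR by (apply le_IZR; rewrite minus_IZR; lra). lra.
- exists (Z.to_nat (up x)). rewrite INR_IZR_INZ, Z2Nat.id by auto. lra.
Qed.

Lemma nat_floor x : 0 <= x -> exists n : nat, INR n <= x < INR n + 1.
Proof.
intros Hx. destruct (archimed x) as [H1 H2].
assert (0 <= up x - 1)%Z by (apply Z.lt_succ_r; unfold Z.succ; replace (up x - 1 + 1)%Z with (up x) by ring; apply lt_IZR; lra).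
exists (Z.to_nat (up x - 1)).
rewrite INR_IZR_INZ, Z2Nat.id, minus_IZR by auto. lra.
Qed.

(** * Van der Corput's bound for sums of n^(it) *)

Section VanDerCorput.
Variable t : R.
Hypothesis Ht : 6 <= t.

Let z (n : nat) : C := cis (t * ln (INR n)).
Let g (n : nat) : R := t * ln (1 + / INR n).

Lemma vdc_step n : (1 <= n)%nat -> z (S n) = (z n * cis (g n))%C.
Proof.
intros Hn. unfold z, g. rewrite <- cis_plus. f_equal.
assert (0 < INR n) by (apply lt_0_INR; lia).
rewrite <- Rmult_plus_distr_l, <- ln_mult; auto.
- rewrite S_INR. do 2 f_equal. field. lra.
- assert (0 < / INR n) by now apply Rinv_0_lt_compat. lra.
Qed.

Lemma vdc_g_le n : (1 <= n)%nat -> g n <= t / INR n.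
Proof.
intros Hn. unfold g. apply Rmult_le_compat_l; [lra|]. apply ln_1p_upper.
left; apply Rinv_0_lt_compat, lt_0_INR; lia.
Qed.

Lemma vdc_g_ge n : (1 <= n)%nat -> t / INR (S n) <= g n.
Proof.
intros Hn. unfold g. apply Rmult_le_compat_l; [lra|].
assert (0 < INR n) by (apply lt_0_INR; lia).
assert (0 < / INR n) by now apply Rinv_0_lt_compat.
eapply Rle_trans; [|apply ln_lower; lra].
rewrite S_INR. right. field. lra.
Qed.

(** The difference of logarithms is [ln r] with [r = (n+1)^2 / (n (n+2))], and [1 - 1/r] is exactly
    [1/(n+1)^2], so [ln r >= 1 - 1/r] suffices. *)
Lemma vdc_g_diff n : (1 <= n)%nat -> g (S n) + t / (INR (S n) * INR (S n)) <= g n.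
Proof.
intros Hn.
assert (H0 : 0 < INR n) by (apply lt_0_INR; lia).
assert (Hi : 0 < / INR n) by now apply Rinv_0_lt_compat.
assert (Hs : 0 < / INR (S n)) by (apply Rinv_0_lt_compat, lt_0_INR; lia).
assert (H : ln (1 + / INR n) - ln (1 + / INR (S n)) >= / (INR (S n) * INR (S n))).
{ rewrite <- ln_div by lra. apply Rle_ge.
  eapply Rle_trans; [|apply ln_lower; apply Rdiv_lt_0_compat; lra].
  rewrite S_INR in *. right. field. lra. }
unfold g, Rdiv. nra.
Qed.

(* The windows [2 pi nu <= g <= 2 pi (nu + 1)] are peeled off one at a time; in each of them the
   second difference is at least [d^2] with [d] of order [(nu + 1) / sqrt t], and sacrificing the terms
   within [d] of the endpoints costs as much as the Kusmin-Landau bound, namely [O(1 / d)]. *)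
Lemma vdc_windows V : forall A B, (A <= B)%nat -> (1 <= A)%nat -> INR B <= t -> INR V <= sqrt t ->
  (forall n, (A < n <= B)%nat -> g n <= 2 * PI * INR V) ->
  Cmod (csum z B - csum z A)%C <= 2 * INR V + 56 * sqrt t * rsum (fun n => / INR n) V.
Proof.
assert (HPI := PI2_3_2).
assert (Hst2 : sqrt t * sqrt t = t) by (apply sqrt_sqrt; lra).
induction V as [|V IH]; intros A B HAB HA HB HV Hg.
- assert (E : A = B).
  { destruct (Nat.eq_dec A B); auto. exfalso.
    assert (X := Hg B ltac:(lia)). assert (Y := vdc_g_ge B ltac:(lia)).
    assert (0 < t / INR (S B)) by (apply Rdiv_lt_0_compat; [lra | apply lt_0_INR; lia]).
    simpl in X. lra. }
  subst. replace (csum z B - csum z B)%C with (RtoC 0) by ring. rewrite Cmod_0. simpl. lra.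
- assert (HVr := S_INR V). assert (HV0 := pos_INR V).
  destruct (monotone_split (fun n => g n <= 2 * PI * INR V) A B HAB) as [m [Hm [Hn Hp]]].
  { intros n. destruct (Rle_dec (g n) (2 * PI * INR V)); auto. }
  { intros n Hn H. assert (X := vdc_g_diff n ltac:(lia)).
    assert (0 < t / (INR (S n) * INR (S n))).
    { apply Rdiv_lt_0_compat; [lra|]. assert (0 < INR (S n)) by (apply lt_0_INR; lia). nra. }
    lra. }
  replace (csum z B - csum z A)%C with ((csum z m - csum z A) + (csum z B - csum z m))%C by ring.
  assert (B2 := IH m B ltac:(lia) ltac:(lia) HB ltac:(lra) Hp).
  set (d := INR (S V) / (4 * sqrt t)).
  assert (Hd : 0 < d <= 1).
  { unfold d; split.
    - apply Rdiv_lt_0_compat; lra.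
    - apply Rle_div_l; lra. }
  assert (B1 : Cmod (csum z m - csum z A)%C <= 2 * (d / (d * d) + 1) + 12 / d).
  { apply (window_bound z (fun n => g n - 2 * INR V * PI)); auto; try nra; try lia.
    - intros; apply Cmod_cis.
    - intros n Hn1. rewrite cis_period. now apply vdc_step.
    - intros n Hn1. assert (X := Hn n Hn1). apply Rnot_le_lt in X. 
      assert (Y := Hg n ltac:(lia)). rewrite HVr in Y. split; lra.
    - intros n Hn1. assert (X := vdc_g_diff n ltac:(lia)).
      assert (Y := Hn (S n) ltac:(lia)). apply Rnot_le_lt in Y.
      assert (Yu := vdc_g_le (S n) ltac:(lia)).
      set (p := INR (S n)) in *.
      assert (Hp0 : 0 < p) by (apply lt_0_INR; lia).
      assert (Hpt : p <= t).
      { apply Rle_trans with (INR B); auto. apply le_INR. lia. }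
      (* The index [S n] is still in the window, so [2 pi V < g (S n) <= t / p]; hence
         [(V + 1) p <= 2 t], the case [V = 0] resting on [p <= t]. Squaring gives the spacing
         [d^2]. *)
      assert (K : d * d <= t / (p * p)).
      { apply Rmult_le_reg_r with (p * p); [nra|].
        replace (t / (p * p) * (p * p)) with t by (field; lra).
        unfold d. replace (INR (S V) / (4 * sqrt t) * (INR (S V) / (4 * sqrt t)) * (p * p)) with
         ((INR (S V) * p) * (INR (S V) * p) / (16 * (sqrt t * sqrt t))) by (field; lra).
        rewrite Hst2. apply Rle_div_l; [lra|].
        assert (INR (S V) * p <= 2 * t).
        { destruct V as [|V'].
          - simpl. lra.
          - assert (Hw : 2 * PI * INR (S V') * p < t).
            { apply Rmult_lt_reg_r with (/ p); [now apply Rinv_0_lt_compat|].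
              replace (2 * PI * INR (S V') * p * / p) with (2 * PI * INR (S V')) by (field; lra).
              unfold Rdiv in Yu. lra. }
            assert (6 * (INR (S V') * p) <= 2 * PI * INR (S V') * p).
            { replace (2 * PI * INR (S V') * p) with ((2 * PI) * (INR (S V') * p)) by ring.
              apply Rmult_le_compat_r; [nra | lra]. }
            rewrite HVr. nra. }
        assert (0 <= INR (S V) * p) by nra. nra. }
      lra. }
  cbn [rsum].
  replace (2 * (d / (d * d) + 1) + 12 / d) with (2 + 56 * sqrt t * / INR (S V)) in B1.
  2:{ unfold d. field. lra. }
  eapply Rle_trans; [apply Cmod_triangle|]. rewrite HVr in *. lra.
Qed.

Lemma ln_t_ge_1 : 1 <= ln t.
Proof.
rewrite <- (ln_exp 1) at 1. assert (H := exp_le_3). assert (H2 := exp_pos 1).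
left; apply ln_increasing; lra.
Qed.

(** For [n > t] the phase increment is at most 1 and, as [n <= 2 t^(3/2)], at least [1/(3 sqrt t)],
    so one application of Kusmin-Landau is enough. For [sqrt t <= n <= t] the increment is at most
    [sqrt t], hence about [sqrt t / 6] windows cover it, and the harmonic sum of their costs
    produces the logarithm. *)
Lemma van_der_corput A B : (A <= B)%nat -> sqrt t <= INR A + 1 -> (1 <= A)%nat ->
  INR B <= 2 * (t * sqrt t) ->
  Cmod (csum z B - csum z A)%C <= 150 * sqrt t * ln t.
Proof.
intros HAB HA HA1 HB.
assert (HPI := PI2_3_2).
assert (Hln := ln_t_ge_1).
assert (Hst : 0 < sqrt t) by (apply sqrt_lt_R0; lra).
assert (Hst2 : sqrt t * sqrt t = t) by (apply sqrt_sqrt; lra).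
assert (Hst3 : 2 <= sqrt t) by nra.
destruct (monotone_split (fun n => t < INR n) A B HAB) as [m [Hm [Hn Hp]]].
{ intros n. destruct (Rlt_dec t (INR n)); auto. }
{ intros n Hn H. rewrite S_INR. lra. }
replace (csum z B - csum z A)%C with ((csum z m - csum z A) + (csum z B - csum z m))%C by ring.
assert (B2 : Cmod (csum z B - csum z m)%C <= 12 / (/ (3 * sqrt t))).
{ apply (kusmin_landau z g); try lia.
  - intros; apply Cmod_cis.
  - intros n Hn1. now apply vdc_step.
  - split; [apply Rinv_0_lt_compat; lra|].
    rewrite <- Rinv_1. apply Rinv_le_contravar; lra.
  - intros n Hn1. assert (X := Hp n Hn1). assert (X1 := vdc_g_le n ltac:(lia)).
    assert (X2 := vdc_g_ge n ltac:(lia)). split.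
    + eapply Rle_trans; [|apply X2].
      assert (INR n <= INR B) by (apply le_INR; lia).
      rewrite S_INR. apply Rle_div_r; [lra|].
      rewrite Rmult_comm. apply Rle_div_l; [lra|]. nra.
    + assert (t / INR n <= 1) by (apply Rle_div_l; lra).
      assert (/ (3 * sqrt t) <= 1) by (rewrite <- Rinv_1; apply Rinv_le_contravar; lra). lra.
  - intros n Hn1. assert (X := vdc_g_diff n ltac:(lia)).
    assert (0 < t / (INR (S n) * INR (S n))).
    { apply Rdiv_lt_0_compat; [lra|]. assert (0 < INR (S n)) by (apply lt_0_INR; lia). nra. }
    lra. }
replace (12 / (/ (3 * sqrt t))) with (36 * sqrt t) in B2 by (field; lra).
assert (B1 : Cmod (csum z m - csum z A)%C <= 2 * sqrt t + 56 * sqrt t * (1 + ln t)).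
{ destruct (Nat.eq_dec A m) as [E|E].
  { subst. replace (csum z m - csum z m)%C with (RtoC 0) by ring. rewrite Cmod_0.
    nra. }
  destruct (nat_ceil (sqrt t / 6) ltac:(lra)) as [V [HV1 HV2]].
  assert (HV : INR V <= sqrt t) by lra.
  assert (HV0 : (1 <= V)%nat).
  { destruct V; [simpl in HV1; lra | lia]. }
  assert (X := vdc_windows V A m ltac:(lia) HA1).
  assert (Y := harmonic_le V HV0).
  assert (Z : ln (INR V) <= ln t).
  { apply ln_le; [apply lt_0_INR; lia | nra]. }
  assert (W : INR m <= t).
  { assert (Q := Hn m ltac:(lia)). lra. }
  specialize (X W HV). 
  assert (Q : Cmod (csum z m - csum z A) <= 2 * INR V + 56 * sqrt t * rsum (fun n : nat => / INR n) V).
  { apply X. intros n Hn1.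
    eapply Rle_trans; [apply vdc_g_le; lia|].
    assert (HnA : sqrt t <= INR n).
    { assert (INR (S A) <= INR n) by (apply le_INR; lia). rewrite S_INR in *. lra. }
    apply Rle_trans with (sqrt t); [apply Rle_div_l; nra|].
    assert (6 * INR V <= 2 * PI * INR V) by nra. lra. }
  assert (56 * sqrt t * rsum (fun n : nat => / INR n) V <= 56 * sqrt t * (1 + ln t)).
  { apply Rmult_le_compat_l; lra. }
  lra. }
eapply Rle_trans; [apply Cmod_triangle|].
assert (sqrt t <= sqrt t * ln t) by nra. lra.
Qed.
End VanDerCorput.

Lemma Rpower_le_1 x a : 1 <= x -> a <= 0 -> Rpower x a <= 1.
Proof.
intros Hx Ha. destruct (Req_dec x 1) as [->|].
- unfold Rpower. rewrite ln_1, Rmult_0_r, exp_0. lra.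
- rewrite <- (Rpower_O x) by lra. apply Rle_Rpower; lra.
Qed.

Lemma Rpower_pos x a : 0 < Rpower x a.
Proof. apply exp_pos. Qed.

Lemma Rpower_le_self x a : 1 <= x -> a <= 1 -> Rpower x a <= x.
Proof. intros Hx Ha. rewrite <- (Rpower_1 x) at 2 by lra. apply Rle_Rpower; lra. Qed.

Lemma Rpower_ge_1 x a : 1 <= x -> 0 <= a -> 1 <= Rpower x a.
Proof. intros Hx Ha. apply Rle_trans with (Rpower x 0); [rewrite Rpower_O; lra|]. apply Rle_Rpower; lra. Qed.

Lemma Rpower_le_inv x a : 1 <= x -> a <= - (1) -> Rpower x a <= / x.
Proof. intros Hx Ha. apply Rle_trans with (Rpower x (- (1))); [apply Rle_Rpower; lra|]. rewrite Rpower_Ropp, Rpower_1; lra. Qed.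

Lemma Rpower_ge_inv x a : 1 <= x -> - (1) <= a -> / x <= Rpower x a.
Proof. intros Hx Ha. apply Rle_trans with (Rpower x (- (1))); [rewrite Rpower_Ropp, Rpower_1; lra|]. apply Rle_Rpower; lra. Qed.

Lemma Rpower_decr x y a : 0 < x <= y -> 0 <= a -> Rpower y (- a) <= Rpower x (- a).
Proof.
intros [Hx Hxy] Ha. rewrite !Rpower_Ropp. apply Rinv_le_contravar; [apply Rpower_pos|].
apply Rle_Rpower_l; lra.
Qed.

(** The series is cut at [A ~ sqrt t] and [Y ~ t^(3/2)]: trivial bounds below [A], van der Corput
    with weights [n^(-sg)] in between, Euler-Maclaurin above [Y]. With this [Y] the last error is of
    order [t Y^(-sg) = t^(1 - 3 sg/2)] for bounded [sg], which is at most [t^((1-sg)/2)] exactly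
    when [sg >= 1/2]. Nothing in the bound depends on [X]. *)
Lemma zeta_bound (t sg : R) (X : nat) : 6 <= t -> / 2 <= sg -> t * sqrt t <= INR X ->
  Cmod (Zeta_ps X (sg, - t)) <= 200 * Rpower t (Rmax 0 ((1 - sg) / 2)) * ln t.
Proof.
intros Ht Hsg HX.
set (mu := Rmax 0 ((1 - sg) / 2)).
assert (Hmu0 : 0 <= mu) by apply Rmax_l. assert (Hmu1 : (1 - sg) / 2 <= mu) by apply Rmax_r.
assert (Hln := ln_t_ge_1 t Ht).
assert (Hst : 0 < sqrt t) by (apply sqrt_lt_R0; lra).
assert (Hst2 : sqrt t * sqrt t = t) by (apply sqrt_sqrt; lra).
assert (Hst3 : 2 <= sqrt t) by nra.
assert (Hsp : sqrt t = Rpower t (/ 2)) by (rewrite Rpower_sqrt; auto; lra).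
assert (Htsp : t * sqrt t = Rpower t (3 / 2)).
{ rewrite Hsp. rewrite <- (Rpower_1 t) at 1 by lra. rewrite <- Rpower_plus. f_equal; lra. }
set (P := Rpower t mu).
assert (HP : 1 <= P).
{ apply Rpower_ge_1; lra. }
assert (HPe : forall a, a <= mu -> Rpower t a <= P) by (intros; unfold P; apply Rle_Rpower; lra).
destruct (nat_ceil (t * sqrt t) ltac:(nra)) as [Y [HY1 HY2]].
assert (HYX : (Y <= X)%nat).
{ apply Nat.lt_succ_r. apply INR_lt. rewrite S_INR. lra. }
assert (HY0 : 1 <= INR Y) by nra.
assert (HY1' : (1 <= Y)%nat) by (apply INR_le; simpl; lra).
destruct (nat_floor (sqrt t) ltac:(lra)) as [A [HA1 HA2]].
assert (HA1' : (1 <= A)%nat).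
{ destruct A; [simpl in HA2; lra | lia]. }
assert (HAY : (A <= Y)%nat) by (apply INR_le; nra).
set (s := (sg, - t) : C).
assert (Hs1 : s <> RtoC 1).
{ intros E. apply (f_equal snd) in E. simpl in E. lra. }
assert (B1 : Cmod (Zeta_ps X s - Zeta_ps Y s)%C <= 3 * P).
{ eapply Rle_trans; [apply Zeta_ps_diff; auto; simpl; lra|]. simpl fst.
  assert (Cmod s <= sg + t).
  { eapply Rle_trans; [apply Cmod_le_abs|]. simpl. rewrite Rabs_Ropp, !Rabs_pos_eq; lra. }
  assert (Cmod s / sg <= 3 * t).
  { apply Rle_div_l; nra. }
  assert (0 <= Cmod s / sg) by (apply Rdiv_le_0_compat; [apply Cmod_ge_0 | lra]).
  assert (Q : Rpower (INR Y) (- sg) <= Rpower t (- (3 / 2 * sg))).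
  { rewrite <- Ropp_mult_distr_r_reverse, <- Rpower_mult, <- Htsp. apply Rpower_decr; nra. }
  assert (Q2 := Rpower_pos (INR X) (- sg)). 
  apply Rle_trans with (3 * t * Rpower t (- (3 / 2 * sg))).
  { apply Rmult_le_compat; try lra.
    assert (Rpower (INR X) (- sg) <= Rpower (INR Y) (- sg)); [|lra].
    apply Rpower_decr; [|lra]. split; [lra | now apply le_INR]. }
  rewrite Rmult_assoc. rewrite <- (Rpower_1 t) at 1 by lra. rewrite <- Rpower_plus.
  apply Rmult_le_compat_l; [lra|]. apply HPe. lra. }
assert (B2 : Cmod (cpow (INR Y) (s - 1) / (1 - s))%C <= 2 * P).
{ assert (H1s := C1_minus_neq0 s Hs1).
  rewrite Cmod_div by auto. rewrite Cmod_cpow. simpl fst.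
  assert (Hm : t <= Cmod (1 - s)%C).
  { eapply Rle_trans; [|apply Rabs_snd_Cmod]. simpl. rewrite Rabs_pos_eq; lra. }
  apply Rle_div_l; [lra|].
  replace (- (sg + - (1))) with (1 - sg) by ring.
  apply Rle_trans with (2 * P * t); [|apply Rmult_le_compat_l; lra].
  destruct (Rle_or_lt sg 1).
  - apply Rle_trans with (Rpower (2 * (t * sqrt t)) (1 - sg)).
    { apply Rle_Rpower_l; nra. }
    rewrite <- Rpower_mult_distr by nra.
    rewrite Htsp, Rpower_mult.
    assert (Rpower 2 (1 - sg) <= 2).
    { apply Rpower_le_self; lra. }
    assert (Rpower t (3 / 2 * (1 - sg)) <= P * t).
    { unfold P. rewrite <- (Rpower_1 t) at 3 by lra. rewrite <- Rpower_plus.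
      apply Rle_Rpower; lra. }
    assert (X1 := Rpower_pos 2 (1 - sg)). assert (X2 := Rpower_pos t (3 / 2 * (1 - sg))). 
    replace (2 * P * t) with (2 * (P * t)) by ring.
    apply Rmult_le_compat; lra.
  - assert (Rpower (INR Y) (1 - sg) <= 1) by (apply Rpower_le_1; lra). nra. }
set (a := fun n : nat => Rpower (INR n) (- sg)).
assert (Ez : forall n, npow n s = (RtoC (a n) * cis (t * ln (INR n)))%C).
{ intros n. unfold npow, a, s, cis, Rpower, Cmult, RtoC; simpl.
  replace (- t * ln (INR n)) with (- (t * ln (INR n))) by ring.
  rewrite cos_neg, sin_neg. f_equal; ring. }
assert (B3 : Cmod (csum (fun n => npow n s) A) <= P * (1 + ln t)).
{ eapply Rle_trans; [apply Cmod_csum|].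
  apply Rle_trans with (rsum (fun n => P * / INR n) A).
  - apply rsum_le. intros n Hn. rewrite npow_cpow, Cmod_cpow. simpl fst.
    assert (H1 : 1 <= INR n) by (apply (le_INR 1); lia).
    replace (- sg) with ((1 - sg) + - (1)) by ring. rewrite Rpower_plus, (Rpower_Ropp _ 1), Rpower_1 by lra.
    apply Rmult_le_compat_r; [left; apply Rinv_0_lt_compat; lra|].
    apply Rle_trans with (Rpower (INR n) (2 * mu)); [apply Rle_Rpower; lra|].
    assert (INR n <= sqrt t) by (eapply Rle_trans; [apply le_INR; apply Hn | lra]).
    apply Rle_trans with (Rpower (sqrt t) (2 * mu)); [apply Rle_Rpower_l; lra|].
    rewrite Hsp, Rpower_mult. unfold P. right. f_equal. field.
  - rewrite rsum_scal. apply Rmult_le_compat_l; [lra|].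
    eapply Rle_trans; [apply harmonic_le; auto|]. apply Rplus_le_compat_l, ln_le; [apply lt_0_INR; lia | nra]. }
assert (B4 : Cmod (csum (fun n => npow n s) Y - csum (fun n => npow n s) A)%C <= 150 * P * ln t).
{ rewrite !(csum_ext (fun n => npow n s) (fun n => RtoC (a n) * cis (t * ln (INR n)))%C) by (intros; apply Ez).
  eapply Rle_trans; [apply (abel_bound a (fun n => cis (t * ln (INR n))) (150 * sqrt t * ln t)); auto|].
  - nra.
  - intros n Hn. left. apply Rpower_pos.
  - intros n Hn. unfold a. apply Rpower_decr; [|lra]. split; [apply lt_0_INR; lia | apply le_INR; lia].
  - intros m Hm. apply van_der_corput; auto; try lia; try lra.
    apply Rle_trans with (INR Y); [apply le_INR; lia | nra].
  - left. apply Rpower_pos.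
  - unfold a. rewrite S_INR.
    assert (Q : Rpower (INR A + 1) (- sg) <= Rpower t (- (/ 2 * sg))).
    { rewrite <- Ropp_mult_distr_r_reverse, <- Rpower_mult, <- Hsp. apply Rpower_decr; lra. }
    assert (Q2 : Rpower t (- (/ 2 * sg)) * sqrt t <= P).
    { rewrite Hsp, <- Rpower_plus. apply HPe. lra. }
    assert (Rpower (INR A + 1) (- sg) * sqrt t <= P).
    { eapply Rle_trans; [|apply Q2]. apply Rmult_le_compat_r; lra. }
    replace (Rpower (INR A + 1) (- sg) * (150 * sqrt t * ln t)) with
      (150 * ln t * (Rpower (INR A + 1) (- sg) * sqrt t)) by ring.
    replace (150 * P * ln t) with (150 * ln t * P) by ring.
    apply Rmult_le_compat_l; lra. }
replace (Zeta_ps X s) with ((Zeta_ps X s - Zeta_ps Y s) +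
  ((csum (fun n => npow n s) A + (csum (fun n => npow n s) Y - csum (fun n => npow n s) A))
   + - (cpow (INR Y) (s - 1) / (1 - s))))%C by (unfold Zeta_ps; ring).
eapply Rle_trans; [apply Cmod_triangle|].
assert (T1 := Cmod_triangle (csum (fun n => npow n s) A) (csum (fun n => npow n s) Y - csum (fun n => npow n s) A)%C).
eapply Rle_trans; [apply Rplus_le_compat_l, Cmod_triangle|]. rewrite Cmod_opp.
assert (P <= P * ln t) by nra.
lra.
Qed.

(** * Shifting the line of integration *)

Definition cont2 (G : R -> R -> C) (x t : R) : Prop :=
  continuity_2d_pt (fun u v => fst (G u v)) x t /\ continuity_2d_pt (fun u v => snd (G u v)) x t.

(* [G x t = H (x - i t)] with [H] holomorphic and [H' = G']. *)
Definition antiholo (G G' : R -> R -> C) (x t : R) : Prop :=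
  is_dC (fun y => G y t) x (G' x t) /\ is_dC (fun y => G x y) t (- Ci * G' x t)%C /\
  cont2 G x t /\ cont2 G' x t.

Lemma cont2_mult F G x t : cont2 F x t -> cont2 G x t -> cont2 (fun u v => F u v * G u v)%C x t.
Proof.
intros [H1 H2] [H3 H4]; split; simpl.
- apply continuity_2d_pt_minus; apply continuity_2d_pt_mult; auto.
- apply continuity_2d_pt_plus; apply continuity_2d_pt_mult; auto.
Qed.

Lemma cont2_plus F G x t : cont2 F x t -> cont2 G x t -> cont2 (fun u v => F u v + G u v)%C x t.
Proof. intros [H1 H2] [H3 H4]; split; simpl; apply continuity_2d_pt_plus; auto. Qed.

Lemma cont2_const c x t : cont2 (fun u v => c) x t.
Proof. split; apply continuity_2d_pt_const. Qed.

Lemma antiholo_const c x t : antiholo (fun _ _ => c) (fun _ _ => RtoC 0) x t.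
Proof.
split; [|split; [|split; apply cont2_const]].
- apply is_dC_const.
- replace (- Ci * 0)%C with (RtoC 0) by ring. apply is_dC_const.
Qed.

Lemma antiholo_plus F F' G G' x t : antiholo F F' x t -> antiholo G G' x t ->
  antiholo (fun u v => F u v + G u v)%C (fun u v => F' u v + G' u v)%C x t.
Proof.
intros [A1 [A2 [A3 A4]]] [B1 [B2 [B3 B4]]]. split; [|split; [|split]].
- now apply is_dC_plus.
- rewrite Cmult_plus_distr_l. now apply is_dC_plus.
- now apply cont2_plus.
- now apply cont2_plus.
Qed.

Lemma antiholo_mult F F' G G' x t : antiholo F F' x t -> antiholo G G' x t ->
  antiholo (fun u v => F u v * G u v)%C (fun u v => F' u v * G u v + F u v * G' u v)%C x t.
Proof.
intros [A1 [A2 [A3 A4]]] [B1 [B2 [B3 B4]]]. split; [|split; [|split]].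
- exact (is_dC_mult (fun y => F y t) (fun y => G y t) x _ _ A1 B1).
- replace (- Ci * (F' x t * G x t + F x t * G' x t))%C with
   ((- Ci * F' x t) * G x t + F x t * (- Ci * G' x t))%C by ring.
  exact (is_dC_mult (fun y => F x y) (fun y => G x y) t _ _ A2 B2).
- now apply cont2_mult.
- apply cont2_plus; now apply cont2_mult.
Qed.

Lemma antiholo_csum F F' N x t : (forall n, (1 <= n <= N)%nat -> antiholo (F n) (F' n) x t) ->
  antiholo (fun u v => csum (fun n => F n u v) N) (fun u v => csum (fun n => F' n u v) N) x t.
Proof.
induction N as [|N IH]; intros H; cbn [csum]; [apply antiholo_const|].
apply antiholo_plus; [apply IH; intros; apply H; lia | apply H; lia].
Qed.

(** The affine map [b w + c] at [w = u - i v], in the coordinates of [antiholo]. *)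
Definition aff (b c u v : R) : C := (b * u + c, - (b * v)).

Lemma antiholo_affine b c x t : 
  antiholo (aff b c) (fun _ _ => RtoC b) x t.
Proof.
split; [|split; [|split; [|apply cont2_const]]]; split; simpl.
- auto_derive; auto; ring.
- auto_derive; auto; ring.
- auto_derive; auto; ring.
- auto_derive; auto; ring.
- apply continuity_2d_pt_plus; [apply continuity_2d_pt_mult|]; try apply continuity_2d_pt_const;
  apply continuity_2d_pt_id1.
- apply continuity_2d_pt_opp, continuity_2d_pt_mult; [apply continuity_2d_pt_const|].
  apply continuity_2d_pt_id2.
Qed.

Lemma cont2_cexp G x t : cont2 G x t -> cont2 (fun u v => cexp (G u v)) x t.
Proof.
intros [H1 H2]; unfold cexp; split; simpl; apply continuity_2d_pt_mult.
- apply (continuity_1d_2d_pt_comp exp (fun u v => fst (G u v))); auto.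
  apply derivable_continuous_pt, derivable_pt_exp.
- apply (continuity_1d_2d_pt_comp cos (fun u v => snd (G u v))); auto. apply continuity_cos.
- apply (continuity_1d_2d_pt_comp exp (fun u v => fst (G u v))); auto.
  apply derivable_continuous_pt, derivable_pt_exp.
- apply (continuity_1d_2d_pt_comp sin (fun u v => snd (G u v))); auto. apply continuity_sin.
Qed.

Lemma antiholo_cexp G G' x t : antiholo G G' x t ->
  antiholo (fun u v => cexp (G u v)) (fun u v => G' u v * cexp (G u v))%C x t.
Proof.
intros [A1 [A2 [A3 A4]]]. split; [|split; [|split]].
- apply (is_dC_cexp _ _ _ A1).
- rewrite Cmult_assoc. apply (is_dC_cexp _ _ _ A2).
- now apply cont2_cexp.
- apply cont2_mult; auto. now apply cont2_cexp.
Qed.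

Lemma Csqr_pos (w : C) : w <> RtoC 0 -> fst w ^ 2 + snd w ^ 2 <> 0.
Proof.
intros H E. apply H. destruct w as [a b]; simpl in E. unfold RtoC. f_equal; nra.
Qed.

Lemma derR_ratio (p u v : R -> R) x k l m : is_derive p x k -> is_derive u x l -> is_derive v x m ->
  u x ^ 2 + v x ^ 2 <> 0 ->
  is_derive (fun y => p y / (u y ^ 2 + v y ^ 2)) x
    ((k * (u x ^ 2 + v x ^ 2) - p x * (2 * u x * l + 2 * v x * m)) / (u x ^ 2 + v x ^ 2) ^ 2).
Proof.
intros H0 H1 H2 Hn.
assert (D0 := is_derive_unique _ _ _ H0).
assert (D1 := is_derive_unique _ _ _ H1). assert (D2 := is_derive_unique _ _ _ H2).
assert (E0 : ex_derive p x) by (eexists; exact H0).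
assert (E1 : ex_derive u x) by (eexists; exact H1).
assert (E2 : ex_derive v x) by (eexists; exact H2).
assert (Hn' : u x * (u x * 1) + v x * (v x * 1) <> 0) by (simpl in Hn; exact Hn).
auto_derive.
- split; [exact E0|]. split; [exact E1|]. split; [exact E2|]. split; [exact Hn'|exact I].
- replace (Derive (fun x => p x) x) with k by (symmetry; exact D0).
  replace (Derive (fun x => u x) x) with l by (symmetry; exact D1).
  replace (Derive (fun x => v x) x) with m by (symmetry; exact D2).
  field. exact Hn.
Qed.

Lemma is_dC_inv (f : R -> C) x l : is_dC f x l -> f x <> RtoC 0 ->
  is_dC (fun y => / f y)%C x (- l * (/ f x * / f x))%C.
Proof.
intros [H1 H2] H0. apply Csqr_pos in H0.
assert (A := derR_ratio _ _ _ x _ _ _ H1 H1 H2 H0).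
assert (B := derR_ratio _ _ _ x _ _ _ (derR_opp _ _ _ H2) H1 H2 H0).
split.
- simpl fst at 1. match type of A with is_derive _ _ ?a => match goal with |- is_derive _ _ ?b =>
    replace b with a; [exact A|] end end.
  cbn [fst snd Cmult Copp Cinv]. field. exact H0.
- match type of B with is_derive _ _ ?a => match goal with |- is_derive _ _ ?b =>
    replace b with a; [exact B|] end end.
  cbn [fst snd Cmult Copp Cinv]. field. exact H0.
Qed.

Lemma cont2_inv G x t : cont2 G x t -> G x t <> RtoC 0 -> cont2 (fun u v => / G u v)%C x t.
Proof.
intros [H1 H2] H0. apply Csqr_pos in H0.
assert (Hd : continuity_2d_pt (fun u v => / (fst (G u v) ^ 2 + snd (G u v) ^ 2)) x t).
{ apply continuity_2d_pt_inv; auto. simpl.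
  apply continuity_2d_pt_plus; repeat apply continuity_2d_pt_mult; auto; apply continuity_2d_pt_const. }
split; simpl; unfold Rdiv; apply continuity_2d_pt_mult; auto. now apply continuity_2d_pt_opp.
Qed.

Lemma antiholo_inv G G' x t : antiholo G G' x t -> G x t <> RtoC 0 ->
  antiholo (fun u v => / G u v)%C (fun u v => - G' u v * (/ G u v * / G u v))%C x t.
Proof.
intros [A1 [A2 [A3 A4]]] H0. split; [|split; [|split]].
- apply (is_dC_inv (fun y => G y t)); auto.
- replace (- Ci * (- G' x t * (/ G x t * / G x t)))%C with
   (- (- Ci * G' x t) * (/ G x t * / G x t))%C by ring.
  apply (is_dC_inv (fun y => G x y)); auto.
- now apply cont2_inv.
- apply cont2_mult; [|apply cont2_mult; now apply cont2_inv].
  destruct A4 as [C1 C2]; split; simpl; now apply continuity_2d_pt_opp.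
Qed.

Lemma antiholo_cpow y G G' x t : antiholo G G' x t ->
  antiholo (fun u v => cpow y (G u v)) (fun u v => (- RtoC (ln y) * G' u v) * cpow y (G u v))%C x t.
Proof.
intros H. unfold cpow.
assert (H1 := antiholo_mult _ _ _ _ x t (antiholo_const (- RtoC (ln y))%C x t) H).
apply antiholo_cexp in H1.
destruct H1 as [A1 [A2 [A3 A4]]]. split; [|split; [|split]]; auto.
- replace (- RtoC (ln y) * G' x t)%C with (0 * G x t + - RtoC (ln y) * G' x t)%C by ring. exact A1.
- replace (- RtoC (ln y) * G' x t)%C with (0 * G x t + - RtoC (ln y) * G' x t)%C by ring. exact A2.
- apply cont2_mult; auto. apply cont2_mult; [apply cont2_const|]. apply H.
Qed.

(** Restricting to [t > 0] keeps every point off the real axis, where the poles of the truncated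
    zeta factors lie; hence no residues occur. *)
Definition has_antiholo (G : R -> R -> C) : Prop :=
  exists G', forall x t, 0 < t -> antiholo G G' x t.

Lemma has_antiholo_mult F G : has_antiholo F -> has_antiholo G ->
  has_antiholo (fun u v => F u v * G u v)%C.
Proof.
intros [F' HF] [G' HG]. eexists. intros x t Ht. apply antiholo_mult; auto.
Qed.

Lemma has_antiholo_cpow (y b c : R) :
  has_antiholo (fun u v => cpow y (- aff b c u v)%C).
Proof.
eexists. intros x t Ht. apply antiholo_cpow.
replace (fun u v => - aff b c u v)%C with
  (fun u v => - (1) * aff b c u v)%C.
- apply antiholo_mult; [apply antiholo_const | apply antiholo_affine].
- do 2 (apply functional_extensionality; intro). ring.
Qed.

Lemma has_antiholo_Zeta_ps X b c : 0 < b ->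
  has_antiholo (fun u v => Zeta_ps X (aff b c u v)).
Proof.
intros Hb. eexists. intros x t Ht.
assert (HA := antiholo_affine b c x t).
assert (H1 : antiholo (fun u v => csum (fun n => cpow (INR n) (aff b c u v)) X) _ x t) by
  (apply antiholo_csum; intros n Hn; apply antiholo_cpow, HA).
assert (H2 := antiholo_plus _ _ _ _ x t (antiholo_const (- (1))%C x t) HA).
assert (H3 := antiholo_mult _ _ _ _ x t (antiholo_const (- (1))%C x t) H2).
apply antiholo_inv in H3.
2:{ intros E. apply (f_equal snd) in E. simpl in E. assert (0 < b * t) by now apply Rmult_lt_0_compat. lra. }
assert (H4 := antiholo_cpow (INR X) _ _ x t H2).
apply (antiholo_mult _ _ _ _ x t (antiholo_const (- (1))%C x t)) in H4.
assert (H5 := antiholo_plus _ _ _ _ x t H1 (antiholo_mult _ _ _ _ x t H4 H3)).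
replace (fun u v => Zeta_ps X (aff b c u v)) with
 (fun u v => (csum (fun n => cpow (INR n) (aff b c u v)) X +
   - (1) * cpow (INR X) (- (1) + aff b c u v) *
   / (- (1) * (- (1) + aff b c u v)))%C).
- exact H5.
- apply functional_extensionality; intro u. apply functional_extensionality; intro v.
  unfold Zeta_ps. rewrite (csum_ext (fun n => npow n _) _ X (fun n _ => npow_cpow n _)).
  set (s := aff b c u v : C).
  replace (- (1) * (- (1) + s))%C with (1 - s)%C by ring.
  replace (- (1) + s)%C with (s - 1)%C by ring. unfold Cdiv. ring.
Qed.

(** * Complex integrals and Cauchy's theorem on a rectangle *)

Definition cint (f : R -> C) (a b : R) : C :=
  (RInt (fun t => fst (f t)) a b, RInt (fun t => snd (f t)) a b).

Lemma continuity_2d_1d (f : R -> R -> R) x t : continuity_2d_pt f x t -> continuous (fun v => f x v) t.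
Proof.
intros H. apply continuity_pt_filterlim. intros eps Heps.
destruct (H (mkposreal eps Heps)) as [d Hd]. exists d. split; [apply cond_pos|].
intros y [_ Hy]. apply Hd; [rewrite Rminus_eq_0, Rabs_R0; apply cond_pos | exact Hy].
Qed.

(* Cauchy's theorem on a rectangle, by differentiating under the integral sign: the derivative of
   [cint (G x) a b] in [x] is [i (G x b - G x a)]. *)
Lemma contour_shift (G : R -> R -> C) (a b x0 x1 B : R) : has_antiholo G -> 0 < a <= b -> x0 <= x1 ->
  (forall x, x0 <= x <= x1 -> Cmod (G x a) <= B /\ Cmod (G x b) <= B) ->
  Cmod (cint (G x1) a b - cint (G x0) a b)%C <= 2 * B * (x1 - x0).
Proof.
intros [G' HG] Hab Hx HB.
replace (2 * B * (x1 - x0)) with (2 * B * x1 - 2 * B * x0) by ring.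
apply (Cmod_incr_le (fun x => cint (G x) a b) (fun x => Ci * (G x b - G x a))%C
  (fun x => 2 * B * x) (fun _ => 2 * B)); auto.
- intros x _.
  assert (key : forall p : C -> R, 
    (forall u v l, is_dC (fun y => G y v) u l -> is_derive (fun y => p (G y v)) u (p l)) ->
    (forall u v l, is_dC (fun y => G u y) v (- Ci * l)%C -> is_derive (fun y => p (Ci * G u y)%C) v (p l)) ->
    (forall u v, cont2 G u v -> continuity_2d_pt (fun u v => p (G u v)) u v) ->
    (forall u v, cont2 G' u v -> continuity_2d_pt (fun u v => p (G' u v)) u v) ->
    (forall z w, p z - p w = p (z - w)%C) ->
    is_derive (fun y => RInt (fun t => p (G y t)) a b) x (p (Ci * (G x b - G x a))%C)).
  { intros p Hp1 Hp2 Hp3 Hp4 Hp5.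
    (* The [t]-derivative of [G] is [- i G'], so [i G] is a primitive of [G'] in [t], and the
       integral of the [x]-derivative is a boundary term. *)
    assert (HI : is_RInt (fun t => p (G' x t)) a b (p (Ci * (G x b - G x a))%C)).
    { replace (p (Ci * (G x b - G x a))%C) with (minus (p (Ci * G x b)%C) (p (Ci * G x a)%C)).
      - apply (is_RInt_derive (V := R_CompleteNormedModule) (fun t => p (Ci * G x t)%C)).
        + intros t Ht. rewrite Rmin_left in Ht by lra. apply Hp2, HG; lra.
        + intros t Ht. rewrite Rmin_left in Ht by lra.
          apply (continuity_2d_1d (fun u v => p (G' u v))). apply Hp4, HG; lra.
      - change (minus (p (Ci * G x b)%C) (p (Ci * G x a)%C)) with (p (Ci * G x b)%C - p (Ci * G x a)%C).
        rewrite Hp5. f_equal. ring. }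
    assert (HD : forall u t, 0 < t -> Derive (fun z => p (G z t)) u = p (G' u t)).
    { intros u t Ht. apply is_derive_unique, Hp1, HG; auto. }
    rewrite <- (is_RInt_unique _ _ _ _ HI).
    rewrite <- (RInt_ext (fun t => Derive (fun u => p (G u t)) x)).
    - apply (is_derive_RInt_param (fun u t => p (G u t))).
      + exists (mkposreal 1 Rlt_0_1). intros y _ t Ht. rewrite Rmin_left in Ht by lra.
        exists (p (G' y t)). apply (Hp1 y t). apply (HG y t). lra.
      + intros t Ht. rewrite Rmin_left in Ht by lra.
        apply (continuity_2d_pt_ext_loc (fun u v => p (G' u v))).
        * assert (Ht2 : 0 < t) by lra. exists (mkposreal t Ht2). simpl. intros u v _ Hv.
          symmetry. apply HD. apply Rabs_lt_between in Hv. lra.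
        * apply Hp4, HG. lra.
      + exists (mkposreal 1 Rlt_0_1). intros y _. apply (ex_RInt_continuous (V := R_CompleteNormedModule)).
        intros t Ht. rewrite Rmin_left in Ht by lra.
        apply (continuity_2d_1d (fun u v => p (G u v))). apply Hp3, HG; lra.
    - intros t Ht. rewrite Rmin_left in Ht by lra. apply HD. lra. }
  split; simpl fst; simpl snd; [apply (key fst) | apply (key snd)].
  + intros u v l [H _]; exact H.
  + intros u v l [_ H]. simpl in *.
    apply (is_derive_ext (fun y => - snd (G u y))); [intros y; simpl; ring|].
    replace (fst l) with (- (- 0 * snd l + - (1) * fst l)) by ring.
    apply derR_opp. exact H.
  + intros u v H; apply H.
  + intros u v H; apply H.
  + intros; simpl; ring.
  + intros u v l [_ H]; exact H.
  + intros u v l [H _]. simpl in *.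
    apply (is_derive_ext (fun y => fst (G u y))); [intros y; simpl; ring|].
    replace (snd l) with (- 0 * fst l - - (1) * snd l) by ring. exact H.
  + intros u v H; apply H.
  + intros u v H; apply H.
  + intros; simpl; ring.
- intros x _. auto_derive; auto; ring.
- intros x Hx1. rewrite Cmod_mult. destruct (HB x Hx1) as [B1 B2].
  replace (Cmod Ci) with 1.
  + assert (T := Cmod_triangle (G x b) (- G x a)%C). rewrite Cmod_opp in T.
    unfold Cminus. lra.
  + unfold Cmod, Ci; simpl. replace (0 * (0*1) + 1 * (1*1)) with 1 by ring. now rewrite sqrt_1.
Qed.

(** * The integral belonging to a single n *)

Definition is_cint (f : R -> C) (a b : R) (l : C) : Prop :=
  is_RInt (fun t => fst (f t)) a b (fst l) /\ is_RInt (fun t => snd (f t)) a b (snd l).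

Lemma is_cint_unique f a b l : is_cint f a b l -> cint f a b = l.
Proof.
intros [H1 H2]. unfold cint. rewrite (is_RInt_unique _ _ _ _ H1), (is_RInt_unique _ _ _ _ H2).
now destruct l.
Qed.

Lemma is_cint_plus f g a b l m : is_cint f a b l -> is_cint g a b m ->
  is_cint (fun t => f t + g t)%C a b (l + m)%C.
Proof.
intros [H1 H2] [H3 H4]. split.
- exact (is_RInt_plus (V := R_NormedModule) _ _ _ _ _ _ H1 H3).
- exact (is_RInt_plus (V := R_NormedModule) _ _ _ _ _ _ H2 H4).
Qed.

Lemma is_cint_minus f g a b l m : is_cint f a b l -> is_cint g a b m ->
  is_cint (fun t => f t - g t)%C a b (l - m)%C.
Proof.
intros [H1 H2] [H3 H4]. split.
- exact (is_RInt_minus (V := R_NormedModule) _ _ _ _ _ _ H1 H3).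
- exact (is_RInt_minus (V := R_NormedModule) _ _ _ _ _ _ H2 H4).
Qed.

Lemma is_cint_0 a b : is_cint (fun _ => RtoC 0) a b (RtoC 0).
Proof.
split; simpl; assert (H := is_RInt_const (V := R_NormedModule) a b 0);
 unfold scal in H; simpl in H; unfold mult in H; simpl in H; rewrite Rmult_0_r in H; exact H.
Qed.

Lemma is_cint_scal c f a b l : is_cint f a b l -> is_cint (fun t => c * f t)%C a b (c * l)%C.
Proof.
intros [H1 H2].
assert (S1 := fun k => is_RInt_scal (V := R_NormedModule) _ a b k _ H1).
assert (S2 := fun k => is_RInt_scal (V := R_NormedModule) _ a b k _ H2).
split.
- exact (is_RInt_minus (V := R_NormedModule) _ _ _ _ _ _ (S1 (fst c)) (S2 (snd c))).
- exact (is_RInt_plus (V := R_NormedModule) _ _ _ _ _ _ (S2 (fst c)) (S1 (snd c))).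
Qed.

Lemma is_cint_csum (f : nat -> R -> C) (l : nat -> C) a b N :
  (forall n, (1 <= n <= N)%nat -> is_cint (f n) a b (l n)) ->
  is_cint (fun t => csum (fun n => f n t) N) a b (csum l N).
Proof.
induction N as [|N IH]; intros H; cbn [csum]; [apply is_cint_0|].
apply is_cint_plus; [apply IH; intros; apply H; lia | apply H; lia].
Qed.

Lemma is_cint_ext f g a b l : a <= b -> (forall t, a < t < b -> f t = g t) ->
  is_cint f a b l -> is_cint g a b l.
Proof.
intros Hab H [H1 H2]. split.
- eapply is_RInt_ext; [|exact H1]. intros t Ht. rewrite Rmin_left, Rmax_right in Ht by lra.
  simpl. now rewrite H.
- eapply is_RInt_ext; [|exact H2]. intros t Ht. rewrite Rmin_left, Rmax_right in Ht by lra.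
  simpl. now rewrite H.
Qed.

Lemma is_cint_Chasles f a b c l m : is_cint f a b l -> is_cint f b c m -> is_cint f a c (l + m)%C.
Proof.
intros [H1 H2] [H3 H4]. split.
- exact (is_RInt_Chasles (V := R_NormedModule) _ _ _ _ _ _ H1 H3).
- exact (is_RInt_Chasles (V := R_NormedModule) _ _ _ _ _ _ H2 H4).
Qed.

(** The factor 2 comes from bounding the real and imaginary parts separately. *)
Lemma is_cint_bound f a b l M : a <= b -> is_cint f a b l ->
  (forall t, a <= t <= b -> Cmod (f t) <= M) -> Cmod l <= 2 * M * (b - a).
Proof.
intros Hab [H1 H2] HM. eapply Rle_trans; [apply Cmod_le_abs|].
assert (B1 := norm_RInt_le_const (V := R_NormedModule) _ a b _ M Hab
  (fun t Ht => Rle_trans _ _ _ (Rabs_fst_Cmod (f t)) (HM t Ht)) H1).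
assert (B2 := norm_RInt_le_const (V := R_NormedModule) _ a b _ M Hab
  (fun t Ht => Rle_trans _ _ _ (Rabs_snd_Cmod (f t)) (HM t Ht)) H2).
change (norm (fst l)) with (Rabs (fst l)) in B1. change (norm (snd l)) with (Rabs (snd l)) in B2. lra.
Qed.

Definition ccont (f : R -> C) (t : R) : Prop :=
  continuous (fun y => fst (f y)) t /\ continuous (fun y => snd (f y)) t.

Lemma is_cint_cint f a b : a <= b -> (forall t, a <= t <= b -> ccont f t) ->
  is_cint f a b (cint f a b).
Proof.
intros Hab H. unfold cint. split; simpl; apply (RInt_correct (V := R_CompleteNormedModule));
apply (ex_RInt_continuous (V := R_CompleteNormedModule)); intros t Ht;
rewrite Rmin_left, Rmax_right in Ht by lra; apply H; auto.
Qed.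

Lemma ccont_mult f g t : ccont f t -> ccont g t -> ccont (fun y => f y * g y)%C t.
Proof.
intros [H1 H2] [H3 H4]. split; simpl.
- apply (continuous_minus (V := R_NormedModule)); now apply (continuous_mult (K := R_AbsRing)).
- apply (continuous_plus (V := R_NormedModule)); now apply (continuous_mult (K := R_AbsRing)).
Qed.

Lemma ccont_dC f t l : is_dC f t l -> ccont f t.
Proof.
intros [H1 H2]. split; apply (ex_derive_continuous (K := R_AbsRing) (V := R_NormedModule)); eexists; eauto.
Qed.

Lemma has_antiholo_ccont G x t : has_antiholo G -> 0 < t -> ccont (G x) t.
Proof. intros [G' HG] Ht. eapply ccont_dC. apply (HG x t Ht). Qed.

Lemma is_cint_cis al a b : al <> 0 ->
  is_cint (fun t => cis (t * al)) a b
   ((sin (b * al) - sin (a * al)) / al, - (cos (b * al) - cos (a * al)) / al).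
Proof.
intros Hal. split; cbn [fst snd cis].
- replace ((sin (b * al) - sin (a * al)) / al) with (minus (sin (b * al) / al) (sin (a * al) / al)).
  2:{ unfold minus, plus, opp; simpl. field. auto. }
  apply (is_RInt_derive (V := R_CompleteNormedModule) (fun t => sin (t * al) / al)).
  + intros t _. auto_derive; auto. field; auto.
  + intros t _. apply (ex_derive_continuous (K := R_AbsRing) (V := R_NormedModule)). auto_derive; auto.
- replace (- (cos (b * al) - cos (a * al)) / al) with (minus (- cos (b * al) / al) (- cos (a * al) / al)).
  2:{ unfold minus, plus, opp; simpl. field. auto. }
  apply (is_RInt_derive (V := R_CompleteNormedModule) (fun t => - cos (t * al) / al)).
  + intros t _. auto_derive; auto. field; auto.
  + intros t _. apply (ex_derive_continuous (K := R_AbsRing) (V := R_NormedModule)). auto_derive; auto.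
Qed.

Lemma cint_cis_bound al a b : al <> 0 -> Cmod (cint (fun t => cis (t * al)) a b) <= 4 / Rabs al.
Proof.
intros Hal. rewrite (is_cint_unique _ _ _ _ (is_cint_cis al a b Hal)).
eapply Rle_trans; [apply Cmod_le_abs|]. cbn [fst snd].
assert (Hp : 0 < Rabs al) by now apply Rabs_pos_lt.
unfold Rdiv. rewrite !Rabs_mult, Rabs_inv, Rabs_Ropp.
assert (K1 : Rabs (sin (b * al) - sin (a * al)) <= 2).
{ apply Rabs_le. assert (X := SIN_bound (b * al)). assert (Y := SIN_bound (a * al)). lra. }
assert (K2 : Rabs (cos (b * al) - cos (a * al)) <= 2).
{ apply Rabs_le. assert (X := COS_bound (b * al)). assert (Y := COS_bound (a * al)). lra. }
assert (0 < / Rabs al) by now apply Rinv_0_lt_compat. nra.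
Qed.

Lemma is_RInt_constR (a b c : R) : is_RInt (fun _ : R => c) a b ((b - a) * c).
Proof. exact (is_RInt_const (V := R_NormedModule) a b c). Qed.

Lemma is_cint_cis_0 a b : is_cint (fun t => cis (t * 0)) a b (RtoC (b - a)).
Proof.
split; cbn [fst snd RtoC cis].
- apply (is_RInt_ext (fun _ => 1)); [intros t _; now rewrite Rmult_0_r, cos_0|].
  replace (b - a) with ((b - a) * 1) by ring. apply is_RInt_constR.
- apply (is_RInt_ext (fun _ => 0)); [intros t _; now rewrite Rmult_0_r, sin_0|].
  assert (H := is_RInt_constR a b 0). rewrite Rmult_0_r in H. exact H.
Qed.

Lemma is_cint_cint_cis al a b :
  is_cint (fun t => cis (t * al)) a b (cint (fun t => cis (t * al)) a b).
Proof.
destruct (Req_dec al 0) as [->|H].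
- assert (Hc := is_cint_cis_0 a b). now rewrite (is_cint_unique _ _ _ _ Hc).
- assert (X := is_cint_cis al a b H). now rewrite (is_cint_unique _ _ _ _ X).
Qed.

(** The induction carries [3 - 2 N^(-1/2)], which comes from comparison with the integral of
    [x^(-3/2)], because the plain bound 3 is not inductive. *)
Lemma rsum_3_2 N : rsum (fun k => Rpower (INR k) (- (3 / 2))) N <= 3.
Proof.
assert (H : (1 <= N)%nat -> rsum (fun k => Rpower (INR k) (- (3 / 2))) N <= 3 - 2 * Rpower (INR N) (- / 2)).
{ induction 1 as [|N HN IH].
  - simpl. unfold Rpower. rewrite ln_1, !Rmult_0_r, exp_0. lra.
  - cbn [rsum].
    assert (H1 : 1 <= INR N) by (apply (le_INR 1); lia).
    assert (M : Rpower (INR (S N)) (- (3 / 2)) <= 2 * Rpower (INR N) (- / 2) - 2 * Rpower (INR (S N)) (- / 2)).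
    { set (q := Rpower (INR (S N)) (- (3 / 2))).
      assert (G := nondecr_of_derive (fun x => - 2 * Rpower x (- / 2) - q * x)
        (fun x => - 2 * (- / 2 * Rpower x (- / 2 - 1)) - q * 1) (INR N) (INR (S N))).
      rewrite S_INR in *.
      assert (G2 : - 2 * Rpower (INR N) (- / 2) - q * INR N <= 
         - 2 * Rpower (INR N + 1) (- / 2) - q * (INR N + 1)).
      { apply G; try lra.
        - intros x Hx. apply derR_minus; apply derR_scal; [apply is_derive_Rpower; lra | apply (is_derive_id x)].
        - intros x Hx. replace (- / 2 - 1) with (- (3 / 2)) by lra.
          assert (Rpower (INR N + 1) (- (3 / 2)) <= Rpower x (- (3 / 2))) by (apply Rpower_decr; lra).
          unfold q. rewrite S_INR. lra. }
      lra. }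
    lra. }
destruct N; [simpl; lra|].
assert (X1 := H ltac:(lia)). assert (X2 := Rpower_pos (INR (S N)) (- / 2)). lra.
Qed.

Section ShiftedIntegral.
Variables (b X n : nat).
Hypothesis Hb : (1 <= b)%nat.
Hypothesis Hn : (1 <= n)%nat.
Hypothesis HX : (1 <= X)%nat.

(* With [w = x - i t]: [n^(w - 1/2) zeta(1/2 + b (w - 1/2)) zeta(w)], each zeta truncated at [X].
   On [x = 1/2] this is [n^(-i t) zeta(1/2 - i b t) zeta(1/2 - i t)]. *)
Definition shift_integrand (x t : R) : C :=
  (cpow (INR n) (- aff 1 (- / 2) x t) *
    (Zeta_ps X (aff (INR b) (/ 2 - INR b / 2) x t) * Zeta_ps X (aff 1 0 x t)))%C.

Lemma one_le_INR_b : 1 <= INR b.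
Proof. apply (le_INR 1). exact Hb. Qed.

Lemma shift_integrand_antiholo : has_antiholo shift_integrand.
Proof.
assert (H := one_le_INR_b).
apply has_antiholo_mult; [apply has_antiholo_cpow|].
apply has_antiholo_mult; apply has_antiholo_Zeta_ps; lra.
Qed.

(** [n <= sqrt t] bounds the first factor by [t^((x - 1/2)/2)], and each zeta contributes [t^mu]
    with [mu = max(0, (1-x)/2)]; this includes the first one, because [1/2 + b (x - 1/2) >= x]. The
    total exponent is [3/4 - x/2] for [x <= 1] and [x/2 - 1/4] beyond, hence at most 1/2, with
    equality at both ends of the strip. *)
Lemma shift_integrand_horizontal (t x : R) : 6 <= t -> INR n <= sqrt t -> / 2 <= x <= 3 / 2 ->
  INR b * t * sqrt (INR b * t) <= INR X ->
  Cmod (shift_integrand x t) <= 40000 * INR b * (1 + ln (INR b)) * (sqrt t * (ln t) ^ 2).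
Proof.
intros Ht Hnt Hx HXb. assert (Hb1 := one_le_INR_b).
set (B := INR b) in *.
assert (Hln := ln_t_ge_1 t Ht).
assert (Hst : 0 < sqrt t) by (apply sqrt_lt_R0; lra).
assert (Hsp : sqrt t = Rpower t (/ 2)) by (rewrite Rpower_sqrt; auto; lra).
assert (Hlnb : 0 <= ln B) by (rewrite <- ln_1; apply ln_le; lra).
assert (Hbt : t <= B * t) by nra.
assert (Hsbt : sqrt t <= sqrt (B * t)) by (apply sqrt_le_1; lra).
unfold shift_integrand. rewrite !Cmod_mult, Cmod_cpow.
set (mu := Rmax 0 ((1 - x) / 2)).
assert (Hmu0 : 0 <= mu) by apply Rmax_l. assert (Hmu1 : (1 - x) / 2 <= mu) by apply Rmax_r.
assert (Z1 : Cmod (Zeta_ps X (aff B (/ 2 - B / 2) x t)) <= 200 * (B * Rpower t mu) * ((1 + ln B) * ln t)).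
{ unfold aff. eapply Rle_trans; [apply zeta_bound; auto; nra|].
  assert (M1 : Rpower (B * t) (Rmax 0 ((1 - (B * x + (/ 2 - B / 2))) / 2)) <= B * Rpower t mu).
  { apply Rle_trans with (Rpower (B * t) mu).
    - apply Rle_Rpower; [lra|]. apply Rmax_lub; auto. eapply Rle_trans; [|apply Hmu1]. nra.
    - rewrite <- Rpower_mult_distr by lra. apply Rmult_le_compat_r; [left; apply Rpower_pos|].
      rewrite <- (Rpower_1 B) at 2 by lra. apply Rle_Rpower; [lra|].
      apply Rmax_lub; lra. }
  assert (M2 : ln (B * t) <= (1 + ln B) * ln t) by (rewrite ln_mult by lra; nra).
  assert (Q := Rpower_pos (B * t) (Rmax 0 ((1 - (B * x + (/ 2 - B / 2))) / 2))).
  assert (0 <= ln (B * t)) by (rewrite ln_mult by lra; lra).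
  apply Rmult_le_compat; try lra. }
assert (Z2 : Cmod (Zeta_ps X (aff 1 0 x t)) <= 200 * Rpower t mu * ln t).
{ unfold aff. replace (1 * x + 0) with x by ring. replace (1 * t) with t by ring.
  apply zeta_bound; try lra. apply Rle_trans with (B * t * sqrt (B * t)); auto. nra. }
assert (Z0 : Rpower (INR n) (- fst (- aff 1 (- / 2) x t)%C) <= Rpower t ((x - / 2) / 2)).
{ unfold aff; simpl. replace (- - (1 * x + - / 2)) with (x - / 2) by ring.
  apply Rle_trans with (Rpower (sqrt t) (x - / 2)).
  - apply Rle_Rpower_l; [lra|]. split; [apply lt_0_INR; lia | auto].
  - rewrite Hsp, Rpower_mult. right. f_equal. field. }
assert (E : Rpower t ((x - / 2) / 2) * (Rpower t mu * Rpower t mu) <= sqrt t).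
{ rewrite <- !Rpower_plus, Hsp. apply Rle_Rpower; [lra|].
  unfold mu. destruct (Rle_or_lt x 1).
  - rewrite Rmax_right by lra. lra.
  - rewrite Rmax_left by lra. lra. }
apply Rle_trans with (Rpower t ((x - / 2) / 2) *
  ((200 * (B * Rpower t mu) * ((1 + ln B) * ln t)) * (200 * Rpower t mu * ln t))).
{ apply Rmult_le_compat; auto.
  - left; apply Rpower_pos.
  - apply Rmult_le_pos; apply Cmod_ge_0.
  - apply Rmult_le_compat; auto using Cmod_ge_0. }
replace (Rpower t ((x - / 2) / 2) *
  ((200 * (B * Rpower t mu) * ((1 + ln B) * ln t)) * (200 * Rpower t mu * ln t))) with
  ((40000 * B * (1 + ln B) * (ln t) ^ 2) * (Rpower t ((x - / 2) / 2) * (Rpower t mu * Rpower t mu))) by ring.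
replace (40000 * B * (1 + ln B) * (sqrt t * ln t ^ 2)) with
  ((40000 * B * (1 + ln B) * (ln t) ^ 2) * sqrt t) by ring.
apply Rmult_le_compat_l; auto.
apply Rmult_le_pos; [|apply pow_le; lra]. nra.
Qed.

Lemma shift_integral (t0 T : R) : 6 <= t0 <= T -> INR n <= sqrt t0 ->
  INR b * T * sqrt (INR b * T) <= INR X ->
  Cmod (cint (shift_integrand (3 / 2)) t0 T - cint (shift_integrand (/ 2)) t0 T)%C <=
  80000 * INR b * (1 + ln (INR b)) * (sqrt T * (ln T) ^ 2).
Proof.
intros Ht Hnt HXb. assert (Hb1 := one_le_INR_b).
assert (Hst : sqrt t0 <= sqrt T) by (apply sqrt_le_1; lra).
assert (Hlnb : 0 <= ln (INR b)) by (rewrite <- ln_1; apply ln_le; lra).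
assert (L0 := ln_t_ge_1 t0 ltac:(lra)). 
assert (L1 : ln t0 <= ln T) by (apply ln_le; lra).
assert (Hmono : sqrt t0 * ln t0 ^ 2 <= sqrt T * ln T ^ 2).
{ apply Rmult_le_compat; auto using sqrt_pos; [apply pow_le; lra|]. apply pow_incr; lra. }
assert (HX0 : INR b * t0 * sqrt (INR b * t0) <= INR X).
{ eapply Rle_trans; [|exact HXb]. apply Rmult_le_compat; try nra; auto using sqrt_pos.
  apply sqrt_le_1; nra. }
eapply Rle_trans; [apply (contour_shift shift_integrand t0 T (/ 2) (3 / 2)
   (40000 * INR b * (1 + ln (INR b)) * (sqrt T * (ln T) ^ 2)) shift_integrand_antiholo); try lra|].
- intros x Hx. split.
  + eapply Rle_trans; [apply shift_integrand_horizontal; auto; lra|].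
    apply Rmult_le_compat_l; [nra | auto].
  + apply shift_integrand_horizontal; auto; lra.
- lra.
Qed.

(** Dirichlet coefficients of the two zeta factors on [Re w = 3/2], where their arguments have real
    parts [b + 1/2] and [3/2]. *)
Definition dcoef (k m : nat) : R := Rpower (INR k) (- (INR b + / 2)) * Rpower (INR m) (- (3 / 2)).

(** For positive indices this is [log(k^b m / n)], zero exactly on the diagonal [n = k^b m]. *)
Definition freq (k m : nat) : R := INR b * ln (INR k) + ln (INR m) - ln (INR n).

Definition dirichlet_poly (t : R) : C :=
  csum (fun k => csum (fun m => RtoC (INR n * dcoef k m) * cis (t * freq k m))%C X) X.

(** At real part at least 3/2 the correction [X^(1-s)/(1-s)] of a truncation is at most
    [r = X^(-1/2)], as [|1-s| >= 1]. Both partial sums are at most 3, so the products differ by at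
    most [r^2 + 3r + 3r <= 7r]; the factor [n] is the modulus of [n^(w - 1/2)]. *)
Lemma shift_integrand_right (t : R) : 6 <= t ->
  Cmod (shift_integrand (3 / 2) t - dirichlet_poly t)%C <= INR n * (7 * Rpower (INR X) (- / 2)).
Proof.
intros Ht. assert (Hb1 := one_le_INR_b).
assert (Hn0 : 0 < INR n) by (apply lt_0_INR; lia).
assert (HX1 : 1 <= INR X) by (apply (le_INR 1); lia).
set (P1 := csum (fun k => npow k (INR b + / 2, - (INR b * t))) X).
set (P2 := csum (fun m => npow m (3 / 2, - t)) X).
set (s1 := (INR b + / 2, - (INR b * t)) : C). set (s2 := (3 / 2, - t) : C).
set (R1 := (cpow (INR X) (s1 - 1) / (1 - s1))%C).
set (R2 := (cpow (INR X) (s2 - 1) / (1 - s2))%C).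
assert (Ez : shift_integrand (3 / 2) t = (RtoC (INR n) * cis (- (t * ln (INR n))) * ((P1 - R1) * (P2 - R2)))%C).
{ unfold shift_integrand. f_equal; [|f_equal].
  - unfold cpow, cexp, aff, cis, Cmult, Copp, RtoC; cbn [fst snd].
    replace (- ln (INR n) * - (1 * (3 / 2) + - / 2) - - 0 * - - (1 * t)) with (ln (INR n)) by field.
    replace (- ln (INR n) * - - (1 * t) + - 0 * - (1 * (3 / 2) + - / 2)) with (- (t * ln (INR n))) by ring.
    rewrite exp_ln by auto. f_equal; ring.
  - unfold Zeta_ps, P1, R1, s1, aff. replace (INR b * (3 / 2) + (/ 2 - INR b / 2)) with (INR b + / 2) by field.
    reflexivity.
  - unfold Zeta_ps, P2, R2, s2, aff. replace (1 * (3 / 2) + 0) with (3 / 2) by field.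
    replace (1 * t) with t by ring. reflexivity. }
assert (Ed : dirichlet_poly t = (RtoC (INR n) * cis (- (t * ln (INR n))) * (P1 * P2))%C).
{ unfold P1, P2. rewrite csum_mult, <- csum_scal. unfold dirichlet_poly.
  apply csum_ext; intros k Hk. rewrite <- csum_scal. apply csum_ext; intros m Hm.
  unfold freq, dcoef. replace (t * (INR b * ln (INR k) + ln (INR m) - ln (INR n))) with
    (- (t * ln (INR n)) + (INR b * t * ln (INR k) + t * ln (INR m))) by ring.
  rewrite !cis_plus.
  assert (En : forall j a v, npow j (a, - v) = (RtoC (Rpower (INR j) (- a)) * cis (v * ln (INR j)))%C).
  { intros j a v. unfold npow, cis, Rpower, Cmult, RtoC; cbn [fst snd].
    replace (- v * ln (INR j)) with (- (v * ln (INR j))) by ring. rewrite cos_neg, sin_neg. f_equal; ring. }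
  rewrite !En, !RtoC_mult. ring. }
rewrite Ez, Ed.
set (r := Rpower (INR X) (- / 2)).
assert (Hr0 : 0 < r) by apply Rpower_pos.
assert (Hr1 : r <= 1) by (apply Rpower_le_1; lra).
assert (BP1 : Cmod P1 <= 3).
{ eapply Rle_trans; [apply Cmod_csum|]. eapply Rle_trans; [|apply (rsum_3_2 X)].
  apply rsum_le. intros k Hk. rewrite npow_cpow, Cmod_cpow. simpl fst.
  apply Rle_Rpower; [apply (le_INR 1); lia | lra]. }
assert (BP2 : Cmod P2 <= 3).
{ eapply Rle_trans; [apply Cmod_csum|]. eapply Rle_trans; [|apply (rsum_3_2 X)].
  apply rsum_le. intros k Hk. rewrite npow_cpow, Cmod_cpow. simpl fst. lra. }
assert (BR : forall s : C, 3 / 2 <= fst s -> snd s <= - (1) -> Cmod (cpow (INR X) (s - 1) / (1 - s))%C <= r).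
{ intros s Hs1 Hs2.
  assert (Hm : 1 <= Cmod (1 - s)%C).
  { eapply Rle_trans; [|apply Rabs_snd_Cmod]. simpl. rewrite Rabs_pos_eq; lra. }
  rewrite Cmod_div.
  2:{ intros E. rewrite E, Cmod_0 in Hm. lra. }
  apply Rle_div_l; [lra|]. rewrite Cmod_cpow. simpl fst.
  apply Rle_trans with (r * 1); [|apply Rmult_le_compat_l; lra]. rewrite Rmult_1_r.
  apply Rle_Rpower; lra. }
assert (Hbt : 1 <= INR b * t) by nra.
assert (BR1 : Cmod R1 <= r) by (apply BR; simpl; lra).
assert (BR2 : Cmod R2 <= r) by (apply BR; simpl; lra).
match goal with |- Cmod ?z <= _ => replace z with 
  (RtoC (INR n) * cis (- (t * ln (INR n))) * (R1 * R2 + (- (P1 * R2) + - (R1 * P2))))%C by ring end.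
rewrite !Cmod_mult, Cmod_cis, Cmod_R, Rabs_pos_eq, Rmult_1_r by lra.
apply Rmult_le_compat_l; [lra|].
eapply Rle_trans; [apply Cmod_triangle|].
eapply Rle_trans; [apply Rplus_le_compat_l, Cmod_triangle|].
rewrite !Cmod_opp, !Cmod_mult.
assert (A1 := Cmod_ge_0 P1). 
assert (A3 := Cmod_ge_0 R1). nra.
Qed.

Lemma dirichlet_poly_cint (t0 T : R) : is_cint dirichlet_poly t0 T
  (csum (fun k => csum (fun m => RtoC (INR n * dcoef k m) * cint (fun t => cis (t * freq k m)) t0 T)%C X) X).
Proof.
unfold dirichlet_poly.
apply (is_cint_csum (fun k t => csum (fun m => RtoC (INR n * dcoef k m) * cis (t * freq k m))%C X)).
intros k _.
apply (is_cint_csum (fun m t => RtoC (INR n * dcoef k m) * cis (t * freq k m))%C).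
intros m _. apply is_cint_scal, is_cint_cint_cis.
Qed.

Lemma shift_integral_left (t0 T : R) : 6 <= t0 <= T -> INR n <= sqrt t0 ->
  INR b * T * sqrt (INR b * T) <= INR X ->
  Cmod (cint (shift_integrand (/ 2)) t0 T -
     csum (fun k => csum (fun m => RtoC (INR n * dcoef k m) * cint (fun t => cis (t * freq k m)) t0 T)%C X) X)%C
  <= 80000 * INR b * (1 + ln (INR b)) * (sqrt T * (ln T) ^ 2) + 14 * INR n * T * Rpower (INR X) (- / 2).
Proof.
intros Ht Hnt HXb.
set (D := csum _ X).
assert (HD := dirichlet_poly_cint t0 T). fold D in HD.
assert (HZ : is_cint (shift_integrand (3 / 2)) t0 T (cint (shift_integrand (3 / 2)) t0 T)).
{ apply is_cint_cint; [lra|]. intros t Ht2. apply has_antiholo_ccont; [apply shift_integrand_antiholo | lra]. }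
assert (HM := is_cint_minus _ _ _ _ _ _ HZ HD).
assert (B1 : Cmod (cint (shift_integrand (3 / 2)) t0 T - D)%C <= 2 * (INR n * (7 * Rpower (INR X) (- / 2))) * (T - t0)).
{ apply (is_cint_bound (fun t => shift_integrand (3 / 2) t - dirichlet_poly t)%C); auto; [lra|].
  intros t Ht2. apply shift_integrand_right. lra. }
assert (B2 := shift_integral t0 T Ht Hnt HXb).
assert (Q := Rpower_pos (INR X) (- / 2)). assert (Q2 := pos_INR n).
assert (2 * (INR n * (7 * Rpower (INR X) (- / 2))) * (T - t0) <= 14 * INR n * T * Rpower (INR X) (- / 2)).
{ replace (2 * (INR n * (7 * Rpower (INR X) (- / 2))) * (T - t0)) with
   (14 * INR n * Rpower (INR X) (- / 2) * (T - t0)) by ring.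
  replace (14 * INR n * T * Rpower (INR X) (- / 2)) with
   (14 * INR n * Rpower (INR X) (- / 2) * T) by ring.
  apply Rmult_le_compat_l; [|lra]. apply Rmult_le_pos; lra. }
replace (cint (shift_integrand (/ 2)) t0 T - D)%C with
 (- (cint (shift_integrand (3 / 2)) t0 T - cint (shift_integrand (/ 2)) t0 T) + (cint (shift_integrand (3 / 2)) t0 T - D))%C by ring.
eapply Rle_trans; [apply Cmod_triangle|]. rewrite Cmod_opp. lra.
Qed.
End ShiftedIntegral.

(** * Off-diagonal terms *)

Definition harmonic (N : nat) : R := rsum (fun n => / INR n) N.

Lemma harmonic_S N : harmonic (S N) = harmonic N + / INR (S N).
Proof. reflexivity. Qed.

Lemma harmonic_mono N M : (N <= M)%nat -> harmonic N <= harmonic M.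
Proof.
induction 1 as [|M H IH]; [lra|]. rewrite harmonic_S.
assert (0 < / INR (S M)) by (apply Rinv_0_lt_compat, lt_0_INR; lia). lra.
Qed.

Lemma harmonic_subadd a N : harmonic (a + N) <= harmonic a + harmonic N.
Proof.
induction N as [|N IH].
- rewrite Nat.add_0_r. unfold harmonic at 3. simpl. lra.
- rewrite Nat.add_succ_r, !harmonic_S.
  assert (/ INR (S (a + N)) <= / INR (S N)).
  { apply Rinv_le_contravar; [apply lt_0_INR; lia | apply le_INR; lia]. }
  lra.
Qed.

Definition invdist (n r : nat) : R := if Nat.eq_dec n r then 0 else / Rabs (INR n - INR r).

(** The bound is uniform in [r], which may lie far beyond [N]: the indices below [r] contribute
    [H(r-1) - H(r-1-N)], at most [H(N)] by subadditivity of the harmonic numbers. Truncated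
    subtraction makes the same formula valid for [r <= N]. *)
Lemma invdist_sum r N : rsum (fun n => invdist n r) N <= 2 * harmonic N.
Proof.
set (w1 := fun n => if lt_dec n r then / INR (r - n) else 0).
set (w2 := fun n => if lt_dec r n then / INR (n - r) else 0).
assert (E : rsum (fun n => invdist n r) N = rsum w1 N + rsum w2 N).
{ rewrite <- rsum_plus. apply rsum_ext. intros n Hn. unfold invdist, w1, w2.
  destruct (Nat.eq_dec n r), (lt_dec n r), (lt_dec r n); try lia; try lra.
  - rewrite minus_INR by lia. rewrite Rplus_0_r. f_equal. apply lt_INR in l.
    rewrite Rabs_minus_sym, Rabs_pos_eq; lra.
  - rewrite minus_INR by lia. rewrite Rplus_0_l. f_equal. apply lt_INR in l.
    rewrite Rabs_pos_eq; lra. }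
rewrite E.
assert (E2 : rsum w2 N = harmonic (N - r)).
{ clear E. induction N as [|N IH]; [reflexivity|]. cbn [rsum]. rewrite IH. unfold w2.
  destruct (lt_dec r (S N)).
  - replace (S N - r)%nat with (S (N - r)) by lia. now rewrite harmonic_S.
  - replace (S N - r)%nat with (N - r)%nat by lia. lra. }
assert (E1 : rsum w1 N = harmonic (r - 1) - harmonic (r - 1 - N)).
{ clear E E2. induction N as [|N IH]; [rewrite Nat.sub_0_r; simpl; lra|]. cbn [rsum]. rewrite IH. unfold w1.
  destruct (lt_dec (S N) r).
  - replace (r - 1 - N)%nat with (S (r - 1 - S N)) by lia. rewrite harmonic_S.
    replace (S (r - 1 - S N)) with (r - S N)%nat by lia. lra.
  - replace (r - 1 - N)%nat with (r - 1 - S N)%nat by lia. lra. }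
assert (harmonic (N - r) <= harmonic N) by (apply harmonic_mono; lia).
assert (harmonic (r - 1) <= harmonic (r - 1 - N) + harmonic N).
{ eapply Rle_trans; [|apply harmonic_subadd]. apply harmonic_mono. lia. }
lra.
Qed.

(** [|log(r/n)| >= 1 - min/max], whose inverse is [max(n,r)/|n-r| <= 1 + n/|n-r|]. Only [n] appears
    as a factor, which keeps the bound usable for unbounded [r]. *)
Lemma inv_ln_ratio (n r : nat) : (1 <= n)%nat -> (1 <= r)%nat -> n <> r ->
  ln (INR r) - ln (INR n) <> 0 /\
  / Rabs (ln (INR r) - ln (INR n)) <= 1 + INR n * invdist n r.
Proof.
intros Hn Hr Hnr.
assert (Hn0 : 0 < INR n) by (apply lt_0_INR; lia).
assert (Hr0 : 0 < INR r) by (apply lt_0_INR; lia).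
unfold invdist. destruct (Nat.eq_dec n r) as [|_]; [contradiction|].
destruct (Nat.lt_gt_cases n r) as [[H|H] _]; auto; apply lt_INR in H.
- assert (L : 1 - INR n / INR r <= ln (INR r) - ln (INR n)).
  { rewrite <- ln_div by auto. assert (X := ln_lower (INR r / INR n) ltac:(now apply Rdiv_lt_0_compat)).
    replace (INR n / INR r) with (/ (INR r / INR n)) by (field; lra). auto. }
  assert (P : 0 < 1 - INR n / INR r).
  { replace (1 - INR n / INR r) with ((INR r - INR n) / INR r) by (field; lra).
    apply Rdiv_lt_0_compat; lra. }
  split; [lra|]. rewrite Rabs_pos_eq by lra.
  rewrite Rabs_minus_sym, Rabs_pos_eq by lra.
  replace (1 + INR n * / (INR r - INR n)) with (/ (1 - INR n / INR r)).
  + apply Rinv_le_contravar; auto.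
  + field. repeat split; try lra.
- assert (L : 1 - INR r / INR n <= ln (INR n) - ln (INR r)).
  { rewrite <- ln_div by auto. assert (X := ln_lower (INR n / INR r) ltac:(now apply Rdiv_lt_0_compat)).
    replace (INR r / INR n) with (/ (INR n / INR r)) by (field; lra). auto. }
  assert (P : 0 < 1 - INR r / INR n).
  { replace (1 - INR r / INR n) with ((INR n - INR r) / INR n) by (field; lra).
    apply Rdiv_lt_0_compat; lra. }
  split; [lra|]. rewrite Rabs_minus_sym, Rabs_pos_eq by lra.
  rewrite Rabs_pos_eq by lra.
  apply Rle_trans with (/ (1 - INR r / INR n)).
  + apply Rinv_le_contravar; auto.
  + replace (/ (1 - INR r / INR n)) with (INR n * / (INR n - INR r)) by (field; lra). lra.
Qed.

(* The time at which the n-th term enters the Dirichlet polynomial. *)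
Definition Tstart (theta : R) (n : nat) : R := 2 * PI * Rpower (INR n) (/ theta).

(** On the diagonal, substituting [n = k^b m] turns [n^(1/2) k^(-(b+1/2)) m^(-3/2)], the coefficient
    produced by the shifted integral, into [k^(-(b+1)/2) / m]. *)
Definition diag_weight (b n k m : nat) : R :=
  if Nat.eq_dec (k ^ b * m) n then Rpower (INR k) (- ((INR b + 1) / 2)) * / INR m else 0.

Lemma ln_pow_mult b k m : (1 <= k)%nat -> (1 <= m)%nat ->
  ln (INR (k ^ b * m)) = INR b * ln (INR k) + ln (INR m).
Proof.
intros Hk Hm. rewrite mult_INR, pow_INR.
assert (0 < INR k) by (apply lt_0_INR; lia). assert (0 < INR m) by (apply lt_0_INR; lia).
rewrite ln_mult; [|apply pow_lt; auto | auto].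
now rewrite <- Rpower_pow, ln_Rpower by auto.
Qed.

(** On the diagonal [freq] vanishes and the integral is exactly [T - t0]. Elsewhere oscillation
    bounds it by [4/|freq|] whatever the endpoints, so the start time may depend on [n]. *)
Lemma offdiag_term b n k m t0 T : (1 <= b)%nat -> (1 <= n)%nat -> (1 <= k)%nat -> (1 <= m)%nat ->
  Cmod (RtoC (Rpower (INR n) (- / 2)) * (RtoC (INR n * dcoef b k m) * cint (fun t => cis (t * freq b n k m)) t0 T)
    - RtoC (diag_weight b n k m * (T - t0)))%C
  <= 4 * Rpower (INR n) (/ 2) * dcoef b k m * (1 + INR n * invdist n (k ^ b * m)).
Proof.
intros Hb Hn Hk Hm.
assert (Hn0 : 0 < INR n) by (apply lt_0_INR; lia).
assert (Hm0 : 0 < INR m) by (apply lt_0_INR; lia).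
assert (Hr : (1 <= k ^ b * m)%nat).
{ assert (k ^ b <> 0)%nat by (apply Nat.pow_nonzero; lia). nia. }
assert (Hd : 0 < dcoef b k m) by (apply Rmult_lt_0_compat; apply Rpower_pos).
assert (Hr2 := Rpower_pos (INR n) (/ 2)).
assert (Ef : freq b n k m = ln (INR (k ^ b * m)) - ln (INR n)).
{ unfold freq. now rewrite ln_pow_mult. }
assert (En : Rpower (INR n) (- / 2) * INR n = Rpower (INR n) (/ 2)).
{ rewrite <- (Rpower_1 (INR n)) at 2 by auto. rewrite <- Rpower_plus. f_equal. field. }
unfold diag_weight. destruct (Nat.eq_dec (k ^ b * m) n) as [E|E].
- assert (Ef0 : freq b n k m = 0) by (rewrite Ef, E; ring).
  rewrite (functional_extensionality (fun t => cis (t * freq b n k m)) (fun t => cis (t * 0)))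
   by (intros t; now rewrite Ef0).
  rewrite (is_cint_unique _ _ _ _ (is_cint_cis_0 t0 T)).
  rewrite <- !RtoC_mult, <- RtoC_minus, Cmod_R.
  match goal with |- Rabs ?x <= _ => replace x with 0 end.
  + rewrite Rabs_R0. unfold invdist. destruct (Nat.eq_dec n (k ^ b * m)); [|lia].
    rewrite Rmult_0_r, Rplus_0_r, Rmult_1_r. nra.
  + rewrite <- !Rmult_assoc, En. rewrite <- Rmult_minus_distr_r.
    match goal with |- 0 = ?x * _ => replace x with 0; [ring|] end.
    unfold dcoef.
    replace (Rpower (INR n) (/ 2)) with (Rpower (INR k) (INR b * / 2) * Rpower (INR m) (/ 2)).
    * replace (/ INR m) with (Rpower (INR m) (- (1))) by (rewrite Rpower_Ropp, Rpower_1; auto).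
      unfold Rpower. rewrite <- !exp_plus. 
      apply Rminus_diag_eq_sym || (symmetry; apply Rminus_diag_eq). f_equal. field.
    * rewrite <- E. unfold Rpower. rewrite ln_pow_mult, <- exp_plus by auto. f_equal. ring.
- assert (Hne : n <> (k ^ b * m)%nat) by auto.
  destruct (inv_ln_ratio n (k ^ b * m) Hn Hr Hne) as [L1 L2].
  rewrite <- Ef in L1, L2.
  rewrite Rmult_0_l. 
  match goal with |- Cmod ?z <= _ => replace z with 
   (RtoC (Rpower (INR n) (/ 2) * dcoef b k m) * cint (fun t => cis (t * freq b n k m)) t0 T)%C end.
  2:{ rewrite <- En, !RtoC_mult. ring. }
  rewrite Cmod_mult, Cmod_R, Rabs_pos_eq by nra.
  replace (4 * Rpower (INR n) (/ 2) * dcoef b k m * (1 + INR n * invdist n (k ^ b * m))) with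
   ((Rpower (INR n) (/ 2) * dcoef b k m) * (4 * (1 + INR n * invdist n (k ^ b * m)))) by ring.
  apply Rmult_le_compat_l; [nra|].
  eapply Rle_trans; [apply cint_cis_bound; auto|]. unfold Rdiv. apply Rmult_le_compat_l; lra.
Qed.

Lemma invdist_nonneg n r : 0 <= invdist n r.
Proof.
unfold invdist. destruct (Nat.eq_dec n r); [lra|]. left. apply Rinv_0_lt_compat, Rabs_pos_lt.
intros E. apply n0. apply INR_eq. lra.
Qed.

(** Summing over [n] first, with [r = k^b m] fixed, gives a bound uniform in [r]. The coefficients
    in [k] and [m] then each sum to at most 3, whence [36 = 9 * 4]. *)
Lemma offdiag_sum b N X : (1 <= b)%nat -> (1 <= N)%nat ->
  rsum (fun n => rsum (fun k => rsum (fun m =>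
     4 * Rpower (INR n) (/ 2) * dcoef b k m * (1 + INR n * invdist n (k ^ b * m))) X) X) N
  <= 36 * (Rpower (INR N) (3 / 2) * (3 + 2 * ln (INR N))).
Proof.
intros Hb HN.
assert (HN0 : 1 <= INR N) by (apply (le_INR 1); lia).
set (S := Rpower (INR N) (3 / 2)).
assert (HS0 : 0 < S) by apply Rpower_pos.
assert (HSe : S = Rpower (INR N) (/ 2) * INR N).
{ unfold S. rewrite <- (Rpower_1 (INR N)) at 3 by lra. rewrite <- Rpower_plus. f_equal. field. }
assert (inner : forall r, rsum (fun n => 4 * Rpower (INR n) (/ 2) * (1 + INR n * invdist n r)) N <=
   4 * S * (3 + 2 * ln (INR N))).
{ intros r.
  apply Rle_trans with (rsum (fun n => 4 * Rpower (INR N) (/ 2) + (4 * S) * invdist n r) N).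
  - apply rsum_le. intros n Hn.
    assert (Q := invdist_nonneg n r).
    assert (Q1 : 1 <= INR n) by (apply (le_INR 1); lia).
    assert (Q2 : INR n <= INR N) by (apply le_INR; lia).
    assert (Q3 : Rpower (INR n) (/ 2) <= Rpower (INR N) (/ 2)) by (apply Rle_Rpower_l; lra).
    assert (Q4 := Rpower_pos (INR n) (/ 2)).
    assert (Q5 : Rpower (INR n) (/ 2) * INR n <= S) by (rewrite HSe; apply Rmult_le_compat; lra).
    assert (Q6 : Rpower (INR n) (/ 2) * INR n * invdist n r <= S * invdist n r) by
      (apply Rmult_le_compat_r; lra).
    lra.
  - rewrite rsum_plus, rsum_const, rsum_scal.
    assert (A := invdist_sum r N). assert (B := harmonic_le N HN). fold (harmonic N) in B.
    replace (INR N * (4 * Rpower (INR N) (/ 2))) with (4 * S) by (rewrite HSe; ring).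
    assert (4 * S * rsum (fun n => invdist n r) N <= 4 * S * (2 * (1 + ln (INR N)))).
    { apply Rmult_le_compat_l; lra. }
    lra. }
rewrite rsum_swap.
apply Rle_trans with (rsum (fun k => rsum (fun m => dcoef b k m * (4 * S * (3 + 2 * ln (INR N)))) X) X).
- apply rsum_le. intros k Hk. rewrite rsum_swap. apply rsum_le. intros m Hm.
  rewrite (rsum_ext _ (fun n => dcoef b k m * (4 * Rpower (INR n) (/ 2) * (1 + INR n * invdist n (k ^ b * m)))))
    by (intros; ring).
  rewrite rsum_scal. apply Rmult_le_compat_l; [|apply inner].
  left. apply Rmult_lt_0_compat; apply Rpower_pos.
- assert (Hln : 0 <= ln (INR N)) by (rewrite <- ln_1; apply ln_le; lra).
  set (Q := 4 * S * (3 + 2 * ln (INR N))).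
  assert (HQ : 0 <= Q) by (unfold Q; nra).
  apply Rle_trans with (rsum (fun k => Rpower (INR k) (- (3 / 2)) * (3 * Q)) X).
  + apply rsum_le. intros k Hk.
    rewrite (rsum_ext _ (fun m => (Rpower (INR k) (- (INR b + / 2)) * Q) * Rpower (INR m) (- (3 / 2))))
     by (intros; unfold dcoef; ring).
    rewrite rsum_scal.
    assert (A := rsum_3_2 X).
    assert (A0 : 0 <= rsum (fun m => Rpower (INR m) (- (3 / 2))) X).
    { apply rsum_nonneg. intros. left. apply Rpower_pos. }
    assert (B : Rpower (INR k) (- (INR b + / 2)) <= Rpower (INR k) (- (3 / 2))).
    { apply Rle_Rpower; [apply (le_INR 1); lia|]. assert (1 <= INR b) by (apply (le_INR 1); lia). lra. }
    assert (C := Rpower_pos (INR k) (- (INR b + / 2))).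
    replace (Rpower (INR k) (- (3 / 2)) * (3 * Q)) with (Rpower (INR k) (- (3 / 2)) * Q * 3) by ring.
    apply Rmult_le_compat; try nra. 
  + rewrite (rsum_ext (fun k => Rpower (INR k) (- (3 / 2)) * (3 * Q)) (fun k => (3 * Q) * Rpower (INR k) (- (3 / 2)))) by (intros; apply Rmult_comm).
    rewrite rsum_scal. assert (A := rsum_3_2 X). unfold Q in *. nra.
Qed.

Lemma rsum_inv_sqrt N : rsum (fun n => Rpower (INR n) (- / 2)) N <= 2 * Rpower (INR N) (/ 2).
Proof.
induction N as [|N IH].
- simpl. assert (X := Rpower_pos 0 (/2)). lra.
- cbn [rsum]. destruct N as [|N].
  + simpl. unfold Rpower. rewrite ln_1, !Rmult_0_r, exp_0. lra.
  + set (q := Rpower (INR (S (S N))) (- / 2)) in *.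
    set (M := S N) in *.
    assert (H1 : 1 <= INR M) by (apply (le_INR 1); lia).
    assert (G : 2 * Rpower (INR M) (/ 2) - q * INR M <= 
         2 * Rpower (INR (S M)) (/ 2) - q * (INR (S M))).
    { apply (nondecr_of_derive (fun x => 2 * Rpower x (/ 2) - q * x)
        (fun x => 2 * (/ 2 * Rpower x (/ 2 - 1)) - q * 1) (INR M) (INR (S M))).
      - rewrite S_INR; lra.
      - intros x Hx. apply derR_minus; apply derR_scal; [apply is_derive_Rpower; lra | apply (is_derive_id x)].
      - intros x Hx. replace (/ 2 - 1) with (- (/ 2)) by lra.
        assert (q <= Rpower x (- / 2)) by (apply Rpower_decr; lra). lra. }
    rewrite S_INR in G |- *. unfold q in *. lra.
Qed.

Lemma shifted_total (theta T : R) (b X N : nat) : (1 <= b)%nat -> (1 <= N)%nat -> (N <= X)%nat ->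
  0 < theta <= / 2 -> 6 <= T ->
  (forall n, (1 <= n <= N)%nat -> Tstart theta n <= T) ->
  INR b * T * sqrt (INR b * T) <= INR X ->
  Cmod (csum (fun n => RtoC (Rpower (INR n) (- / 2)) * cint (shift_integrand b X n (/ 2)) (Tstart theta n) T)%C N
    - RtoC (rsum (fun n => rsum (fun k => rsum (fun m => (diag_weight b n k m * (T - Tstart theta n))%R) X) X) N))%C
  <= 2 * Rpower (INR N) (/ 2) * (80000 * INR b * (1 + ln (INR b)) * (sqrt T * (ln T) ^ 2))
     + INR N * (14 * INR N * T * Rpower (INR X) (- / 2))
     + 36 * (Rpower (INR N) (3 / 2) * (3 + 2 * ln (INR N))).
Proof.
intros Hb HN HNX Hth HT HTn HXb.
assert (HPI := PI2_3_2).
set (C1 := 80000 * INR b * (1 + ln (INR b)) * (sqrt T * (ln T) ^ 2)).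
assert (Hb1 : 1 <= INR b) by (apply (le_INR 1); lia).
assert (Hlnb : 0 <= ln (INR b)) by (rewrite <- ln_1; apply ln_le; lra).
assert (HC1 : 0 <= C1).
{ unfold C1. apply Rmult_le_pos; [nra|]. apply Rmult_le_pos; [apply sqrt_pos | apply pow2_ge_0]. }
set (D := fun n => csum (fun k => csum (fun m => RtoC (INR n * dcoef b k m) * cint (fun t => cis (t * freq b n k m)) (Tstart theta n) T)%C X) X).
(* Here [theta <= 1/2] enters: [1/theta >= 2] gives [T_n >= 2 pi n^2], hence both [T_n >= 6] and
   [n <= sqrt T_n]. *)
assert (HTn6 : forall n, (1 <= n)%nat -> 6 <= Tstart theta n /\ INR n <= sqrt (Tstart theta n)).
{ intros n Hn. assert (Hn1 : 1 <= INR n) by (apply (le_INR 1); lia).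
  assert (Hi : 2 <= / theta).
  { replace 2 with (/ / 2) by field. apply Rinv_le_contravar; lra. }
  assert (H2 : Rpower (INR n) 2 <= Rpower (INR n) (/ theta)) by (apply Rle_Rpower; lra).
  replace 2 with (INR 2) in H2 by reflexivity. rewrite Rpower_pow in H2 by lra.
  set (R1 := Rpower (INR n) (/ theta)) in *. simpl in H2.
  unfold Tstart. fold R1. split; [nra|].
  rewrite <- (sqrt_square (INR n)) by lra. apply sqrt_le_1; nra. }
assert (S1 : Cmod (csum (fun n => RtoC (Rpower (INR n) (- / 2)) * cint (shift_integrand b X n (/ 2)) (Tstart theta n) T)%C N
    - csum (fun n => RtoC (Rpower (INR n) (- / 2)) * D n)%C N)%C <=
   2 * Rpower (INR N) (/ 2) * C1 + INR N * (14 * INR N * T * Rpower (INR X) (- / 2))).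
{ rewrite <- csum_minus. eapply Rle_trans; [apply Cmod_csum|].
  apply Rle_trans with (rsum (fun n => C1 * Rpower (INR n) (- / 2) + 14 * INR N * T * Rpower (INR X) (- / 2)) N).
  - apply rsum_le. intros n Hn.
    replace (RtoC (Rpower (INR n) (- / 2)) * cint (shift_integrand b X n (/ 2)) (Tstart theta n) T - RtoC (Rpower (INR n) (- / 2)) * D n)%C
      with (RtoC (Rpower (INR n) (- / 2)) * (cint (shift_integrand b X n (/ 2)) (Tstart theta n) T - D n))%C by ring.
    rewrite Cmod_mult, Cmod_R, Rabs_pos_eq by (left; apply Rpower_pos).
    destruct (HTn6 n ltac:(lia)) as [A1 A2].
    assert (B := shift_integral_left b X n Hb ltac:(lia) ltac:(lia) (Tstart theta n) T
      (conj A1 (HTn n Hn)) A2 HXb). fold (D n) C1 in B.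
    assert (P := Rpower_pos (INR n) (- / 2)).
    assert (P1 : Rpower (INR n) (- / 2) <= 1) by (apply Rpower_le_1; [apply (le_INR 1); lia | lra]).
    assert (P2 := Rpower_pos (INR X) (- / 2)).
    assert (P3 : INR n <= INR N) by (apply le_INR; lia). assert (P4 := pos_INR n).
    set (E := T * Rpower (INR X) (- / 2)) in *.
    assert (HE : 0 < E) by (unfold E; nra).
    replace (14 * INR n * T * Rpower (INR X) (- / 2)) with (14 * INR n * E) in B by (unfold E; ring).
    replace (14 * INR N * T * Rpower (INR X) (- / 2)) with (14 * INR N * E) by (unfold E; ring).
    apply Rle_trans with (Rpower (INR n) (- / 2) * (C1 + 14 * INR n * E)); [apply Rmult_le_compat_l; lra|].
    assert (0 <= 14 * INR n * E) by (apply Rmult_le_pos; lra).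
    nra.
  - rewrite rsum_plus, rsum_const, rsum_scal. apply Rplus_le_compat_r.
    assert (A := rsum_inv_sqrt N). nra. }
assert (S2 : Cmod (csum (fun n => RtoC (Rpower (INR n) (- / 2)) * D n)%C N
    - RtoC (rsum (fun n => rsum (fun k => rsum (fun m => (diag_weight b n k m * (T - Tstart theta n))%R) X) X) N))%C <=
   36 * (Rpower (INR N) (3 / 2) * (3 + 2 * ln (INR N)))).
{ rewrite <- csum_RtoC, <- csum_minus.
  eapply Rle_trans; [apply Cmod_csum|]. eapply Rle_trans; [|apply (offdiag_sum b N X Hb HN)].
  apply rsum_le. intros n Hn. unfold D. rewrite <- csum_scal, <- csum_RtoC, <- csum_minus.
  eapply Rle_trans; [apply Cmod_csum|]. apply rsum_le. intros k Hk.
  rewrite <- csum_scal, <- csum_RtoC, <- csum_minus.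
  eapply Rle_trans; [apply Cmod_csum|]. apply rsum_le. intros m Hm.
  apply offdiag_term; auto; lia. }
match goal with |- Cmod (?a - ?c)%C <= _ => replace (a - c)%C with
  ((a - csum (fun n => RtoC (Rpower (INR n) (- / 2)) * D n) N) +
   (csum (fun n => RtoC (Rpower (INR n) (- / 2)) * D n) N - c))%C by ring end.
eapply Rle_trans; [apply Cmod_triangle|]. lra.
Qed.

(** * Reduction of the moment to the diagonal *)

(** Serves to make zeta on the critical line continuous, hence integrable: it is a locally uniform
    limit of truncations, which are differentiable. *)
Lemma continuous_uniform_approx (f : R -> R) (t0 : R) :
  (forall eps, 0 < eps -> exists g d, 0 < d /\ continuous g t0 /\
     forall t, Rabs (t - t0) < d -> Rabs (f t - g t) <= eps) -> continuous f t0.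
Proof.
intros H. apply continuity_pt_filterlim. intros eps Heps.
destruct (H (eps / 4) ltac:(lra)) as [g [d [Hd [Hg Hfg]]]].
apply continuity_pt_filterlim in Hg.
destruct (Hg (eps / 4) ltac:(lra)) as [d2 [Hd2 Hg2]].
exists (Rmin d d2). split; [now apply Rmin_pos|].
intros x [_ Hx]. change (Rabs (x - t0) < Rmin d d2) in Hx. change (Rabs (f x - f t0) < eps).
assert (Rmin d d2 <= d) by apply Rmin_l. assert (Rmin d d2 <= d2) by apply Rmin_r.
destruct (Req_dec t0 x) as [->|Hne].
- rewrite Rminus_eq_0, Rabs_R0. lra.
- assert (A : Rabs (f x - g x) <= eps / 4) by (apply Hfg; lra).
  assert (B : Rabs (f t0 - g t0) <= eps / 4) by (apply Hfg; rewrite Rminus_eq_0, Rabs_R0; lra).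
  assert (C : Rabs (g x - g t0) < eps / 4).
  { apply Hg2. split; [split; [exact I | auto]|]. change (Rabs (x - t0) < d2). lra. }
  apply Rabs_le_between in A. apply Rabs_le_between in B. apply Rabs_lt_between in C.
  apply Rabs_lt_between. lra.
Qed.

Lemma exists_large_nat (Q : R) : exists X0 : nat, (1 <= X0)%nat /\ Q <= INR X0 /\
  forall X, (X0 <= X)%nat -> Q * Rpower (INR X) (- / 2) <= 1.
Proof.
set (P := Rmax Q 1).
assert (HP : 1 <= P) by apply Rmax_r. assert (HQ : Q <= P) by apply Rmax_l.
destruct (nat_ceil (P * P) ltac:(nra)) as [X0 [H1 H2]].
exists X0. split; [|split].
- apply INR_le. simpl. nra.
- nra.
- intros X HX. apply le_INR in HX.
  assert (Rpower (INR X) (- / 2) <= Rpower (P * P) (- / 2)) by (apply Rpower_decr; nra).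
  assert (E : Rpower (P * P) (- / 2) = / P).
  { rewrite Rpower_Ropp, Rpower_sqrt by nra. now rewrite sqrt_square by lra. }
  rewrite E in H.
  assert (0 < Rpower (INR X) (- / 2)) by apply Rpower_pos.
  apply Rle_trans with (P * / P); [|right; field; lra].
  apply Rle_trans with (P * Rpower (INR X) (- / 2)); [apply Rmult_le_compat_r; lra|].
  apply Rmult_le_compat_l; lra.
Qed.

Lemma Cmod_half_line t : Cmod ((/ 2)%R, t) <= 1 + Rabs t.
Proof.
eapply Rle_trans; [apply Cmod_le_abs|]. simpl. rewrite Rabs_pos_eq; lra.
Qed.

Lemma zeta_half_ccont (c t0 : R) : 0 < c -> 0 < t0 -> ccont (fun t => zeta (/ 2, - (c * t))) t0.
Proof.
intros Hc Ht0.
assert (key : forall p : C -> R, (forall z, Rabs (p z) <= Cmod z) -> (forall z w, p (z - w)%C = p z - p w) ->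
  (forall f : R -> C, ccont f t0 -> continuous (fun t => p (f t)) t0) ->
  continuous (fun t => p (zeta (/ 2, - (c * t)))) t0).
{ intros p Hp1 Hp2 Hp3. apply continuous_uniform_approx. intros eps Heps.
  destruct (exists_large_nat (2 * (1 + c * (t0 + 1)) / eps)) as [X0 [H1 [_ H2]]].
  exists (fun t => p (Zeta_ps X0 (aff c (/ 2 - c / 2) (/ 2) t))), 1. split; [lra|]. split.
  - apply Hp3. apply (has_antiholo_ccont (fun u v => Zeta_ps X0 (aff c (/ 2 - c / 2) u v))); auto.
    now apply has_antiholo_Zeta_ps.
  - intros t Ht. rewrite <- Hp2. eapply Rle_trans; [apply Hp1|].
    unfold aff. replace (c * / 2 + (/ 2 - c / 2)) with (/ 2) by field.
    eapply Rle_trans; [apply zeta_approx_half; auto|].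
    specialize (H2 X0 (le_n _)).
    assert (A := Cmod_half_line (- (c * t))).
    rewrite Rabs_Ropp, Rabs_mult, (Rabs_pos_eq c) in A by lra.
    assert (B : Rabs t <= t0 + 1).
    { apply Rabs_lt_between in Ht. apply Rabs_le. lra. }
    assert (P := Rpower_pos (INR X0) (- / 2)). 
    assert (2 * Cmod ((/ 2)%R, - (c * t)) <= 2 * (1 + c * (t0 + 1))) by nra.
    apply Rle_trans with (2 * (1 + c * (t0 + 1)) * Rpower (INR X0) (- / 2)); [apply Rmult_le_compat_r; lra|].
    replace (2 * (1 + c * (t0 + 1)) * Rpower (INR X0) (- / 2)) with
     (eps * (2 * (1 + c * (t0 + 1)) / eps * Rpower (INR X0) (- / 2))) by (field; lra).
    nra. }
split; [apply (key fst) | apply (key snd)]; auto using Rabs_fst_Cmod, Rabs_snd_Cmod.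
- intros f [H _]; exact H.
- intros f [_ H]; exact H.
Qed.

(** Truncation at [X = 1], where [Zeta_ps 1 s = 1 - 1/(1-s)]. A linear bound is enough, since it is
    only ever multiplied by [X^(-1/2)] with [X] free to be large. *)
Lemma zeta_half_crude (tau : R) : 0 <= tau -> Cmod (zeta (/ 2, - tau)) <= 5 + 2 * tau.
Proof.
intros Ht.
assert (A := zeta_approx_half (- tau) 1 (le_n _)).
assert (B := Cmod_half_line (- tau)). rewrite Rabs_Ropp, Rabs_pos_eq in B by auto.
assert (E : Rpower (INR 1) (- / 2) = 1) by (unfold Rpower; simpl; rewrite ln_1, Rmult_0_r; apply exp_0).
rewrite E in A.
assert (D : Cmod (Zeta_ps 1 ((/ 2)%R, - tau)) <= 3).
{ unfold Zeta_ps. cbn [csum].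
  rewrite npow_cpow. simpl (INR 1). rewrite !cpow_1l.
  replace (0 + 1 - 1 / (1 - ((/ 2)%R, (- tau)%R)))%C with (1 + - (1 / (1 - ((/ 2)%R, (- tau)%R))))%C by ring.
  eapply Rle_trans; [apply Cmod_triangle|]. rewrite Cmod_opp, Cmod_1.
  assert (H : / 2 <= Cmod (1 - ((/ 2)%R, (- tau)%R))%C).
  { eapply Rle_trans; [|apply Rabs_fst_Cmod]. simpl. rewrite Rabs_pos_eq; lra. }
  rewrite Cmod_div.
  - rewrite Cmod_1. assert (1 / Cmod (1 - ((/ 2)%R, (- tau)%R))%C <= 2); [|lra].
    apply Rle_div_l; lra.
  - intros E2. rewrite E2, Cmod_0 in H. lra. }
replace (zeta (/ 2, - tau)) with ((zeta ((/ 2)%R, (- tau)%R) - Zeta_ps 1 ((/ 2)%R, (- tau)%R)) + Zeta_ps 1 ((/ 2)%R, (- tau)%R))%C by ring.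
eapply Rle_trans; [apply Cmod_triangle|]. lra.
Qed.

(** Turns the cutoff of the Dirichlet polynomial, an integer part of a power of [t], into a
    condition on [t], so that sum and integral can be interchanged. *)
Lemma Dlen_spec theta t n : 0 < theta -> 0 < t -> (1 <= n)%nat ->
  (n <= Dlen theta t)%nat <-> Tstart theta n <= t.
Proof.
intros Hth Ht Hn. assert (HPI := PI2_3_2).
assert (Hn0 : 0 < INR n) by (apply lt_0_INR; lia).
unfold Dlen. destruct (Rlt_dec 0 t) as [_|]; [|contradiction].
set (x := Rpower (t / (2 * PI)) theta).
assert (H2 : 0 < t / (2 * PI)) by (apply Rdiv_lt_0_compat; lra).
assert (E1 : (n <= Z.to_nat (Int_part x))%nat <-> INR n <= x).
{ destruct (base_Int_part x) as [B1 B2]. split; intros H.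
  - 
    apply Rle_trans with (IZR (Int_part x)); auto. rewrite INR_IZR_INZ. apply IZR_le. lia.
  - assert (IZR (Z.of_nat n) < IZR (Int_part x + 1)) by (rewrite <- INR_IZR_INZ, plus_IZR; lra).
    apply lt_IZR in H0. lia. }
rewrite E1. unfold Tstart.
assert (Hi : 0 < / theta) by now apply Rinv_0_lt_compat.
assert (E2 : Rpower x (/ theta) = t / (2 * PI)).
{ unfold x. rewrite Rpower_mult, Rinv_r, Rpower_1; lra. }
split; intros H.
- assert (Rpower (INR n) (/ theta) <= t / (2 * PI)).
  { rewrite <- E2. apply Rle_Rpower_l; lra. }
  apply (Rmult_le_compat_l (2 * PI)) in H0; [|lra].
  replace (2 * PI * (t / (2 * PI))) with t in H0 by (field; lra). auto.
- assert (Rpower (INR n) (/ theta) <= t / (2 * PI)).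
  { apply (Rmult_le_reg_l (2 * PI)); [lra|].
    replace (2 * PI * (t / (2 * PI))) with t by (field; lra). auto. }
  replace (INR n) with (Rpower (Rpower (INR n) (/ theta)) theta).
  + unfold x. apply Rle_Rpower_l; [lra|]. split; auto. apply Rpower_pos.
  + rewrite Rpower_mult, Rinv_l, Rpower_1; lra.
Qed.

Lemma Dlen_le_of_le theta t T : 0 < theta -> 0 < t <= T -> (Dlen theta t <= Dlen theta T)%nat.
Proof.
intros Hth Ht. destruct (Nat.eq_dec (Dlen theta t) 0) as [E|E]; [lia|].
apply (Dlen_spec theta T); [auto | lra | lia |].
apply Rle_trans with t; [|lra]. apply Dlen_spec; auto; try lra; lia.
Qed.

Lemma csum_trunc (f g : nat -> C) M N : (M <= N)%nat ->
  (forall n, (1 <= n <= M)%nat -> g n = f n) -> (forall n, (M < n <= N)%nat -> g n = RtoC 0) ->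
  csum g N = csum f M.
Proof.
induction 1 as [|N H IH]; intros H1 H2; [now apply csum_ext|].
cbn [csum]. rewrite IH, H2; [ring | lia | auto | intros; apply H2; lia].
Qed.

Lemma Tstart_pos theta n : 0 < Tstart theta n.
Proof. unfold Tstart. assert (HPI := PI2_3_2). assert (H := Rpower_pos (INR n) (/ theta)). nra. Qed.

Local Notation hl t := (@pair R R (/ 2)%R t%R).

Section Reduction.
Variables (theta T : R) (b : nat).
Hypothesis Hth : 0 < theta <= / 2.
Hypothesis HT : 8 <= T.
Hypothesis Hb : (1 <= b)%nat.
Let N := Dlen theta T.

Definition zeta_term (n : nat) (t : R) : C :=
  (npow n (hl t) * zeta (hl (- (INR b * t))) * zeta (hl (- t)))%C.

Lemma npow_ccont n t : ccont (fun t => npow n (hl t)) t.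
Proof.
unfold npow; split; cbn [fst snd]; apply (ex_derive_continuous (K := R_AbsRing) (V := R_NormedModule)); auto_derive; auto.
Qed.

Lemma zeta_term_ccont n t : 0 < t -> ccont (zeta_term n) t.
Proof.
intros Ht. assert (0 < INR b) by (apply lt_0_INR; lia).
apply ccont_mult; [apply ccont_mult|].
- apply npow_ccont.
- now apply zeta_half_ccont.
- replace (fun t => zeta (hl (- t))) with (fun t => zeta (hl (- (1 * t)))).
  + apply zeta_half_ccont; lra.
  + apply functional_extensionality. intros; do 2 f_equal. ring.
Qed.

(** Each term is extended by zero before its entrance time, which makes the number of terms
    independent of [t]. Below [T_1 = 2 pi] the polynomial is empty, so nothing has to be known about
    zeta near [t = 0]. *)
Lemma M1b1_sum : M1b1 theta (INR b) T = csum (fun n => cint (zeta_term n) (Tstart theta n) T) N.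
Proof.
assert (HTn : forall n, (1 <= n <= N)%nat -> Tstart theta n <= T).
{ intros n Hn. apply Dlen_spec; try lra; try lia; apply Hn. }
assert (H : is_cint (fun t => Dtheta theta (hl t) * zeta (hl (- (INR b * t))) * zeta (hl (- t)))%C 0 T
   (csum (fun n => cint (zeta_term n) (Tstart theta n) T) N)).
{ apply (is_cint_ext (fun t => csum (fun n => if Rle_dec (Tstart theta n) t then zeta_term n t else RtoC 0) N)); [lra| |].
  - intros t Ht.
    rewrite (csum_trunc (fun n => zeta_term n t) _ (Dlen theta t) N).
    + unfold Dtheta, zeta_term. cbn [snd].
      rewrite (csum_ext _ (fun n => (zeta (hl (- (INR b * t))) * zeta (hl (- t))) * npow n (hl t))%C).
      * rewrite csum_scal. ring.
      * intros; ring.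
    + apply Dlen_le_of_le; lra.
    + intros n Hn. destruct (Rle_dec (Tstart theta n) t) as [_|Hf]; auto.
      exfalso. apply Hf. apply Dlen_spec; try lra; lia.
    + intros n Hn. destruct (Rle_dec (Tstart theta n) t) as [Hf|_]; auto.
      apply Dlen_spec in Hf; try lra; lia.
  - apply (is_cint_csum (fun n t => if Rle_dec (Tstart theta n) t then zeta_term n t else RtoC 0)).
    intros n Hn. specialize (HTn n Hn). assert (Hp := Tstart_pos theta n).
    replace (cint (zeta_term n) (Tstart theta n) T) with (0 + cint (zeta_term n) (Tstart theta n) T)%C by ring.
    apply is_cint_Chasles with (Tstart theta n).
    + apply (is_cint_ext (fun _ => RtoC 0)); [lra| |apply is_cint_0].
      intros t Ht. destruct (Rle_dec (Tstart theta n) t); [lra | auto].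
    + apply (is_cint_ext (zeta_term n)); [lra| |].
      * intros t Ht. destruct (Rle_dec (Tstart theta n) t); [auto | lra].
      * apply is_cint_cint; [lra|]. intros t Ht. apply zeta_term_ccont. lra. }
unfold M1b1. apply (is_RInt_unique (V := C_R_CompleteNormedModule)). destruct H as [H1 H2].
rewrite (surjective_pairing (csum _ N)).
exact (is_RInt_fct_extend_pair (U := R_NormedModule) (V := R_NormedModule) _ 0 T _ _ H1 H2).
Qed.

(** [z1 z2 - w1 w2 = z1 (z2 - w2) + (z1 - w1) w2]: the factors are at most [K] and [2 K] with [K]
    linear in [T], and the differences at most [K X^(-1/2)], so the cost tends to 0 as [X] grows
    with [T] fixed. *)
Lemma zeta_term_shift n X : (1 <= n <= N)%nat -> (1 <= X)%nat ->
  Cmod (cint (zeta_term n) (Tstart theta n) T - RtoC (Rpower (INR n) (- / 2)) * cint (shift_integrand b X n (/ 2)) (Tstart theta n) T)%C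
  <= 2 * (3 * (5 + 2 * (INR b * T)) ^ 2 * Rpower (INR X) (- / 2)) * T.
Proof.
intros Hn HX.
assert (Hb1 : 1 <= INR b) by (apply (le_INR 1); lia).
assert (HTn : Tstart theta n <= T) by (apply Dlen_spec; try lra; try lia; apply Hn).
assert (Hp := Tstart_pos theta n).
set (K := 5 + 2 * (INR b * T)). assert (HK : 5 <= K) by (unfold K; nra).
set (r := Rpower (INR X) (- / 2)). assert (Hr : 0 < r) by apply Rpower_pos.
assert (Hr1 : r <= 1) by (apply Rpower_le_1; [apply (le_INR 1); lia | lra]).
assert (H1 : is_cint (zeta_term n) (Tstart theta n) T (cint (zeta_term n) (Tstart theta n) T)).
{ apply is_cint_cint; auto. intros t Ht. apply zeta_term_ccont. lra. }
assert (H2 : is_cint (shift_integrand b X n (/ 2)) (Tstart theta n) T (cint (shift_integrand b X n (/ 2)) (Tstart theta n) T)).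
{ apply is_cint_cint; [lra|]. intros t Ht2. apply has_antiholo_ccont; [apply shift_integrand_antiholo; lia | lra]. }
assert (H3 := is_cint_minus _ _ _ _ _ _ H1 (is_cint_scal (RtoC (Rpower (INR n) (- / 2))) _ _ _ _ H2)).
apply Rle_trans with (2 * (3 * K ^ 2 * r) * (T - Tstart theta n)).
2:{ apply Rmult_le_compat_l; [|lra]. nra. }
apply (is_cint_bound _ _ _ _ _ HTn H3). intros t Ht.
assert (En : npow n (hl t) = (RtoC (Rpower (INR n) (- / 2)) * cpow (INR n) (- aff 1 (- / 2) (/ 2) t))%C).
{ rewrite npow_cpow, <- cpow_RtoC, <- cpow_plus. f_equal. unfold aff, Cplus, Copp, RtoC; simpl. f_equal; field. }
unfold zeta_term, shift_integrand. rewrite En.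
set (z1 := zeta (hl (- (INR b * t)))). set (z2 := zeta (hl (- t))).
replace (aff (INR b) (/ 2 - INR b / 2) (/ 2) t) with ((hl (- (INR b * t))) : C) by (unfold aff; f_equal; field).
replace (aff 1 0 (/ 2) t) with ((hl (- t)) : C) by (unfold aff; f_equal; field).
set (w1 := Zeta_ps X (hl (- (INR b * t)))). set (w2 := Zeta_ps X (hl (- t))).
set (q := RtoC (Rpower (INR n) (- / 2))). set (u := cpow (INR n) _).
replace (q * u * z1 * z2 - q * (u * (w1 * w2)))%C with (q * u * (z1 * (z2 - w2) + (z1 - w1) * w2))%C by ring.
assert (Hqu : Cmod (q * u)%C <= 1).
{ unfold q, u. rewrite <- En. rewrite npow_cpow, Cmod_cpow. simpl fst. 
  apply Rpower_le_1; [apply (le_INR 1); lia | lra]. }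
assert (T2 : t <= INR b * T) by nra. assert (T3 : INR b * t <= INR b * T) by (apply Rmult_le_compat_l; lra).
assert (Z1 : Cmod z1 <= K) by (eapply Rle_trans; [apply zeta_half_crude; nra | unfold K; lra]).
assert (Z2 : Cmod z2 <= K) by (eapply Rle_trans; [apply zeta_half_crude; nra | unfold K; lra]).
assert (AP : forall tau, 0 <= tau <= INR b * T -> 
  Cmod (zeta (hl (- tau)) - Zeta_ps X (hl (- tau)))%C <= K * r).
{ intros tau Htau. eapply Rle_trans; [apply zeta_approx_half; auto|].
  assert (B := Cmod_half_line (- tau)). rewrite Rabs_Ropp, Rabs_pos_eq in B by lra.
  apply Rmult_le_compat_r; [lra|]. unfold K. lra. }
assert (A1 : Cmod (z1 - w1)%C <= K * r) by (apply AP; nra).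
assert (A2 : Cmod (z2 - w2)%C <= K * r) by (apply AP; lra).
assert (W2 : Cmod w2 <= 2 * K).
{ replace w2 with (z2 + - (z2 - w2))%C by ring. eapply Rle_trans; [apply Cmod_triangle|]. rewrite Cmod_opp. nra. }
rewrite Cmod_mult.
assert (S1 : Cmod (z1 * (z2 - w2) + (z1 - w1) * w2)%C <= 3 * K ^ 2 * r).
{ eapply Rle_trans; [apply Cmod_triangle|]. rewrite !Cmod_mult.
  assert (Cmod z1 * Cmod (z2 - w2)%C <= K * (K * r)) by (apply Rmult_le_compat; auto using Cmod_ge_0).
  assert (Cmod (z1 - w1)%C * Cmod w2 <= (K * r) * (2 * K)) by (apply Rmult_le_compat; auto using Cmod_ge_0).
  simpl. lra. }
assert (G2 := Cmod_ge_0 (z1 * (z2 - w2) + (z1 - w1) * w2)%C). nra.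
Qed.

Lemma M1b1_reduce : 
  exists X, (1 <= X)%nat /\ (N <= X)%nat /\ 
  Cmod (M1b1 theta (INR b) T - 
    RtoC (rsum (fun n => rsum (fun k => rsum (fun m => (diag_weight b n k m * (T - Tstart theta n))%R) X) X) N))%C
  <= 2 + 2 * Rpower (INR N) (/ 2) * (80000 * INR b * (1 + ln (INR b)) * (sqrt T * (ln T) ^ 2))
     + 36 * (Rpower (INR N) (3 / 2) * (3 + 2 * ln (INR N))).
Proof.
(* [X1] makes the replacement of zeta by truncations cost at most 1, [X2] does the same for the
   truncation error on the right line, and [X3] meets the length required by the convexity bound.
   The two costs form the leading 2 of the bound. *)
destruct (exists_large_nat (INR N * (2 * (3 * (5 + 2 * (INR b * T)) ^ 2) * T))) as [X1 [H1 [_ H1']]].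
destruct (exists_large_nat (INR N * (14 * INR N * T))) as [X2 [H2 [_ H2']]].
destruct (exists_large_nat (INR b * T * sqrt (INR b * T))) as [X3 [H3 [H3' _]]].
set (X := (X1 + X2 + X3 + N)%nat).
exists X. split; [lia|]. split; [lia|].
(* The first term is present because [T >= 8 >= 2 pi = T_1]. *)
assert (E0 : (1 <= N)%nat).
{ apply Dlen_spec; try lra; try lia. unfold Tstart, Rpower. simpl. rewrite ln_1, Rmult_0_r, exp_0.
  assert (H := PI_4). lra. }
assert (B2 := shifted_total theta T b X N Hb ltac:(lia) ltac:(lia) Hth ltac:(lra)).
assert (B3 := B2 ltac:(intros n Hn; apply Dlen_spec; try lra; try lia; apply Hn)).
assert (HX3 : INR b * T * sqrt (INR b * T) <= INR X).
{ eapply Rle_trans; [exact H3'|]. apply le_INR. lia. }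
specialize (B3 HX3).
specialize (H1' X ltac:(lia)). specialize (H2' X ltac:(lia)).
assert (B1 : Cmod (M1b1 theta (INR b) T - 
  csum (fun n => RtoC (Rpower (INR n) (- / 2)) * cint (shift_integrand b X n (/ 2)) (Tstart theta n) T)%C N)%C <= 1).
{ rewrite M1b1_sum, <- csum_minus. eapply Rle_trans; [apply Cmod_csum|].
  eapply Rle_trans; [apply rsum_le; intros n Hn; apply zeta_term_shift; auto; lia|].
  rewrite rsum_const. eapply Rle_trans; [|exact H1']. right. ring. }
match goal with |- Cmod (?a - ?c)%C <= _ => replace (a - c)%C with
  ((a - csum (fun n => RtoC (Rpower (INR n) (- / 2)) * cint (shift_integrand b X n (/ 2)) (Tstart theta n) T) N) +
   (csum (fun n => RtoC (Rpower (INR n) (- / 2)) * cint (shift_integrand b X n (/ 2)) (Tstart theta n) T) N - c))%C by ring end.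
eapply Rle_trans; [apply Cmod_triangle|]. 
replace (INR N * (14 * INR N * T * Rpower (INR X) (- / 2))) with
  (INR N * (14 * INR N * T) * Rpower (INR X) (- / 2)) in B3 by ring.
lra.
Qed.
End Reduction.

(** * Partial sums with real cutoff *)

(** The condition [m <= u] is an indicator inside a sum of common length [X], so that double sums
    with varying cutoffs can be compared pointwise. *)
Definition fsum (f : nat -> R) (u : R) (X : nat) : R :=
  rsum (fun m => if Rle_dec (INR m) u then f m else 0) X.

Lemma fsum_floor (h : nat -> R) u n X : INR n <= u < INR n + 1 -> u <= INR X -> fsum h u X = rsum h n.
Proof.
intros Hn HX. unfold fsum. apply rsum_trunc.
- apply INR_le. lra.
- intros m Hm. destruct (Rle_dec (INR m) u) as [|H]; auto. exfalso. apply H.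
  assert (INR m <= INR n) by (apply le_INR; lia). lra.
- intros m Hm. destruct (Rle_dec (INR m) u) as [H|]; auto.
  assert (INR (S n) <= INR m) by (apply le_INR; lia). rewrite S_INR in *. lra.
Qed.

Section EMReal.
Variables (f f' Phi psi psi' : R -> R).
Hypothesis HPhi : forall x, 1 <= x -> is_derive Phi x (f x).
Hypothesis Hf : forall x, 1 <= x -> is_derive f x (f' x).
Hypothesis Hpsi : forall x, 1 <= x -> is_derive psi x (psi' x).
Hypothesis Hle : forall x, 1 <= x -> Rabs (f' x) <= - psi' x.

Lemma EM_real_sum M N : (1 <= M <= N)%nat ->
  Rabs ((rsum (fun n => f (INR n)) N - Phi (INR N)) - (rsum (fun n => f (INR n)) M - Phi (INR M)))
  <= psi (INR M) - psi (INR N).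
Proof.
intros H.
assert (K := EM_sum (fun x => RtoC (f x)) (fun x => RtoC (f' x)) (fun x => RtoC (Phi x)) psi psi'
  (fun x Hx => is_dC_RtoC _ _ _ (HPhi x Hx)) (fun x Hx => is_dC_RtoC _ _ _ (Hf x Hx)) Hpsi).
rewrite <- Cmod_R, !RtoC_minus, <- !csum_RtoC. apply K; auto.
intros x Hx. rewrite Cmod_R. now apply Hle.
Qed.

Hypothesis Hpsi0 : forall x, 1 <= x -> 0 <= psi x.

Lemma EM_real_lim : is_lim_seq (fun n => psi (INR n)) 0 ->
  exists L, forall N, (1 <= N)%nat ->
    Rabs (rsum (fun n => f (INR n)) N - Phi (INR N) - L) <= psi (INR N).
Proof.
intros Hlim.
destruct (Clim_exists (fun N => RtoC (rsum (fun n => f (INR n)) N - Phi (INR N))) (fun N => psi (INR N))) as [l Hl]; auto.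
- intros M N H. rewrite <- RtoC_minus, Cmod_R. eapply Rle_trans; [apply EM_real_sum; auto|].
  assert (0 <= psi (INR N)) by (apply Hpsi0, (le_INR 1); lia). lra.
- exists (fst l). intros N HN. rewrite Rabs_minus_sym.
  eapply Rle_trans; [|apply (Hl N HN)]. eapply Rle_trans; [|apply Rabs_fst_Cmod].
  right. reflexivity.
Qed.

(** Between the integer part [n] and [u] the sum is constant, while [Phi] moves by at most the
    largest [|f|] on [[n, u]]; that is at most [|f u|] plus the variation [psi n]. *)
Lemma EM_real_floor L u n X : (1 <= n)%nat -> INR n <= u < INR n + 1 -> u <= INR X ->
  Rabs (rsum (fun n => f (INR n)) n - Phi (INR n) - L) <= psi (INR n) ->
  Rabs (fsum (fun n => f (INR n)) u X - Phi u - L) <= 2 * psi (INR n) + Rabs (f u).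
Proof.
intros Hn1 Hn HX HL. rewrite (fsum_floor _ u n X Hn HX).
assert (H1 : 1 <= INR n) by (apply (le_INR 1); lia).
assert (B : Rabs (Phi u - Phi (INR n)) <= psi (INR n) + Rabs (f u)).
{ apply Rle_trans with ((psi (INR n) + Rabs (f u)) * u - (psi (INR n) + Rabs (f u)) * INR n).
  - apply (Rabs_incr_le Phi f (fun x => (psi (INR n) + Rabs (f u)) * x) (fun _ => psi (INR n) + Rabs (f u))); try lra.
    + intros; apply HPhi; lra.
    + intros. auto_derive; auto; ring.
    + intros x Hx.
      assert (V1 : Rabs (f u - f x) <= - psi u - - psi x).
      { apply (Rabs_incr_le f f' (fun x => - psi x) (fun x => - psi' x)); try lra.
        - intros; apply Hf; lra.
        - intros; apply derR_opp, Hpsi; lra.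
        - intros; apply Hle; lra. }
      assert (V2 : Rabs (f x - f (INR n)) <= - psi x - - psi (INR n)).
      { apply (Rabs_incr_le f f' (fun x => - psi x) (fun x => - psi' x)); try lra.
        - intros; apply Hf; lra.
        - intros; apply derR_opp, Hpsi; lra.
        - intros; apply Hle; lra. }
      assert (V3 := Rabs_pos (f x - f (INR n))).
      assert (V4 := Hpsi0 u ltac:(lra)).
      replace (f x) with (f u + - (f u - f x)) by ring.
      eapply Rle_trans; [apply Rabs_triang|]. rewrite Rabs_Ropp. lra.
  - assert (0 <= psi (INR n) + Rabs (f u)).
    { assert (X1 := Hpsi0 _ H1). assert (X2 := Rabs_pos (f u)). lra. }
    nra. }
replace (rsum (fun n => f (INR n)) n - Phi u - L) with
  ((rsum (fun n => f (INR n)) n - Phi (INR n) - L) + - (Phi u - Phi (INR n))) by ring.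
eapply Rle_trans; [apply Rabs_triang|]. rewrite Rabs_Ropp. lra.
Qed.
End EMReal.

(** * Asymptotics of the basic sums *)

Lemma floor_ge1 u : 1 <= u -> exists n : nat, (1 <= n)%nat /\ INR n <= u < INR n + 1 /\ u / 2 <= INR n.
Proof.
intros Hu. destruct (nat_floor u ltac:(lra)) as [n Hn]. exists n.
assert (H1 : (1 <= n)%nat) by (destruct n; [simpl in Hn; lra | lia]).
apply (le_INR 1) in H1 as H2. simpl in H2. repeat split; auto; lra.
Qed.

Lemma euler_gamma_spec N : (1 <= N)%nat ->
  Rabs (rsum (fun n => / INR n) N - ln (INR N) - euler_gamma) <= / INR N.
Proof.
assert (D1 : forall x, 1 <= x -> is_derive ln x (/ x)) by (intros; auto_derive; lra).
assert (D2 : forall x, 1 <= x -> is_derive Rinv x (- / (x * x))) by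
  (intros; auto_derive; [lra | field; lra]).
assert (D3 : forall x, 1 <= x -> Rabs (- / (x * x)) <= - - / (x * x)).
{ intros x Hx. assert (0 < / (x * x)) by (apply Rinv_0_lt_compat; nra). rewrite Rabs_Ropp, Rabs_pos_eq; lra. }
assert (D4 : forall x, 1 <= x -> 0 <= / x) by (intros; left; apply Rinv_0_lt_compat; lra).
assert (Hlim : is_lim_seq (fun n => / INR n) 0).
{ apply (is_lim_seq_inv INR p_infty); [apply is_lim_seq_INR | discriminate]. }
destruct (EM_real_lim Rinv (fun x => - / (x * x)) ln Rinv (fun x => - / (x * x)) D1 D2 D2 D3 D4 Hlim) as [L HL].
replace euler_gamma with L; [intros; now apply HL|].
unfold euler_gamma. symmetry.
assert (E : is_lim_seq (fun n => sum_f_R0 (fun k => / INR (S k)) n - ln (INR (S n))) L).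
{ apply (is_lim_seq_ext (fun n => rsum (fun n => / INR n) (S n) - ln (INR (S n)))).
  - intros n. f_equal. induction n; [simpl; ring|]. 
    change (rsum (fun n0 => / INR n0) (S (S n))) with (rsum (fun n0 => / INR n0) (S n) + / INR (S (S n))).
    rewrite IHn. reflexivity.
  - apply (is_lim_seq_incr_1 (fun n => rsum (fun n => / INR n) n - ln (INR n))).
    apply is_lim_seq_spec. intros eps. apply is_lim_seq_spec in Hlim.
    destruct (Hlim eps) as [N0 HN0]. exists (S N0). intros n Hn.
    eapply Rle_lt_trans; [apply HL; lia|]. assert (X := HN0 n ltac:(lia)).
    rewrite Rminus_0_r in X. eapply Rle_lt_trans; [apply Rle_abs | exact X]. }
now rewrite (is_lim_seq_unique _ _ E).
Qed.

Lemma fsum_harmonic u X : 1 <= u <= INR X ->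
  Rabs (fsum (fun n => / INR n) u X - (ln u + euler_gamma)) <= 5 / u.
Proof.
intros Hu. destruct (floor_ge1 u ltac:(lra)) as [n [Hn1 [Hn Hn2]]].
assert (D1 : forall x, 1 <= x -> is_derive ln x (/ x)) by (intros; auto_derive; lra).
assert (D2 : forall x, 1 <= x -> is_derive Rinv x (- / (x * x))) by
  (intros; auto_derive; [lra | field; lra]).
assert (D3 : forall x, 1 <= x -> Rabs (- / (x * x)) <= - - / (x * x)).
{ intros x Hx. assert (0 < / (x * x)) by (apply Rinv_0_lt_compat; nra). rewrite Rabs_Ropp, Rabs_pos_eq; lra. }
assert (D4 : forall x, 1 <= x -> 0 <= / x) by (intros; left; apply Rinv_0_lt_compat; lra).
assert (K := EM_real_floor Rinv (fun x => - / (x * x)) ln Rinv (fun x => - / (x * x)) D1 D2 D2 D3 D4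
  euler_gamma u n X Hn1 Hn ltac:(lra) (euler_gamma_spec n Hn1)).
replace (fsum (fun n => / INR n) u X - (ln u + euler_gamma)) with
 (fsum (fun n => / INR n) u X - ln u - euler_gamma) by ring.
eapply Rle_trans; [exact K|].
assert (/ INR n <= / (u / 2)) by (apply Rinv_le_contravar; lra).
rewrite Rabs_pos_eq by (apply D4; lra).
replace (/ (u / 2)) with (2 * / u) in H by (field; lra). lra.
Qed.

Lemma Rpower_floor_bound a u n : 0 <= a -> 1 <= u -> u / 2 <= INR n -> 
  Rpower (INR n) (- a) <= Rpower 2 a * Rpower u (- a).
Proof.
intros Ha Hu Hn. apply Rle_trans with (Rpower (u / 2) (- a)); [apply Rpower_decr; lra|].
unfold Rdiv. rewrite <- Rpower_mult_distr by lra. rewrite Rmult_comm. right. f_equal.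
unfold Rpower. f_equal. rewrite ln_Rinv by lra. ring.
Qed.

Lemma fsum_power be u X : 0 < be -> be <> 1 -> 1 <= u <= INR X ->
  Rabs (fsum (fun n => Rpower (INR n) (- be)) u X - (Rpower u (1 - be) / (1 - be) + zetaR be))
  <= (2 * Rpower 2 be + 1) * Rpower u (- be).
Proof.
intros Hb Hb1 Hu. destruct (floor_ge1 u ltac:(lra)) as [n [Hn1 [Hn Hn2]]].
assert (HL : Rabs (rsum (fun n => Rpower (INR n) (- be)) n - Rpower (INR n) (1 - be) / (1 - be) - zetaR be)
  <= Rpower (INR n) (- be)).
{ assert (Z := zetaR_approx be n Hb Hb1 Hn1). rewrite Rabs_minus_sym in Z.
  eapply Rle_trans; [|exact Z]. right. f_equal. }
assert (K := EM_real_floor (fun x => Rpower x (- be)) (fun x => - be * Rpower x (- be - 1))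
  (fun x => Rpower x (1 - be) / (1 - be)) (fun x => Rpower x (- be)) (fun x => - be * Rpower x (- be - 1))).
replace (fsum (fun n => Rpower (INR n) (- be)) u X - (Rpower u (1 - be) / (1 - be) + zetaR be)) with
 (fsum (fun n => Rpower (INR n) (- be)) u X - Rpower u (1 - be) / (1 - be) - zetaR be) by ring.
eapply Rle_trans; [apply (K) with (L := zetaR be) (n := n); auto; try lra|].
- intros x Hx. apply (is_derive_ext (fun x => / (1 - be) * Rpower x (1 - be))); [intros; unfold Rdiv; apply Rmult_comm|].
  replace (Rpower x (- be)) with (/ (1 - be) * ((1 - be) * Rpower x (1 - be - 1))).
  + apply derR_scal, is_derive_Rpower; lra.
  + replace (1 - be - 1) with (- be) by ring. field. lra.
- intros; apply is_derive_Rpower; lra.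
- intros; apply is_derive_Rpower; lra.
- intros x Hx. assert (P := Rpower_pos x (- be - 1)). rewrite Rabs_mult, Rabs_Ropp, !Rabs_pos_eq; lra.
- intros x Hx. left. apply Rpower_pos.
- cbv beta. rewrite Rabs_pos_eq by (left; apply Rpower_pos).
  assert (Q := Rpower_floor_bound be u n ltac:(lra) ltac:(lra) Hn2). lra.
Qed.

(** An antiderivative of [x^(-be) log x]. For [be > 1] it is the one vanishing at infinity, so that
    the Euler-Maclaurin constant becomes [- zeta'(be)]; for [be = 1] the constant will be
    [- gamma1]. *)
Definition lnpow_prim (be x : R) : R :=
  if Req_EM_T be 1 then (ln x) ^ 2 / 2
  else - (Rpower x (1 - be) * (ln x / (be - 1) + / (be - 1) ^ 2)).

Section LogPower.
Variable be : R.
Hypothesis Hbe : 1 <= be.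

Lemma lnpow_prim_derive x : 1 <= x -> is_derive (lnpow_prim be) x (Rpower x (- be) * ln x).
Proof.
intros Hx. unfold lnpow_prim. destruct (Req_EM_T be 1) as [E|E].
- rewrite E. rewrite Rpower_Ropp, Rpower_1 by lra. auto_derive; [lra|]. simpl. field. lra.
- unfold Rpower. auto_derive; [lra|].
  replace ((1 - be) * ln x) with (- be * ln x + ln x) by ring. rewrite exp_plus, exp_ln by lra.
  field. lra.
Qed.

Lemma lnpow_derive x : 1 <= x -> is_derive (fun x => Rpower x (- be) * ln x) x
  (Rpower x (- be - 1) * (1 - be * ln x)).
Proof.
intros Hx. unfold Rpower. auto_derive; [lra|].
replace ((- be - 1) * ln x) with (- be * ln x + - ln x) by ring. rewrite exp_plus, exp_Ropp, exp_ln by lra.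
field. lra.
Qed.

(** [2/be] is chosen so that minus the derivative is [x^(-be-1) (1 + be log x)]. This dominates the
    derivative of [x^(-be) log x], which changes sign, so that function cannot serve as its own
    majorant. *)
Lemma lnpow_psi_derive x : 1 <= x -> is_derive (fun x => Rpower x (- be) * (ln x + 2 / be)) x
  (- (Rpower x (- be - 1) * (1 + be * ln x))).
Proof.
intros Hx. unfold Rpower. auto_derive; [lra|].
replace ((- be - 1) * ln x) with (- be * ln x + - ln x) by ring. rewrite exp_plus, exp_Ropp, exp_ln by lra.
field. lra.
Qed.

Lemma ln_nonneg x : 1 <= x -> 0 <= ln x.
Proof. intros; rewrite <- ln_1; apply ln_le; lra. Qed.

Lemma lnpow_le x : 1 <= x -> Rabs (Rpower x (- be - 1) * (1 - be * ln x)) <= - - (Rpower x (- be - 1) * (1 + be * ln x)).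
Proof.
intros Hx. assert (P := Rpower_pos x (- be - 1)). assert (L := ln_nonneg x Hx).
rewrite Ropp_involutive, Rabs_mult, Rabs_pos_eq by lra.
apply Rmult_le_compat_l; [lra|]. apply Rabs_le. nra.
Qed.

Lemma lnpow_psi_nonneg x : 1 <= x -> 0 <= Rpower x (- be) * (ln x + 2 / be).
Proof.
intros Hx. assert (P := Rpower_pos x (- be)). assert (L := ln_nonneg x Hx).
assert (0 < 2 / be) by (apply Rdiv_lt_0_compat; lra). nra.
Qed.

Lemma ln_le_sqrt x : 1 <= x -> ln x <= 2 * Rpower x (/ 2).
Proof.
intros Hx. assert (P := Rpower_pos x (/ 2)).
assert (H := ln_le_lin (Rpower x (/ 2)) P).
rewrite ln_Rpower in H. lra.
Qed.

Lemma lnpow_psi_bound x : 1 <= x -> Rpower x (- be) * (ln x + 2 / be) <= 4 * Rpower x (- / 2).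
Proof.
intros Hx. assert (L := ln_nonneg x Hx).
apply Rle_trans with (Rpower x (- (1)) * (4 * Rpower x (/ 2))).
- apply Rmult_le_compat.
  + left; apply Rpower_pos.
  + assert (0 < 2 / be) by (apply Rdiv_lt_0_compat; lra). lra.
  + apply Rle_Rpower; lra.
  + assert (H := ln_le_sqrt x Hx). assert (2 / be <= 2) by (apply Rle_div_l; lra).
    assert (1 <= Rpower x (/ 2)).
    { rewrite <- (Rpower_O x) at 1 by lra. apply Rle_Rpower; lra. }
    lra.
- right. replace (- / 2) with (- (1) + / 2) by field. rewrite Rpower_plus. ring.
Qed.

Lemma lnpow_lim : exists L, forall N, (1 <= N)%nat ->
  Rabs (rsum (fun n => Rpower (INR n) (- be) * ln (INR n)) N - lnpow_prim be (INR N) - L)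
  <= Rpower (INR N) (- be) * (ln (INR N) + 2 / be).
Proof.
apply (EM_real_lim (fun x => Rpower x (- be) * ln x) _ (lnpow_prim be) (fun x => Rpower x (- be) * (ln x + 2 / be)) _
 lnpow_prim_derive lnpow_derive lnpow_psi_derive lnpow_le lnpow_psi_nonneg).
apply (is_lim_seq_le_le_loc (fun _ => 0) _ (fun n => 4 * Rpower (INR n) (- / 2))).
- exists 1%nat. intros n Hn. assert (H : 1 <= INR n) by (apply (le_INR 1); lia).
  split; [now apply lnpow_psi_nonneg | now apply lnpow_psi_bound].
- apply is_lim_seq_const.
- replace (Finite 0) with (Rbar_mult (Finite 4) (Finite 0)) by (simpl; f_equal; ring).
  apply is_lim_seq_scal_l, is_lim_seq_Rpower_neg. lra.
Qed.

Lemma fsum_lnpow L u X : 1 <= u <= INR X ->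
  (forall N, (1 <= N)%nat ->
   Rabs (rsum (fun n => Rpower (INR n) (- be) * ln (INR n)) N - lnpow_prim be (INR N) - L)
   <= Rpower (INR N) (- be) * (ln (INR N) + 2 / be)) ->
  Rabs (fsum (fun n => Rpower (INR n) (- be) * ln (INR n)) u X - (lnpow_prim be u + L))
  <= (4 * Rpower 2 be + 1) * (Rpower u (- be) * (1 + ln u)).
Proof.
intros Hu HL. destruct (floor_ge1 u ltac:(lra)) as [n [Hn1 [Hn Hn2]]].
assert (K := EM_real_floor (fun x => Rpower x (- be) * ln x) _ (lnpow_prim be) (fun x => Rpower x (- be) * (ln x + 2 / be)) _
 lnpow_prim_derive lnpow_derive lnpow_psi_derive lnpow_le lnpow_psi_nonneg L u n X Hn1 Hn ltac:(lra) (HL n Hn1)).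
replace (fsum (fun n => Rpower (INR n) (- be) * ln (INR n)) u X - (lnpow_prim be u + L)) with
 (fsum (fun n => Rpower (INR n) (- be) * ln (INR n)) u X - lnpow_prim be u - L) by ring.
eapply Rle_trans; [exact K|].
assert (Q := Rpower_floor_bound be u n ltac:(lra) ltac:(lra) Hn2).
assert (N1 : 1 <= INR n) by (apply (le_INR 1); lia).
assert (L1 := ln_nonneg _ N1). assert (L2 : ln (INR n) <= ln u) by (apply ln_le; lra).
assert (P := Rpower_pos u (- be)). assert (P3 := Rpower_pos (INR n) (- be)).
assert (B : 2 / be <= 2) by (apply Rle_div_l; lra). assert (B0 : 0 < 2 / be) by (apply Rdiv_lt_0_compat; lra).
rewrite Rabs_pos_eq by (apply Rmult_le_pos; lra).
assert (Rpower (INR n) (- be) * (ln (INR n) + 2 / be) <= (Rpower 2 be * Rpower u (- be)) * (2 * (1 + ln u))).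
{ apply Rmult_le_compat; try lra. }
nra.
Qed.
End LogPower.

(** * The constants zeta' and gamma_1 *)

Lemma is_lim_seq_of_bound (u : nat -> R) (L : R) (e : nat -> R) :
  (forall n, (1 <= n)%nat -> Rabs (u n - L) <= e n) -> is_lim_seq e 0 -> is_lim_seq u L.
Proof.
intros H He. apply is_lim_seq_spec. intros eps. apply is_lim_seq_spec in He.
destruct (He eps) as [N HN]. exists (S N). intros n Hn.
eapply Rle_lt_trans; [apply H; lia|]. assert (X := HN n ltac:(lia)). rewrite Rminus_0_r in X.
eapply Rle_lt_trans; [apply Rle_abs | exact X].
Qed.

Lemma is_derive_rsum (f : nat -> R -> R) (l : nat -> R) x N :
  (forall n, (1 <= n <= N)%nat -> is_derive (f n) x (l n)) ->
  is_derive (fun y => rsum (fun n => f n y) N) x (rsum l N).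
Proof.
induction N as [|N IH]; intros H; cbn [rsum]; [apply derR_const|].
apply derR_plus; [apply IH; intros; apply H; lia | apply H; lia].
Qed.

Lemma is_derive_Rpower_exp c x : is_derive (fun y => Rpower c (- y)) x (- (Rpower c (- x) * ln c)).
Proof. unfold Rpower. auto_derive; auto. ring. Qed.

(** The shift to [S n] is there because truncation bounds start at index 1. *)
Lemma CVU_of_bound (F : nat -> R -> R) (g : R -> R) (e : nat -> R) c d :
  (forall n y, Boule c d y -> (1 <= n)%nat -> Rabs (F n y - g y) <= e n) -> is_lim_seq e 0 ->
  CVU (fun n => F (S n)) g c d.
Proof.
intros H He eps Heps. apply is_lim_seq_spec in He. destruct (He (mkposreal eps Heps)) as [N HN].
exists N. intros n y Hn Hy. rewrite Rabs_minus_sym. eapply Rle_lt_trans; [apply H; auto; lia|].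
assert (X := HN (S n) ltac:(lia)). rewrite Rminus_0_r in X. simpl in X.
eapply Rle_lt_trans; [apply Rle_abs | exact X].
Qed.

Lemma is_lim_seq_scal0 c e : is_lim_seq e 0 -> is_lim_seq (fun n => c * e n) 0.
Proof.
intros H. replace (Finite 0) with (Rbar_mult (Finite c) (Finite 0)) by (simpl; f_equal; ring).
now apply is_lim_seq_scal_l.
Qed.

(** On a ball staying to the right of 1 the derivatives of the truncations converge at the uniform
    rate [4 n^(-1/2)], so the limit may be differentiated term by term; this identifies the
    Euler-Maclaurin constant at [be] with [- zeta']. *)
Lemma zeta'R_spec be N : 1 < be -> (1 <= N)%nat ->
  Rabs (rsum (fun n => Rpower (INR n) (- be) * ln (INR n)) N - lnpow_prim be (INR N) - - zeta'R be)
  <= Rpower (INR N) (- be) * (ln (INR N) + 2 / be).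
Proof.
intros Hbe.
set (Lam := fun N x => rsum (fun n => Rpower (INR n) (- x) * ln (INR n)) N - lnpow_prim x (INR N)).
set (g := fun x => real (Lim_seq (fun n => Lam n x))).
assert (Hlim : forall c, is_lim_seq (fun n => c * Rpower (INR n) (- / 2)) 0).
{ intros c. apply is_lim_seq_scal0, is_lim_seq_Rpower_neg. lra. }
assert (Hg : forall x, 1 <= x -> forall N, (1 <= N)%nat -> Rabs (Lam N x - g x) <= Rpower (INR N) (- x) * (ln (INR N) + 2 / x)).
{ intros x Hx. destruct (lnpow_lim x Hx) as [L HL].
  assert (E : g x = L).
  { unfold g. rewrite (is_lim_seq_unique _ L); auto.
    apply (is_lim_seq_of_bound _ L (fun n => 4 * Rpower (INR n) (- / 2))); auto.
    intros n Hn. eapply Rle_trans; [apply HL; auto|]. apply lnpow_psi_bound; auto. apply (le_INR 1); lia. }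
  rewrite E. exact HL. }
assert (Hd : 0 < (be - 1) / 2) by lra.
assert (HB : forall y, Boule be (mkposreal _ Hd) y -> 1 < y).
{ intros y Hy. unfold Boule in Hy; simpl in Hy. apply Rabs_lt_between in Hy. lra. }
set (Zr := fun N x => rsum (fun n => Rpower (INR n) (- x)) N - Rpower (INR N) (1 - x) / (1 - x)).
assert (D : derivable_pt_lim zetaR be (- g be)).
{ apply (CVU_derivable (fun n => Zr (S n)) (fun n x => - Lam (S n) x) zetaR (fun x => - g x) be (mkposreal _ Hd)).
  - apply (CVU_of_bound (fun n x => - Lam n x) _ (fun n => 4 * Rpower (INR n) (- / 2))); auto.
    intros n y Hy Hn. apply HB in Hy.
    replace (- Lam n y - - g y) with (- (Lam n y - g y)) by ring. rewrite Rabs_Ropp.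
    eapply Rle_trans; [apply Hg; auto; lra|]. apply lnpow_psi_bound; [lra | apply (le_INR 1); lia].
  - intros x Hx. apply HB in Hx. apply is_lim_seq_Reals.
    apply (is_lim_seq_incr_1 (fun n => Zr n x)).
    apply (is_lim_seq_of_bound _ _ (fun n => Rpower (INR n) (- x))).
    + intros n Hn. rewrite Rabs_minus_sym. apply zetaR_approx; auto; lra.
    + apply is_lim_seq_Rpower_neg. lra.
  - intros n x Hx. apply HB in Hx. apply is_derive_Reals. unfold Zr, Lam.
    replace (- (rsum (fun n => Rpower (INR n) (- x) * ln (INR n)) (S n) - lnpow_prim x (INR (S n)))) with
     (rsum (fun n => - (Rpower (INR n) (- x) * ln (INR n))) (S n) - - lnpow_prim x (INR (S n))).
    + apply derR_minus.
      * apply is_derive_rsum. intros; apply is_derive_Rpower_exp.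
      * unfold lnpow_prim. destruct (Req_EM_T x 1) as [|_]; [lra|].
        generalize (INR (S n)). intros c. unfold Rpower. auto_derive; [lra|]. change (1 + - x) with (1 - x). generalize (exp ((1 - x) * ln c)). intros e. field. lra.
    + rewrite (rsum_ext (fun n => - (Rpower (INR n) (- x) * ln (INR n))) (fun n => (- 1) * (Rpower (INR n) (- x) * ln (INR n)))) by (intros; ring).
      rewrite rsum_scal. ring.
  - unfold Boule. rewrite Rminus_eq_0, Rabs_R0. apply cond_pos. }
assert (E : zeta'R be = - g be).
{ unfold zeta'R. apply is_derive_unique, is_derive_Reals. exact D. }
intros HN. rewrite E, Ropp_involutive. apply Hg; auto; lra.
Qed.

(* [W0 N u] tends to [(u - 1) zeta(u)] and, unlike the truncations of [zeta], is entire in [u]; at [u = 1]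
   its second derivative is [-2 (sum_(n <= N) (ln n) / n - (ln N)^2 / 2)]. *)
Section Gamma1.

Let W0 (N : nat) (u : R) : R := (u - 1) * rsum (fun n => Rpower (INR n) (- u)) N + Rpower (INR N) (1 - u).
(** [f1], [f2] are the first two [u]-derivatives of [(u-1) x^(-u)]. [Phi1], [Phi2] are minus those
    of [x^(1-u)] and at the same time [x]-primitives of [f1], [f2]. So [W1], [W2] are the
    derivatives of [W0] and also Euler-Maclaurin remainders. *)
Let f1 (u x : R) : R := Rpower x (- u) * (1 - (u - 1) * ln x).
Let f2 (u x : R) : R := Rpower x (- u) * (- 2 * ln x + (u - 1) * (ln x) ^ 2).
Let Phi1 (u x : R) : R := ln x * Rpower x (1 - u).
Let Phi2 (u x : R) : R := - (ln x) ^ 2 * Rpower x (1 - u).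
Let W1 (N : nat) (u : R) : R := rsum (fun n => f1 u (INR n)) N - Phi1 u (INR N).
Let W2 (N : nat) (u : R) : R := rsum (fun n => f2 u (INR n)) N - Phi2 u (INR N).
(** The value 1 fills the removable singularity: the product [(u-1) zetaR u] evaluates to 0 at 1,
    while its limit there is 1. *)
Let g0 (u : R) : R := if Req_EM_T u 1 then 1 else (u - 1) * zetaR u.
Let g1 (u : R) : R := real (Lim_seq (fun n => W1 n u)).
Let g2 (u : R) : R := real (Lim_seq (fun n => W2 n u)).

Lemma quarter_pos : 0 < / 4. Proof. lra. Qed.
Let quarter : posreal := mkposreal _ quarter_pos.

Lemma ln_le_eighth x : 1 <= x -> ln x <= 8 * Rpower x (/ 8).
Proof.
intros Hx. assert (P := Rpower_pos x (/ 8)).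
assert (H := ln_le_lin (Rpower x (/ 8)) P). rewrite ln_Rpower in H. lra.
Qed.

(** [log x <= 8 x^(1/8)] turns two logarithms into [x^(1/4)], which is the room between [u >= 3/4]
    and 1/2. This matches the radius 1/4 of the ball around 1. *)
Lemma poly_ln_bound u x a b c : / 4 <= u - / 2 -> 1 <= x -> 0 <= a -> 0 <= b -> 0 <= c ->
  Rpower x (- u - 1) * (a + b * ln x + c * (ln x) ^ 2) <= (a + 8 * b + 64 * c) * Rpower x (- / 2 - 1).
Proof.
intros Hu Hx Ha Hb Hc. assert (L := ln_nonneg x Hx). assert (E := ln_le_eighth x Hx).
assert (P8 : 1 <= Rpower x (/ 8)).
{ rewrite <- (Rpower_O x) at 1 by lra. apply Rle_Rpower; lra. }
set (p := Rpower x (/ 8)) in *.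
assert (P : Rpower x (- u - 1) * (p * p) <= Rpower x (- / 2 - 1)).
{ unfold p. rewrite <- !Rpower_plus. apply Rle_Rpower; lra. }
assert (Q := Rpower_pos x (- u - 1)).
assert (B : a + b * ln x + c * ln x ^ 2 <= (a + 8 * b + 64 * c) * (p * p)).
{ assert (p <= p * p) by nra. assert (ln x ^ 2 <= 64 * (p * p)) by (simpl; nra).
  assert (b * ln x <= b * (8 * (p * p))) by (apply Rmult_le_compat_l; lra).
  assert (c * ln x ^ 2 <= c * (64 * (p * p))) by (apply Rmult_le_compat_l; lra).
  assert (a * 1 <= a * (p * p)) by (apply Rmult_le_compat_l; lra). lra. }
apply Rle_trans with (Rpower x (- u - 1) * ((a + 8 * b + 64 * c) * (p * p))).
- apply Rmult_le_compat_l; lra.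
- replace (Rpower x (- u - 1) * ((a + 8 * b + 64 * c) * (p * p))) with
   ((a + 8 * b + 64 * c) * (Rpower x (- u - 1) * (p * p))) by ring.
  apply Rmult_le_compat_l; lra.
Qed.

Lemma EM_uniform_limit (f f' Phi : R -> R) :
  (forall x, 1 <= x -> is_derive Phi x (f x)) -> (forall x, 1 <= x -> is_derive f x (f' x)) ->
  (forall x, 1 <= x -> Rabs (f' x) <= 100 * Rpower x (- / 2 - 1)) ->
  forall N, (1 <= N)%nat ->
  Rabs (rsum (fun n => f (INR n)) N - Phi (INR N) - 
    real (Lim_seq (fun N => rsum (fun n => f (INR n)) N - Phi (INR N)))) <= 200 * Rpower (INR N) (- / 2).
Proof.
intros H1 H2 H3.
assert (Hl := is_lim_seq_scal0 200 _ (is_lim_seq_Rpower_neg (/ 2) ltac:(lra))).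
destruct (EM_real_lim f f' Phi (fun x => 200 * Rpower x (- / 2)) (fun x => 200 * (- / 2 * Rpower x (- / 2 - 1)))) as [L HL]; auto.
- intros x Hx. apply derR_scal, is_derive_Rpower. lra.
- intros x Hx. eapply Rle_trans; [apply H3; auto|]. lra.
- intros x Hx. assert (P := Rpower_pos x (- / 2)). lra.
- rewrite (is_lim_seq_unique _ L); auto.
  apply (is_lim_seq_of_bound _ L (fun n => 200 * Rpower (INR n) (- / 2))); auto.
Qed.

Lemma Rpower_shift u x : 0 < x -> Rpower x (1 - u) = x * Rpower x (- u) /\ Rpower x (- u) = x * Rpower x (- u - 1).
Proof.
intros Hx. split.
- rewrite <- (Rpower_1 x) at 2 by auto. rewrite <- Rpower_plus. reflexivity.
- rewrite <- (Rpower_1 x) at 2 by auto. rewrite <- Rpower_plus. f_equal. ring.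
Qed.

Lemma W1_unif u N : Rabs (u - 1) < / 4 -> (1 <= N)%nat -> Rabs (W1 N u - g1 u) <= 200 * Rpower (INR N) (- / 2).
Proof.
intros Hu. apply Rabs_lt_between in Hu. unfold W1, g1.
apply (EM_uniform_limit (f1 u) (fun x => Rpower x (- u - 1) * (- u * (1 - (u - 1) * ln x) - (u - 1))) (Phi1 u)).
- intros x Hx. unfold Phi1, f1. destruct (Rpower_shift u x ltac:(lra)) as [E1 _].
  assert (D := is_derive_Rpower x (1 - u) ltac:(lra)).
  assert (D2 := derR_mult ln (fun y => Rpower y (1 - u)) x (/ x) _ (ltac:(auto_derive; lra)) D).
  replace (1 - u - 1) with (- u) in D2 by ring. rewrite E1 in D2.
  replace (Rpower x (- u) * (1 - (u - 1) * ln x)) with (/ x * (x * Rpower x (- u)) + ln x * ((1 - u) * Rpower x (- u))) by (field; lra).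
  exact D2.
- intros x Hx. unfold f1. destruct (Rpower_shift u x ltac:(lra)) as [_ E2].
  assert (D := is_derive_Rpower x (- u) ltac:(lra)).
  assert (D2 := derR_mult (fun y => Rpower y (- u)) (fun y => 1 - (u - 1) * ln y) x _ (- (u - 1) * / x) D
    (ltac:(auto_derive; [lra | field; lra]))).
  cbv beta in D2. rewrite E2 in D2.
  replace (Rpower x (- u - 1) * (- u * (1 - (u - 1) * ln x) - (u - 1))) with
   (- u * Rpower x (- u - 1) * (1 - (u - 1) * ln x) + x * Rpower x (- u - 1) * (- (u - 1) * / x)) by (field; lra).
  exact D2.
- intros x Hx. assert (Q := Rpower_pos x (- u - 1)). assert (L := ln_nonneg x Hx).
  rewrite Rabs_mult, Rabs_pos_eq by lra.
  apply Rle_trans with (Rpower x (- u - 1) * (2 + 2 * ln x + 0 * (ln x) ^ 2));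
    [|eapply Rle_trans; [apply poly_ln_bound; lra|]].
  + apply Rmult_le_compat_l; [lra|].
    replace (- u * (1 - (u - 1) * ln x) - (u - 1)) with (1 - 2 * u + (u * (u - 1)) * ln x) by ring.
    assert (Rabs (u * (u - 1)) <= 2) by (apply Rabs_le; nra).
    eapply Rle_trans; [apply Rabs_triang|]. rewrite Rabs_mult, (Rabs_pos_eq (ln x)) by lra.
    assert (Rabs (1 - 2 * u) <= 2) by (apply Rabs_le; lra). nra.
  + apply Rmult_le_compat_r; [left; apply Rpower_pos | lra].
Qed.

Lemma W2_unif u N : Rabs (u - 1) < / 4 -> (1 <= N)%nat -> Rabs (W2 N u - g2 u) <= 200 * Rpower (INR N) (- / 2).
Proof.
intros Hu. apply Rabs_lt_between in Hu. unfold W2, g2.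
apply (EM_uniform_limit (f2 u) (fun x => Rpower x (- u - 1) * (- u * (- 2 * ln x + (u - 1) * (ln x) ^ 2) + (- 2 + 2 * (u - 1) * ln x))) (Phi2 u)).
- intros x Hx. unfold Phi2, f2. destruct (Rpower_shift u x ltac:(lra)) as [E1 _].
  assert (D := is_derive_Rpower x (1 - u) ltac:(lra)).
  assert (D2 := derR_mult (fun y => - (ln y) ^ 2) (fun y => Rpower y (1 - u)) x (- (2 * ln x * / x)) _ 
    (ltac:(auto_derive; [lra | simpl; field; lra])) D).
  replace (1 - u - 1) with (- u) in D2 by ring. rewrite E1 in D2.
  replace (Rpower x (- u) * (- 2 * ln x + (u - 1) * ln x ^ 2)) with (- (2 * ln x * / x) * (x * Rpower x (- u)) + - ln x ^ 2 * ((1 - u) * Rpower x (- u))) by (field; lra).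
  exact D2.
- intros x Hx. unfold f2. destruct (Rpower_shift u x ltac:(lra)) as [_ E2].
  assert (D := is_derive_Rpower x (- u) ltac:(lra)).
  assert (D2 := derR_mult (fun y => Rpower y (- u)) (fun y => - 2 * ln y + (u - 1) * (ln y) ^ 2) x _ ((- 2 + 2 * (u - 1) * ln x) * / x) D
    (ltac:(auto_derive; [lra | simpl; field; lra]))).
  cbv beta in D2. rewrite E2 in D2.
  replace (Rpower x (- u - 1) * (- u * (- 2 * ln x + (u - 1) * (ln x) ^ 2) + (- 2 + 2 * (u - 1) * ln x))) with
   (- u * Rpower x (- u - 1) * (- 2 * ln x + (u - 1) * ln x ^ 2) + x * Rpower x (- u - 1) * ((- 2 + 2 * (u - 1) * ln x) * / x)) by (field; lra).
  exact D2.
- intros x Hx. assert (Q := Rpower_pos x (- u - 1)). assert (L := ln_nonneg x Hx).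
  rewrite Rabs_mult, Rabs_pos_eq by lra.
  (* [poly_ln_bound] turns this into [2 + 24 + 64 = 90] times [x^(-3/2)], within the 100 allowed by
     [EM_uniform_limit]. *)
  apply Rle_trans with (Rpower x (- u - 1) * (2 + 3 * ln x + 1 * (ln x) ^ 2));
    [|eapply Rle_trans; [apply poly_ln_bound; lra|]].
  + apply Rmult_le_compat_l; [lra|].
    replace (- u * (- 2 * ln x + (u - 1) * ln x ^ 2) + (- 2 + 2 * (u - 1) * ln x)) with
      (- (2) + ((4 * u - 2) * ln x + (- (u * (u - 1))) * ln x ^ 2)) by ring.
    assert (Rabs (- (u * (u - 1))) <= 1) by (apply Rabs_le; nra).
    assert (Rabs (4 * u - 2) <= 3) by (apply Rabs_le; lra).
    eapply Rle_trans; [apply Rabs_triang|]. rewrite Rabs_Ropp, (Rabs_pos_eq 2) by lra.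
    eapply Rle_trans; [apply Rplus_le_compat_l, Rabs_triang|].
    rewrite !Rabs_mult, (Rabs_pos_eq (ln x)), (Rabs_pos_eq (ln x ^ 2)) by (try apply pow2_ge_0; lra).
    nra.
  + apply Rmult_le_compat_r; [left; apply Rpower_pos | lra].
Qed.

Lemma g0_g1_derive u : Rabs (u - 1) < / 4 -> is_derive g0 u (g1 u) /\ is_derive g1 u (g2 u).
Proof.
intros Hu.
assert (Hl := is_lim_seq_scal0 200 _ (is_lim_seq_Rpower_neg (/ 2) ltac:(lra))).
split; apply is_derive_Reals.
- apply (CVU_derivable (fun n => W0 (S n)) (fun n => W1 (S n)) g0 g1 1 quarter); auto.
  + apply (CVU_of_bound W1 g1 (fun n => 200 * Rpower (INR n) (- / 2))); auto.
    intros n y Hy Hn. apply W1_unif; auto.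
  + intros x Hx. unfold Boule in Hx; simpl in Hx. apply Rabs_lt_between in Hx.
    apply is_lim_seq_Reals. apply (is_lim_seq_incr_1 (fun n => W0 n x)). unfold W0, g0.
    destruct (Req_EM_T x 1) as [->|Hne].
    * apply (is_lim_seq_ext_loc (fun _ => 1)); [|apply is_lim_seq_const].
      exists 1%nat. intros n Hn. replace (1 - 1) with 0 by ring. rewrite Rpower_O; [ring|].
      apply lt_0_INR; lia.
    * apply (is_lim_seq_of_bound _ _ (fun n => Rabs (x - 1) * Rpower (INR n) (- x))).
      -- intros n Hn. assert (Z := zetaR_approx x n ltac:(lra) Hne Hn).
         replace ((x - 1) * rsum (fun n => Rpower (INR n) (- x)) n + Rpower (INR n) (1 - x) - (x - 1) * zetaR x)
         with (- (x - 1) * (zetaR x - (rsum (fun n => Rpower (INR n) (- x)) n - Rpower (INR n) (1 - x) / (1 - x)))) by (field; lra).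
         rewrite Rabs_mult, Rabs_Ropp. apply Rmult_le_compat_l; auto using Rabs_pos.
      -- apply is_lim_seq_scal0, is_lim_seq_Rpower_neg. lra.
  + intros n x Hx. apply is_derive_Reals. unfold W0, W1, f1, Phi1.
    assert (D1 := is_derive_rsum (fun n y => Rpower (INR n) (- y)) _ x (S n) (fun n _ => is_derive_Rpower_exp (INR n) x)).
    assert (D2 : is_derive (fun u => u - 1) x 1) by (auto_derive; auto; ring).
    assert (D3 : is_derive (fun u => Rpower (INR (S n)) (1 - u)) x (- (ln (INR (S n)) * Rpower (INR (S n)) (1 - x)))).
    { generalize (INR (S n)). intros c. unfold Rpower. auto_derive; auto.
      change (1 + - x) with (1 - x). ring. }
    assert (D4 := derR_plus _ _ _ _ _ (derR_mult _ _ _ _ _ D2 D1) D3). cbv beta in D4.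
    match type of D4 with is_derive _ _ ?a => match goal with |- is_derive _ _ ?b => replace b with a; [exact D4|] end end.
    rewrite (rsum_ext (fun n => Rpower (INR n) (- x) * (1 - (x - 1) * ln (INR n))) 
      (fun n => Rpower (INR n) (- x) + (x - 1) * (- (Rpower (INR n) (- x) * ln (INR n))))) by (intros; ring).
    rewrite rsum_plus, rsum_scal. ring.
- apply (CVU_derivable (fun n => W1 (S n)) (fun n => W2 (S n)) g1 g2 1 quarter); auto.
  + apply (CVU_of_bound W2 g2 (fun n => 200 * Rpower (INR n) (- / 2))); auto.
    intros n y Hy Hn. apply W2_unif; auto.
  + intros x Hx. apply is_lim_seq_Reals. apply (is_lim_seq_incr_1 (fun n => W1 n x)).
    apply (is_lim_seq_of_bound _ _ (fun n => 200 * Rpower (INR n) (- / 2))); auto.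
    intros n Hn. apply W1_unif; auto.
  + intros n x Hx. apply is_derive_Reals. unfold W1, W2. apply derR_minus.
    * apply (is_derive_rsum (fun n u => f1 u (INR n))). intros k _. generalize (INR k). intros c. unfold f1, f2, Rpower.
      auto_derive; auto. ring.
    * generalize (INR (S n)). intros c. unfold Phi1, Phi2, Rpower. auto_derive; auto.
      change (1 + - x) with (1 - x). ring.
Qed.

Lemma g2_at_1 L : (forall N, (1 <= N)%nat ->
   Rabs (rsum (fun n => Rpower (INR n) (- (1)) * ln (INR n)) N - lnpow_prim 1 (INR N) - L)
   <= Rpower (INR N) (- (1)) * (ln (INR N) + 2 / 1)) -> g2 1 = - 2 * L.
Proof.
intros HL. unfold g2. rewrite (is_lim_seq_unique _ (- 2 * L)); auto.
apply (is_lim_seq_of_bound _ _ (fun n => 2 * (4 * Rpower (INR n) (- / 2)))).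
- intros n Hn. assert (H1 : 1 <= INR n) by (apply (le_INR 1); lia).
  unfold W2, f2, Phi2.
  assert (E := HL n Hn). assert (B := lnpow_psi_bound 1 ltac:(lra) (INR n) H1).
  rewrite (rsum_ext (fun n => Rpower (INR n) (- (1)) * (-2 * ln (INR n) + (1 - 1) * ln (INR n) ^ 2))
    (fun n => - 2 * (Rpower (INR n) (- (1)) * ln (INR n)))) by (intros; ring).
  rewrite rsum_scal. replace (1 - 1) with 0 by ring. rewrite Rpower_O by lra.
  unfold lnpow_prim in E. destruct (Req_EM_T 1 1) as [_|]; [|lra].
  match goal with |- Rabs ?a <= _ => replace a with
   (- 2 * (rsum (fun n => Rpower (INR n) (- (1)) * ln (INR n)) n - ln (INR n) ^ 2 / 2 - L)) by field end.
  rewrite Rabs_mult. replace (Rabs (- 2)) with 2 by (rewrite Rabs_left; lra). lra.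
- apply is_lim_seq_scal0, is_lim_seq_scal0, is_lim_seq_Rpower_neg. lra.
Qed.

(** [(u-1) zetaR u] agrees with [g0] only off 1, so derivatives are compared on balls avoiding 1.
    This suffices because the limit defining [gamma1] sees a punctured neighbourhood. *)
Lemma Derive2_g2 s : Rabs (s - 1) < / 4 -> s <> 1 -> Derive_n (fun u => (u - 1) * zetaR u) 2 s = g2 s.
Proof.
intros Hs Hs1.
assert (Hloc : forall y, Rabs (y - 1) < / 4 -> y <> 1 -> Derive (fun u => (u - 1) * zetaR u) y = g1 y).
{ intros y Hy Hy1. rewrite (Derive_ext_loc _ g0).
  - apply is_derive_unique, g0_g1_derive; auto.
  - assert (Hp : 0 < Rabs (y - 1)) by (apply Rabs_pos_lt; lra).
    exists (mkposreal _ Hp). intros z Hz. change (Rabs (z - y) < Rabs (y - 1)) in Hz.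
    unfold g0. destruct (Req_EM_T z 1) as [->|]; auto.
    rewrite Rabs_minus_sym in Hz. lra. }
simpl. rewrite (Derive_ext_loc _ g1).
- apply is_derive_unique, g0_g1_derive; auto.
- assert (Hp : 0 < Rmin (Rabs (s - 1)) (/ 4 - Rabs (s - 1))).
  { apply Rmin_pos; [apply Rabs_pos_lt; lra | lra]. }
  exists (mkposreal _ Hp). intros z Hz. change (Rabs (z - s) < Rmin (Rabs (s - 1)) (/ 4 - Rabs (s - 1))) in Hz.
  apply Hloc.
  + assert (M := Rmin_r (Rabs (s - 1)) (/ 4 - Rabs (s - 1))).
    replace (z - 1) with ((z - s) + (s - 1)) by ring. eapply Rle_lt_trans; [apply Rabs_triang|]. lra.
  + intros ->. assert (M := Rmin_l (Rabs (s - 1)) (/ 4 - Rabs (s - 1))). rewrite Rabs_minus_sym in Hz. lra.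
Qed.

(** [g2] is continuous at 1 as a uniform limit, so the limit defining [gamma1] is [g2 1 = -2 L], and
    halving gives [gamma1 = - L]. *)
Lemma gamma1_spec N : (1 <= N)%nat ->
   Rabs (rsum (fun n => Rpower (INR n) (- (1)) * ln (INR n)) N - lnpow_prim 1 (INR N) - - gamma1)
   <= Rpower (INR N) (- (1)) * (ln (INR N) + 2 / 1).
Proof.
destruct (lnpow_lim 1 ltac:(lra)) as [L HL].
assert (E : gamma1 = - L).
{ unfold gamma1. rewrite (is_lim_unique _ 1 (g2 1)).
  - simpl. rewrite (g2_at_1 L HL). field.
  - apply (is_lim_ext_loc g2).
    + exists quarter. intros y Hy Hy1. symmetry. apply Derive2_g2; auto.
    + apply is_lim_continuity.
      assert (Hl := is_lim_seq_scal0 200 _ (is_lim_seq_Rpower_neg (/ 2) ltac:(lra))).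
      apply (CVU_continuity (fun n => W2 (S n)) g2 1 quarter).
      * apply (CVU_of_bound W2 g2 (fun n => 200 * Rpower (INR n) (- / 2))); auto.
        intros n y Hy Hn. apply W2_unif; auto.
      * intros n y Hy. apply continuity_pt_filterlim.
        apply (ex_derive_continuous (K := R_AbsRing) (V := R_NormedModule)).
        assert (HF : forall k, ex_derive (fun u => f2 u (INR k)) y) by (intros; unfold f2, Rpower; auto_derive; auto).
        exists (rsum (fun k => Derive (fun u => f2 u (INR k)) y) (S n) - Derive (fun u => Phi2 u (INR (S n))) y).
        unfold W2. apply derR_minus.
        -- apply (is_derive_rsum (fun n u => f2 u (INR n))). intros k _. apply Derive_correct, HF.
        -- apply Derive_correct. unfold Phi2, Rpower; auto_derive; auto.
      * unfold Boule. rewrite Rminus_eq_0, Rabs_R0. apply cond_pos. }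
intros HN. rewrite E, Ropp_involutive. apply HL; auto.
Qed.
End Gamma1.

(** * The hyperbola method *)

Lemma fsum_ext f g u X : (forall n, (1 <= n <= X)%nat -> INR n <= u -> f n = g n) -> fsum f u X = fsum g u X.
Proof.
intros H. apply rsum_ext. intros n Hn. destruct (Rle_dec (INR n) u); auto.
Qed.

Lemma fsum_plus f g u X : fsum (fun n => f n + g n) u X = fsum f u X + fsum g u X.
Proof.
unfold fsum. rewrite <- rsum_plus. apply rsum_ext. intros n _. destruct (Rle_dec (INR n) u); ring.
Qed.

Lemma fsum_scal c f u X : fsum (fun n => c * f n) u X = c * fsum f u X.
Proof.
unfold fsum. rewrite <- rsum_scal. apply rsum_ext. intros n _. destruct (Rle_dec (INR n) u); ring.
Qed.

Lemma fsum_diff_bound f g e u X : 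
  (forall n, (1 <= n <= X)%nat -> INR n <= u -> Rabs (f n - g n) <= e n) ->
  Rabs (fsum f u X - fsum g u X) <= fsum e u X.
Proof.
intros H. unfold fsum. rewrite <- rsum_minus. eapply Rle_trans; [apply Rabs_rsum|].
apply rsum_le. intros n Hn. destruct (Rle_dec (INR n) u); auto.
rewrite Rminus_0_r, Rabs_R0. lra.
Qed.

Lemma fsum_const c u X : 0 <= c -> 0 <= u <= INR X -> fsum (fun _ => c) u X <= u * c.
Proof.
intros Hc Hu. destruct (nat_floor u ltac:(lra)) as [n Hn].
rewrite (fsum_floor _ u n X) by lra. rewrite rsum_const. nra.
Qed.

Section Hyperbola.
Variable b : nat.
Hypothesis Hb : (1 <= b)%nat.

Let be : R := (INR b + 1) / 2.

(* [X] is only a cutoff making the sums finite: the value is the same for all [X >= n]. *)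
Definition wsum (X n : nat) : R :=
  rsum (fun k => rsum (fun m =>
    if le_dec (k ^ b * m) n then Rpower (INR k) (- ((INR b + 1) / 2)) * / INR m else 0) X) X.

Lemma hyperbola X n y : 0 < y -> y ^ b * y = INR n ->
  wsum X n =
    fsum (fun k => Rpower (INR k) (- be) * fsum (fun m => / INR m) (INR n / INR k ^ b) X) y X
  + fsum (fun m => / INR m * fsum (fun k => Rpower (INR k) (- be)) (Rpower (INR n / INR m) (/ INR b)) X) y X
  - fsum (fun k => Rpower (INR k) (- be)) y X * fsum (fun m => / INR m) y X.
Proof.
intros Hy Hyn.
assert (Hb0 : 0 < INR b) by (apply lt_0_INR; lia).
assert (HyP : 0 < y ^ b) by (apply pow_lt; auto).
set (f := fun k : nat => Rpower (INR k) (- be)). set (g := fun m : nat => / INR m).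
assert (E : forall k m, (1 <= k <= X)%nat -> (1 <= m <= X)%nat ->
  (if le_dec (k ^ b * m) n then f k * g m else 0) =
  (if Rle_dec (INR k) y then f k * (if Rle_dec (INR m) (INR n / INR k ^ b) then g m else 0) else 0)
  + (if Rle_dec (INR m) y then g m * (if Rle_dec (INR k) (Rpower (INR n / INR m) (/ INR b)) then f k else 0) else 0)
  - (if Rle_dec (INR k) y then f k else 0) * (if Rle_dec (INR m) y then g m else 0)).
{ intros k m Hk Hm.
  assert (Hk0 : 0 < INR k) by (apply lt_0_INR; lia).
  assert (Hm0 : 0 < INR m) by (apply lt_0_INR; lia).
  assert (HkP : 0 < INR k ^ b) by (apply pow_lt; auto).
  assert (C0 : (k ^ b * m <= n)%nat <-> INR k ^ b * INR m <= INR n).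
  { rewrite <- pow_INR, <- mult_INR. split; [apply le_INR | apply INR_le]. }
  assert (C2 : INR m <= INR n / INR k ^ b <-> INR k ^ b * INR m <= INR n).
  { split; intros H; [apply Rle_div_r in H; lra | apply Rle_div_r; lra]. }
  assert (C4 : INR k <= Rpower (INR n / INR m) (/ INR b) <-> INR k ^ b * INR m <= INR n).
  { split; intros H.
    - destruct (Req_dec (INR n) 0) as [E0|E0].
      { rewrite E0 in Hyn. nra. }
      assert (0 < INR n) by (assert (X1 := pos_INR n); lra).
      assert (Hr : 0 < INR n / INR m) by (apply Rdiv_lt_0_compat; lra).
      assert (H2 : Rpower (INR k) (INR b) <= Rpower (Rpower (INR n / INR m) (/ INR b)) (INR b)).
      { apply Rle_Rpower_l; lra. }
      rewrite Rpower_mult, Rinv_l, Rpower_1, Rpower_pow in H2 by lra.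
      apply (Rmult_le_compat_r (INR m)) in H2; [|lra].
      replace (INR n / INR m * INR m) with (INR n) in H2 by (field; lra). auto.
    - 
      assert (H2 : INR k ^ b <= INR n / INR m) by (apply Rle_div_r; lra).
      replace (INR k) with (Rpower (Rpower (INR k) (INR b)) (/ INR b)).
      + apply Rle_Rpower_l; [left; now apply Rinv_0_lt_compat|]. split; [apply Rpower_pos|].
        now rewrite Rpower_pow.
      + rewrite Rpower_mult, Rinv_r, Rpower_1; lra. }
  assert (D1 : INR k <= y -> INR m <= y -> INR k ^ b * INR m <= INR n).
  { intros H1 H2. rewrite <- Hyn. apply Rmult_le_compat; try lra. apply pow_incr; lra. }
  assert (D2 : ~ INR k <= y -> ~ INR m <= y -> ~ INR k ^ b * INR m <= INR n).
  { intros H1 H2. apply Rnot_le_lt in H1. apply Rnot_le_lt in H2. apply Rlt_not_le.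
    rewrite <- Hyn. apply Rle_lt_trans with (INR k ^ b * y).
    - apply Rmult_le_compat_r; [lra|]. apply pow_incr; lra.
    - apply Rmult_lt_compat_l; lra. }
  destruct (le_dec (k ^ b * m) n) as [P0|P0], (Rle_dec (INR k) y) as [P1|P1], (Rle_dec (INR m) y) as [P3|P3],
    (Rle_dec (INR m) (INR n / INR k ^ b)) as [P2|P2], (Rle_dec (INR k) (Rpower (INR n / INR m) (/ INR b))) as [P4|P4];
   try ring; exfalso; tauto. }
unfold wsum. fold be.
transitivity (rsum (fun k => rsum (fun m => 
  (if Rle_dec (INR k) y then f k * (if Rle_dec (INR m) (INR n / INR k ^ b) then g m else 0) else 0)
  + (if Rle_dec (INR m) y then g m * (if Rle_dec (INR k) (Rpower (INR n / INR m) (/ INR b)) then f k else 0) else 0)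
  - (if Rle_dec (INR k) y then f k else 0) * (if Rle_dec (INR m) y then g m else 0)) X) X).
{ apply rsum_ext; intros k Hk. apply rsum_ext; intros m Hm. now apply E. }
rewrite (rsum_ext _ (fun k => 
   (if Rle_dec (INR k) y then f k * fsum g (INR n / INR k ^ b) X else 0) +
   rsum (fun m => if Rle_dec (INR m) y then g m * (if Rle_dec (INR k) (Rpower (INR n / INR m) (/ INR b)) then f k else 0) else 0) X
   - fsum g y X * (if Rle_dec (INR k) y then f k else 0))).
- rewrite rsum_minus, rsum_plus, rsum_scal, rsum_swap.
  rewrite (rsum_ext (fun m => rsum (fun k => if Rle_dec (INR m) y then g m * (if Rle_dec (INR k) (Rpower (INR n / INR m) (/ INR b)) then f k else 0) else 0) X)
   (fun m => if Rle_dec (INR m) y then g m * fsum f (Rpower (INR n / INR m) (/ INR b)) X else 0)).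
  + unfold f, g, fsum. cbv beta. ring.
  + intros m Hm. destruct (Rle_dec (INR m) y).
    * now rewrite rsum_scal.
    * apply rsum_0.
- intros k Hk. rewrite rsum_minus, rsum_plus, rsum_scal. f_equal; [f_equal|].
  + destruct (Rle_dec (INR k) y); [now rewrite rsum_scal | apply rsum_0].
  + apply Rmult_comm.
Qed.

Variables (X n : nat).
Hypothesis Hn : (1 <= n)%nat.
Hypothesis HnX : (n <= X)%nat.
Let x : R := INR n.
Let y : R := Rpower x (/ (INR b + 1)).
Let l : R := ln y.

Lemma one_le_x : 1 <= x. Proof. apply (le_INR 1). exact Hn. Qed.
Lemma x_le_X : x <= INR X. Proof. apply le_INR. exact HnX. Qed.
Lemma one_le_b : 1 <= INR b. Proof. apply (le_INR 1). exact Hb. Qed.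

Lemma one_le_y : 1 <= y.
Proof.
assert (H := one_le_x). assert (H2 := one_le_b).
unfold y. apply Rle_trans with (Rpower x 0); [rewrite Rpower_O; lra|]. apply Rle_Rpower; [lra|].
left. apply Rinv_0_lt_compat. lra.
Qed.

Lemma ln_x_eq : ln x = (INR b + 1) * l.
Proof. assert (H2 := one_le_b). unfold l, y. rewrite ln_Rpower. field. lra. Qed.

Lemma ln_y_nonneg : 0 <= l. Proof. apply ln_nonneg, one_le_y. Qed.

Lemma Rpower_x_eq a : Rpower x a = Rpower y ((INR b + 1) * a).
Proof. unfold Rpower. f_equal. rewrite ln_x_eq. fold l. ring. Qed.

Lemma y_pow_b_y : y ^ b * y = x.
Proof.
assert (H := one_le_y). rewrite <- Rpower_pow by lra. rewrite <- (Rpower_1 y) at 2 by lra.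
rewrite <- Rpower_plus. rewrite <- (Rpower_1 x) at 1 by (assert (Q := one_le_x); lra).
rewrite (Rpower_x_eq 1). f_equal. ring.
Qed.

Lemma y_le_x : y <= x.
Proof.
assert (H := one_le_y). rewrite <- y_pow_b_y. assert (1 <= y ^ b) by (apply pow_R1_Rle; lra). nra.
Qed.

(** The cut [y = x^(1/(b+1))] and [be = (b+1)/2] turn every error [y^(-be)] into [x^(-1/2)],
    whatever [b] is. *)
Lemma Rpower_y_be : Rpower y (- be) = Rpower x (- / 2).
Proof. rewrite Rpower_x_eq. f_equal. unfold be. field. Qed.

(** For [k <= y] the inner sum is [log x - b log k + gamma] up to [5 k^b / x]. Weighted by [k^(-be)]
    each error is at most [5 y^(b-be) / x], and at most [y] of them total [5 y^(-be)], by
    [y^b y = x]. *)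
Lemma hyperbola_small_k :
  Rabs (fsum (fun k => Rpower (INR k) (- be) * fsum (fun m => / INR m) (x / INR k ^ b) X) y X
   - ((ln x + euler_gamma) * fsum (fun k => Rpower (INR k) (- be)) y X
      - INR b * fsum (fun k => Rpower (INR k) (- be) * ln (INR k)) y X)) <= 5 * Rpower y (- be).
Proof.
assert (HX := x_le_X). assert (Hy := one_le_y). assert (Hyb := y_pow_b_y). assert (Hyx := y_le_x).
assert (Hb1 := one_le_b).
replace ((ln x + euler_gamma) * fsum (fun k => Rpower (INR k) (- be)) y X
      - INR b * fsum (fun k => Rpower (INR k) (- be) * ln (INR k)) y X) with
  (fsum (fun k => (ln x + euler_gamma) * Rpower (INR k) (- be) + - INR b * (Rpower (INR k) (- be) * ln (INR k))) y X).
2:{ rewrite fsum_plus, !fsum_scal. ring. }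
eapply Rle_trans; [apply (fsum_diff_bound _ _ (fun _ => 5 * Rpower y (INR b - be) / x))|].
- intros k Hk Hky.
  assert (Hk1 : 1 <= INR k) by (apply (le_INR 1); lia).
  assert (Hkb : INR k ^ b <= y ^ b) by (apply pow_incr; lra).
  assert (Hk1b : 1 <= INR k ^ b) by (apply pow_R1_Rle; lra).
  set (u := x / INR k ^ b).
  assert (Hu : 1 <= u <= INR X).
  { unfold u. split; [apply Rle_div_r; nra|]. apply Rle_div_l; nra. }
  assert (Q := fsum_harmonic u X Hu).
  assert (Elu : ln u = ln x - INR b * ln (INR k)).
  { unfold u. rewrite ln_div by lra. rewrite <- Rpower_pow by lra. now rewrite ln_Rpower. }
  replace (Rpower (INR k) (- be) * fsum (fun m => / INR m) u X -
    ((ln x + euler_gamma) * Rpower (INR k) (- be) + - INR b * (Rpower (INR k) (- be) * ln (INR k)))) with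
    (Rpower (INR k) (- be) * (fsum (fun m => / INR m) u X - (ln u + euler_gamma))) by (rewrite Elu; ring).
  rewrite Rabs_mult, Rabs_pos_eq by (left; apply Rpower_pos).
  apply Rle_trans with (Rpower (INR k) (- be) * (5 / u)).
  { apply Rmult_le_compat_l; [left; apply Rpower_pos | exact Q]. }
  replace (Rpower (INR k) (- be) * (5 / u)) with (5 * (Rpower (INR k) (- be) * INR k ^ b) / x).
  2:{ unfold u. field. lra. }
  rewrite <- Rpower_pow, <- Rpower_plus by lra.
  replace (- be + INR b) with (INR b - be) by ring.
  unfold Rdiv. apply Rmult_le_compat_r; [left; apply Rinv_0_lt_compat; lra|].
  apply Rmult_le_compat_l; [lra|]. apply Rle_Rpower_l; [unfold be; lra | lra].
- eapply Rle_trans; [apply fsum_const; [|lra]|].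
  + apply Rdiv_le_0_compat; [|lra]. assert (P := Rpower_pos y (INR b - be)). lra.
  + right. assert (E : Rpower y (INR b - be) * y = Rpower y (- be) * x).
    { rewrite <- Hyb. rewrite <- Rpower_pow by lra. rewrite <- (Rpower_1 y) at 2 5 by lra.
      rewrite <- !Rpower_plus. f_equal. ring. }
    replace (y * (5 * Rpower y (INR b - be) / x)) with (5 * (Rpower y (INR b - be) * y) / x) by (field; lra).
    rewrite E. field. lra.
Qed.

(** The inner sum over [k <= (x/m)^(1/b)] is [zeta(be)] plus the tail term
    [(x/m)^((1-be)/b) / (1-be)]. Divided by [m], this term carries [m^(-(1/2 + 1/(2b)))], the origin
    of the secondary term. For [b = 1] one has [be = 1] and the power sum becomes logarithmic. *)
Lemma hyperbola_small_m : (1 < b)%nat ->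
  Rabs (fsum (fun m => / INR m * fsum (fun k => Rpower (INR k) (- be)) (Rpower (x / INR m) (/ INR b)) X) y X
   - (zetaR be * fsum (fun m => / INR m) y X 
      + Rpower x ((1 - be) / INR b) / (1 - be) * fsum (fun m => Rpower (INR m) (- (1 / (2 * INR b) + 1 / 2))) y X))
  <= (2 * Rpower 2 be + 1) * Rpower y (- be) * fsum (fun m => / INR m) y X.
Proof.
intros Hb2.
assert (Hx := one_le_x). assert (HX := x_le_X). assert (Hyb := y_pow_b_y). 
assert (Hb1 : 2 <= INR b) by (apply (le_INR 2); lia).
assert (Hbe : 1 < be) by (unfold be; lra).
assert (Hib : 0 < / INR b <= 1).
{ split; [apply Rinv_0_lt_compat; lra|]. rewrite <- Rinv_1. apply Rinv_le_contravar; lra. }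
match goal with |- Rabs (_ - ?z) <= _ => replace z with
  (fsum (fun m => zetaR be * / INR m + Rpower x ((1 - be) / INR b) / (1 - be) * Rpower (INR m) (- (1 / (2 * INR b) + 1 / 2))) y X) end.
2:{ now rewrite fsum_plus, !fsum_scal. }
rewrite <- fsum_scal. apply fsum_diff_bound. intros m Hm Hmy.
assert (Hm1 : 1 <= INR m) by (apply (le_INR 1); lia).
set (v := x / INR m). set (u := Rpower v (/ INR b)).
assert (Hv1 : y ^ b <= v) by (unfold v; apply Rle_div_r; [lra|]; rewrite <- Hyb; apply Rmult_le_compat_l; [apply pow_le; lra | lra]).
assert (Hv2 : v <= x) by (unfold v; apply Rle_div_l; nra).
assert (Hyb1 : 1 <= y ^ b) by (apply pow_R1_Rle; lra).
assert (Hyu : y <= u).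
{ unfold u. replace y with (Rpower (Rpower y (INR b)) (/ INR b)).
  - apply Rle_Rpower_l; [lra|]. rewrite Rpower_pow by lra. split; [lra | auto].
  - rewrite Rpower_mult, Rinv_r, Rpower_1; lra. }
assert (Hu : 1 <= u <= INR X).
{ split; [lra|]. apply Rle_trans with v; [|lra]. unfold u. rewrite <- (Rpower_1 v) at 2 by lra.
  apply Rle_Rpower; lra. }
assert (Q := fsum_power be u X ltac:(lra) ltac:(lra) Hu).
assert (E : / INR m * (Rpower u (1 - be) / (1 - be)) = 
   Rpower x ((1 - be) / INR b) / (1 - be) * Rpower (INR m) (- (1 / (2 * INR b) + 1 / 2))).
{ assert (E1 : / INR m * Rpower u (1 - be) = Rpower x ((1 - be) / INR b) * Rpower (INR m) (- (1 / (2 * INR b) + 1 / 2))).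
  { replace (/ INR m) with (Rpower (INR m) (- (1))) by (rewrite Rpower_Ropp, Rpower_1; lra).
    unfold u. rewrite Rpower_mult. unfold Rpower. rewrite <- !exp_plus. f_equal.
    unfold v. rewrite ln_div by lra. unfold be. field. lra. }
  unfold Rdiv at 1. rewrite <- Rmult_assoc, E1. field. lra. }
replace (/ INR m * fsum (fun k => Rpower (INR k) (- be)) u X -
 (zetaR be * / INR m + Rpower x ((1 - be) / INR b) / (1 - be) * Rpower (INR m) (- (1 / (2 * INR b) + 1 / 2)))) with
 (/ INR m * (fsum (fun k => Rpower (INR k) (- be)) u X - (Rpower u (1 - be) / (1 - be) + zetaR be))).
2:{ rewrite <- E. ring. }
assert (Him : 0 < / INR m) by (apply Rinv_0_lt_compat; lra).
rewrite Rabs_mult, Rabs_pos_eq by lra. rewrite Rmult_comm.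
apply Rmult_le_compat_r; [lra|]. eapply Rle_trans; [exact Q|].
apply Rmult_le_compat_l; [assert (P := Rpower_pos 2 be); lra|]. apply Rpower_decr; lra.
Qed.

Lemma wsum_asymp_ge2 : (1 < b)%nat ->
  Rabs (wsum X n - (zetaR be * (ln x + euler_gamma) + INR b * zeta'R be
     - 2 / (INR b - 1) * zetaR (1 / (2 * INR b) + 1 / 2) * Rpower x (- ((INR b - 1) / (2 * INR b)))))
  <= (INR b * 2 * (4 * Rpower 2 be + 1) + 100 * (2 * Rpower 2 be + 1) * (1 + Rabs euler_gamma) + 100) * (Rpower x (- / 2) * (1 + ln x)).
Proof.
intros Hb2.
assert (Hx := one_le_x). assert (HX := x_le_X). assert (Hy := one_le_y). assert (Hyb := y_pow_b_y). assert (Hyx := y_le_x).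
assert (Hl := ln_y_nonneg). assert (Hlx := ln_x_eq).
assert (Hb1 : 2 <= INR b) by (apply (le_INR 2); lia).
assert (Hbe : 3 / 2 <= be) by (unfold be; lra).
assert (HyX : 1 <= y <= INR X) by lra.
set (s0 := 1 / (2 * INR b) + 1 / 2).
assert (Hib : 0 < / INR b <= / 2).
{ split; [apply Rinv_0_lt_compat; lra|]. apply Rinv_le_contravar; lra. }
assert (Es0 : s0 = / INR b / 2 + 1 / 2) by (unfold s0; field; lra).
assert (Hs0 : / 2 < s0 <= 3 / 4) by lra.
set (p := Rpower y (- be)). assert (Hp : 0 < p) by apply Rpower_pos.
set (q := Rpower y (1 - be)).
set (rho := Rpower x ((1 - be) / INR b)).
set (F := fsum (fun k => Rpower (INR k) (- be)) y X).
set (H := fsum (fun m => / INR m) y X).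
set (LL := fsum (fun k => Rpower (INR k) (- be) * ln (INR k)) y X).
set (G0 := fsum (fun m => Rpower (INR m) (- s0)) y X).
set (e1 := F - (q / (1 - be) + zetaR be)).
set (e2 := H - (l + euler_gamma)).
set (e3 := LL - (lnpow_prim be y + - zeta'R be)).
set (e4 := G0 - (Rpower y (1 - s0) / (1 - s0) + zetaR s0)).
assert (B1 : Rabs e1 <= (2 * Rpower 2 be + 1) * p) by (apply fsum_power; auto; lra).
assert (B2 : Rabs e2 <= 5 / y) by (now apply fsum_harmonic).
assert (B3 : Rabs e3 <= (4 * Rpower 2 be + 1) * (p * (1 + l))).
{ apply fsum_lnpow; auto; [lra|]. intros N HN. apply zeta'R_spec; auto; lra. }
assert (B4 : Rabs e4 <= (2 * Rpower 2 s0 + 1) * Rpower y (- s0)) by (apply fsum_power; auto; lra).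
assert (HS1 := hyperbola_small_k). fold F LL p in HS1.
assert (HS2 := hyperbola_small_m Hb2). fold s0 H G0 rho p in HS2.
rewrite (hyperbola X n y) by (auto; lra). fold x F H.
set (S1 := fsum _ y X) in HS1 |- *. 
match type of HS2 with Rabs (?s - _) <= _ => set (S2 := s) in HS2 |- * end.
set (E1 := S1 - ((ln x + euler_gamma) * F - INR b * LL)) in HS1.
set (E2 := S2 - (zetaR be * H + rho / (1 - be) * G0)) in HS2.
assert (Eq : rho * Rpower y (1 - s0) = q).
{ unfold rho, q. rewrite Rpower_x_eq, <- Rpower_plus. f_equal. unfold s0, be. field. lra. }
assert (Eq2 : rho * Rpower y (- s0) = p).
{ replace (- s0) with (1 - s0 + - (1)) by ring. rewrite Rpower_plus, <- Rmult_assoc, Eq.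
  unfold q, p. rewrite <- Rpower_plus. f_equal. ring. }
assert (Eq3 : q * / y = p).
{ unfold q, p. rewrite <- (Rpower_1 y) at 2 by lra. rewrite <- Rpower_Ropp, <- Rpower_plus. f_equal. ring. }
assert (Erho : Rpower x (- ((INR b - 1) / (2 * INR b))) = rho).
{ unfold rho. f_equal. unfold be. field. lra. }
assert (Elp : lnpow_prim be y = - (q * (l / (be - 1) + / (be - 1) ^ 2))).
{ unfold lnpow_prim. destruct (Req_EM_T be 1); [lra | reflexivity]. }
rewrite Erho.
assert (Hq0 : 0 < q) by apply Rpower_pos. assert (Hrho : 0 < rho) by apply Rpower_pos.
(* With every sum written as main term plus error, the cut [y] drops out of the main terms. The key
   relation is [rho y^(1-s0) = q], which matches the tail of the sum over [m] with that of the sum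
   over [k]. *)
assert (Main : S1 + S2 - F * H - (zetaR be * (ln x + euler_gamma) + INR b * zeta'R be - 2 / (INR b - 1) * zetaR s0 * rho)
  = E1 + E2 + INR b * l * e1 - INR b * e3 + q * e2 / (be - 1) - rho * e4 / (be - 1) - e1 * e2).
{ replace S1 with (E1 + ((ln x + euler_gamma) * F - INR b * LL)) by (unfold E1; ring).
  replace S2 with (E2 + (zetaR be * H + rho / (1 - be) * G0)) by (unfold E2; ring).
  replace F with (e1 + (q / (1 - be) + zetaR be)) by (unfold e1; ring).
  replace H with (e2 + (l + euler_gamma)) by (unfold e2; ring).
  replace LL with (e3 + (lnpow_prim be y + - zeta'R be)) by (unfold e3; ring).
  replace G0 with (e4 + (Rpower y (1 - s0) / (1 - s0) + zetaR s0)) by (unfold e4; ring).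
  rewrite Elp, Hlx, <- Eq.
  replace (be - 1) with ((INR b - 1) / 2) by (unfold be; field).
  replace (1 - be) with (- ((INR b - 1) / 2)) by (unfold be; field).
  replace (1 - s0) with ((INR b - 1) / (2 * INR b)) by (unfold s0; field; lra).
  field. lra. }
rewrite Main. clear Main.
assert (Hiy : 0 < / y <= 1).
{ split; [apply Rinv_0_lt_compat; lra|]. rewrite <- Rinv_1. apply Rinv_le_contravar; lra. }
set (c1 := 2 * Rpower 2 be + 1) in *. set (c3 := 4 * Rpower 2 be + 1) in *.
assert (Hc1 : 1 <= c1) by (unfold c1; assert (P := Rpower_pos 2 be); lra).
assert (Hc3 : 1 <= c3) by (unfold c3; assert (P := Rpower_pos 2 be); lra).
assert (K2 : 0 < / (be - 1) <= 2).
{ split; [apply Rinv_0_lt_compat; lra|]. replace 2 with (/ / 2) by field. apply Rinv_le_contravar; lra. }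
assert (K4 : 2 * Rpower 2 s0 + 1 <= 5).
{ assert (Rpower 2 s0 <= Rpower 2 1) by (apply Rle_Rpower; lra). rewrite Rpower_1 in H0; lra. }
assert (HH : Rabs H <= l + Rabs euler_gamma + 5).
{ replace H with ((l + euler_gamma) + e2) by (unfold e2; ring).
  eapply Rle_trans; [apply Rabs_triang|].
  assert (Rabs (l + euler_gamma) <= l + Rabs euler_gamma).
  { eapply Rle_trans; [apply Rabs_triang|]. rewrite (Rabs_pos_eq l); lra. }
  unfold Rdiv in B2. lra. }
assert (G := Rabs_pos euler_gamma).
assert (T2 : Rabs E2 <= c1 * p * (l + Rabs euler_gamma + 5)).
{ eapply Rle_trans; [exact HS2|]. apply Rmult_le_compat_l; [nra|]. eapply Rle_trans; [apply Rle_abs | exact HH]. }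
assert (T3 : Rabs (INR b * l * e1) <= INR b * l * (c1 * p)).
{ rewrite !Rabs_mult, (Rabs_pos_eq (INR b)), (Rabs_pos_eq l) by lra. apply Rmult_le_compat_l; nra. }
assert (T4 : Rabs (INR b * e3) <= INR b * (c3 * (p * (1 + l)))).
{ rewrite !Rabs_mult, (Rabs_pos_eq (INR b)) by lra. apply Rmult_le_compat_l; lra. }
assert (T5 : Rabs (q * e2 / (be - 1)) <= 10 * p).
{ unfold Rdiv. rewrite !Rabs_mult, (Rabs_pos_eq q), (Rabs_pos_eq (/ (be - 1))) by lra.
  apply Rle_trans with (q * (5 / y) * 2).
  - apply Rmult_le_compat; try lra; [apply Rmult_le_pos; [lra | apply Rabs_pos]|]. apply Rmult_le_compat_l; lra.
  - rewrite <- Eq3. right. field. lra. }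
assert (T6 : Rabs (rho * e4 / (be - 1)) <= 10 * p).
{ unfold Rdiv. rewrite !Rabs_mult, (Rabs_pos_eq rho), (Rabs_pos_eq (/ (be - 1))) by lra.
  apply Rle_trans with (rho * (5 * Rpower y (- s0)) * 2).
  - apply Rmult_le_compat; try lra; [apply Rmult_le_pos; [lra | apply Rabs_pos]|]. apply Rmult_le_compat_l; [lra|].
    eapply Rle_trans; [exact B4|]. apply Rmult_le_compat_r; [left; apply Rpower_pos | lra].
  - rewrite <- Eq2. right. ring. }
assert (T7 : Rabs (e1 * e2) <= c1 * p * 5).
{ rewrite Rabs_mult. apply Rmult_le_compat; auto using Rabs_pos. unfold Rdiv in B2. lra. }
rewrite <- Rpower_y_be. fold p.
assert (Tot : Rabs (E1 + E2 + INR b * l * e1 - INR b * e3 + q * e2 / (be - 1) - rho * e4 / (be - 1) - e1 * e2)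
  <= 5 * p + c1 * p * (l + Rabs euler_gamma + 5) + INR b * l * (c1 * p) + INR b * (c3 * (p * (1 + l))) + 10 * p + 10 * p + c1 * p * 5).
{ unfold Rminus.
  repeat (eapply Rle_trans; [apply Rabs_triang|]; apply Rplus_le_compat; [|rewrite ?Rabs_Ropp; assumption]).
  exact HS1. }
eapply Rle_trans; [exact Tot|].
rewrite Hlx.
assert (Q1 : 1 + l <= 1 + (INR b + 1) * l) by nra.
assert (Q2 : c1 * p * (l + Rabs euler_gamma + 5) <= p * (1 + (INR b + 1) * l) * (c1 * (5 * (1 + Rabs euler_gamma)))).
{ replace (c1 * p * (l + Rabs euler_gamma + 5)) with (p * (l + Rabs euler_gamma + 5) * c1) by ring.
  replace (p * (1 + (INR b + 1) * l) * (c1 * (5 * (1 + Rabs euler_gamma)))) with 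
    (p * ((1 + (INR b + 1) * l) * (5 * (1 + Rabs euler_gamma))) * c1) by ring.
  apply Rmult_le_compat_r; [lra|]. apply Rmult_le_compat_l; [lra|].
  nra. }
assert (Q3 : INR b * l * (c1 * p) <= p * (1 + (INR b + 1) * l) * c1).
{ replace (INR b * l * (c1 * p)) with ((p * (INR b * l)) * c1) by ring.
  apply Rmult_le_compat_r; [lra|]. apply Rmult_le_compat_l; nra. }
assert (Q4 : INR b * (c3 * (p * (1 + l))) <= p * (1 + (INR b + 1) * l) * (INR b * c3)).
{ replace (INR b * (c3 * (p * (1 + l)))) with ((p * (1 + l)) * (INR b * c3)) by ring.
  apply Rmult_le_compat_r; [nra|]. apply Rmult_le_compat_l; lra. }
assert (Q5 : p <= p * (1 + (INR b + 1) * l)) by nra.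
set (w := p * (1 + (INR b + 1) * l)) in *.
assert (Q6 : c1 * p * 5 <= w * (c1 * 5)) by nra.
assert (Q7 : 0 <= w * c1 * Rabs euler_gamma) by (apply Rmult_le_pos; nra).
assert (Q8 : 0 <= w * c1) by nra. assert (Q9 : 0 <= w * (INR b * c3)) by (apply Rmult_le_pos; nra).
lra.
Qed.
End Hyperbola.

(** For [b = 1] the roles of [k] and [m] are symmetric, so the two one-sided sums coincide and the
    estimate for small [k] serves twice. With [log x = 2 log y] the main terms collapse to the
    stated quadratic in [log x]. *)
Lemma wsum_asymp_1 X n : (1 <= n)%nat -> (n <= X)%nat ->
  Rabs (wsum 1 X n - ((ln (INR n)) ^ 2 / 2 + 2 * euler_gamma * ln (INR n) + (euler_gamma ^ 2 + 2 * gamma1)))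
  <= 100 * (Rpower (INR n) (- / 2) * (1 + ln (INR n))).
Proof.
intros Hn HnX.
set (x := INR n). set (y := Rpower x (/ (INR 1 + 1))). set (l := ln y).
assert (HX : x <= INR X) by (apply le_INR; auto).
assert (Hy : 1 <= y) by (exact (one_le_y 1 (le_n 1) n Hn)).
assert (Hyb : y ^ 1 * y = x) by (exact (y_pow_b_y 1 (le_n 1) n Hn)).
assert (Hyx : y <= x) by (exact (y_le_x 1 (le_n 1) n Hn)).
assert (Hl : 0 <= l) by (exact (ln_y_nonneg 1 (le_n 1) n Hn)).
assert (Hlx : ln x = (INR 1 + 1) * l) by (exact (ln_x_eq 1 (le_n 1) n)).
assert (HS1 := hyperbola_small_k 1 (le_n 1) X n Hn HnX).
assert (Hyh : Rpower y (- ((INR 1 + 1) / 2)) = Rpower x (- / 2)) by (exact (Rpower_y_be 1 (le_n 1) n)).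
fold x in HS1. fold y in HS1. rewrite Hyh in HS1.
rewrite (hyperbola 1 (le_n 1) X n y) by (auto; lra). fold x.
simpl (INR 1) in *. replace ((1 + 1) / 2) with 1 in * by field.
assert (Einv : forall k, (1 <= k)%nat -> Rpower (INR k) (- (1)) = / INR k).
{ intros k Hk. rewrite Rpower_Ropp, Rpower_1; auto. apply lt_0_INR; lia. }
assert (EF : forall u, fsum (fun k => Rpower (INR k) (- (1))) u X = fsum (fun m => / INR m) u X).
{ intros u. apply fsum_ext. intros k Hk _. apply Einv; lia. }
rewrite EF in *.
assert (ES : fsum (fun m => / INR m * fsum (fun k => Rpower (INR k) (- (1))) (Rpower (x / INR m) (/ 1)) X) y X =
   fsum (fun k => Rpower (INR k) (- (1)) * fsum (fun m => / INR m) (x / INR k ^ 1) X) y X).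
{ apply fsum_ext. intros m Hm _. rewrite EF, Einv by lia.
  assert (0 < INR m) by (apply lt_0_INR; lia).
  rewrite Rinv_1, Rpower_1 by (apply Rdiv_lt_0_compat; lra). now rewrite pow_1. }
rewrite ES. clear ES.
set (S1 := fsum (fun k => Rpower (INR k) (- (1)) * fsum (fun m => / INR m) (x / INR k ^ 1) X) y X) in *.
set (H := fsum (fun m => / INR m) y X) in *.
set (LL := fsum (fun k => Rpower (INR k) (- (1)) * ln (INR k)) y X) in *.
set (p := Rpower x (- / 2)) in *.
assert (Ep : p = / y).
{ rewrite <- Hyh. rewrite Rpower_Ropp, Rpower_1; lra. }
set (e2 := H - (l + euler_gamma)).
set (e3 := LL - (lnpow_prim 1 y + - gamma1)).
assert (B2 : Rabs e2 <= 5 / y) by (apply fsum_harmonic; lra).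
assert (B3 : Rabs e3 <= (4 * Rpower 2 1 + 1) * (Rpower y (- (1)) * (1 + l))).
{ apply fsum_lnpow; [lra | lra |]. intros N HN. now apply gamma1_spec. }
rewrite Rpower_1, (Rpower_Ropp y 1), Rpower_1 in B3 by lra.
set (E := S1 - ((ln x + euler_gamma) * H - 1 * LL)) in HS1.
assert (Main : S1 + S1 - H * H - (ln x ^ 2 / 2 + 2 * euler_gamma * ln x + (euler_gamma ^ 2 + 2 * gamma1)) =
   2 * E + 2 * l * e2 - 2 * e3 - e2 * e2).
{ replace S1 with (E + ((ln x + euler_gamma) * H - 1 * LL)) by (unfold E; ring).
  replace H with (e2 + (l + euler_gamma)) by (unfold e2; ring).
  replace LL with (e3 + (lnpow_prim 1 y + - gamma1)) by (unfold e3; ring).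
  unfold lnpow_prim. destruct (Req_EM_T 1 1) as [_|]; [|lra]. fold l. rewrite Hlx. field. }
rewrite Main. clear Main.
rewrite <- Ep in B3. replace (5 / y) with (5 * p) in B2 by (rewrite Ep; reflexivity).
assert (Hp : 0 < p <= 1).
{ rewrite Ep. split; [apply Rinv_0_lt_compat; lra|]. rewrite <- Rinv_1. apply Rinv_le_contravar; lra. }
rewrite Hlx.
apply Rabs_le_between in HS1. apply Rabs_le_between in B2. apply Rabs_le_between in B3.
assert (D : - (25 * p) <= - (e2 * e2) <= 0) by nra.
assert (D2 : - (l * (5 * p)) <= l * e2 <= l * (5 * p)) by nra.
apply Rabs_le. lra.
Qed.

(** * Riesz means and the theorem *)

(** Each pair [(k, m)] is met by exactly one [n], namely [k^b m], so [wsum] is the summatory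
    function of the diagonal coefficients. *)
Lemma sum_diag_weight b X N : (1 <= b)%nat ->
  rsum (fun n => rsum (fun k => rsum (fun m => diag_weight b n k m) X) X) N = wsum b X N.
Proof.
intros Hb. rewrite rsum_swap. unfold wsum. apply rsum_ext. intros k Hk.
rewrite rsum_swap. apply rsum_ext. intros m Hm.
assert (Hr : (1 <= k ^ b * m)%nat).
{ assert (k ^ b <> 0)%nat by (apply Nat.pow_nonzero; lia). nia. }
unfold diag_weight. set (r := (k ^ b * m)%nat) in *. set (v := Rpower _ _ * _).
induction N as [|N IH]; cbn [rsum].
- destruct (le_dec r 0); [lia | auto].
- rewrite IH. destruct (le_dec r N), (Nat.eq_dec r (S N)), (le_dec r (S N)); try lia; ring.
Qed.

Section Assembly.
(** Both cases of the theorem go through this argument: [P] is the main term of [wsum], and [Q] an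
    antiderivative of [P] at [(t/2 pi)^theta], so [Q T] is the main term of the moment. The additive
    constant in [Q] is absorbed by the error. *)
Variables (theta : R) (b : nat) (P P' Q : R -> R) (Ca Da : R).
Hypothesis Hth : 0 < theta <= / 2.
Hypothesis Hb : (1 <= b)%nat.
Hypothesis HP : forall x, 1 <= x -> is_derive P x (P' x).
Hypothesis HP' : forall x, 1 <= x -> Rabs (P' x) <= Da * ((1 + ln x) * / x).
Hypothesis HQ : forall t, 0 < t -> is_derive Q t (P (Rpower (t / (2 * PI)) theta)).
Hypothesis HA : forall X n, (1 <= n)%nat -> (n <= X)%nat ->
  Rabs (wsum b X n - P (INR n)) <= Ca * (Rpower (INR n) (- / 2) * (1 + ln (INR n))).

(** Both error bounds are read at the point 1, where their weights equal 1. *)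
Lemma coef_nonneg : 0 <= Ca /\ 0 <= Da.
Proof.
assert (H1 := HA 1 1 (le_n _) (le_n _)). assert (H2 := HP' 1 (Rle_refl _)).
simpl INR in H1. rewrite ln_1 in *. rewrite Rinv_1 in H2.
unfold Rpower in H1. rewrite ln_1, Rmult_0_r, exp_0 in H1.
assert (A := Rabs_pos (P' 1)). assert (B := Rabs_pos (wsum b 1 1 - P 1)). lra.
Qed.

(** Between [n] and [n + 1] the main term [P] moves by at most [2 Da (1 + log x) / x], which is
    below the error already present; the factors 2 come from [x <= 2 n]. *)
Lemma wsum_real X n x : (1 <= n)%nat -> (n <= X)%nat -> INR n <= x <= INR n + 1 ->
  Rabs (wsum b X n - P x) <= 2 * (Ca + Da) * (Rpower x (- / 2) * (1 + ln x)).
Proof.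
intros Hn HnX Hx. destruct coef_nonneg as [Hc Hd].
assert (Hn1 : 1 <= INR n) by (apply (le_INR 1); lia).
assert (Ln := ln_nonneg _ Hn1).
assert (L2 : ln (INR n) <= ln x) by (apply ln_le; lra).
assert (Px := Rpower_pos x (- / 2)).
assert (B1 : Rabs (wsum b X n - P (INR n)) <= 2 * Ca * (Rpower x (- / 2) * (1 + ln x))).
{ eapply Rle_trans; [apply HA; auto|].
  assert (R1 := Rpower_floor_bound (/ 2) x n ltac:(lra) ltac:(lra) ltac:(lra)).
  assert (R2 : Rpower 2 (/ 2) <= 2) by (apply Rpower_le_self; lra).
  rewrite (Rmult_comm 2 Ca), Rmult_assoc. apply Rmult_le_compat_l; auto.
  rewrite <- Rmult_assoc. apply Rmult_le_compat; try lra; [left; apply Rpower_pos|].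
  eapply Rle_trans; [exact R1|]. apply Rmult_le_compat_r; lra. }
assert (B2 : Rabs (P x - P (INR n)) <= 2 * Da * (Rpower x (- / 2) * (1 + ln x))).
{ set (M := 2 * Da * (Rpower x (- / 2) * (1 + ln x))).
  assert (HM : 0 <= M) by (unfold M; apply Rmult_le_pos; [lra | nra]).
  apply Rle_trans with (M * x - M * INR n); [|nra].
  apply (Rabs_incr_le P P' (fun y => M * y) (fun _ => M)); try lra.
  - intros y Hy. apply HP; lra.
  - intros. auto_derive; auto; ring.
  - intros y Hy. eapply Rle_trans; [apply HP'; lra|]. unfold M.
    rewrite (Rmult_comm 2 Da), Rmult_assoc. apply Rmult_le_compat_l; auto.
    assert (I1 : / y <= 2 * / x).
    { replace (2 * / x) with (/ (x / 2)) by (field; lra). apply Rinv_le_contravar; lra. }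
    assert (I2 : / x <= Rpower x (- / 2)).
    { apply Rpower_ge_inv; lra. }
    assert (ln y <= ln x) by (apply ln_le; lra).
    assert (0 <= ln y) by (apply ln_nonneg; lra).
    assert (0 < / y) by (apply Rinv_0_lt_compat; lra).
    replace (2 * (Rpower x (- / 2) * (1 + ln x))) with ((1 + ln x) * (2 * Rpower x (- / 2))) by ring.
    apply Rmult_le_compat; lra. }
replace (wsum b X n - P x) with ((wsum b X n - P (INR n)) + - (P x - P (INR n))) by ring.
eapply Rle_trans; [apply Rabs_triang|]. rewrite Rabs_Ropp. lra.
Qed.

(* The derivative of the Riesz mean [sum_(n <= j) a_n (t - T_n)] is the partial sum of the [a_n], which is
   [P ((t / 2 pi)^theta)] up to a small error for [t] between [T_j] and [T_(j+1)]. *)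
Lemma riesz_aux X T j : (1 <= j)%nat -> (j <= X)%nat -> 1 <= T -> 
  forall t, Tstart theta j <= t <= Tstart theta (S j) -> t <= T ->
  Rabs (rsum (fun n => (wsum b X n - wsum b X (n - 1)) * (t - Tstart theta n)) j - (Q t - Q (Tstart theta 1)))
  <= 32 * (Ca + Da) * (1 + ln T) * (Rpower t (1 - theta / 2) - Rpower (Tstart theta 1) (1 - theta / 2)).
Proof.
intros Hj HjX HT.
destruct coef_nonneg as [Hc Hd]. assert (HPI := PI2_3_2). assert (HPI4 := PI_4).
set (a := fun n => wsum b X n - wsum b X (n - 1)).
set (S_ := fun j t => rsum (fun n => a n * (t - Tstart theta n)) j).
(* [32 = 2 * 8 * 2]: from [wsum_real], from [(2 pi)^(theta/2) <= 8], and from [1 - theta/2 >= 1/2],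
   the factor that appears when [t^(1 - theta/2)] is differentiated. *)
set (K := 32 * (Ca + Da) * (1 + ln T)).
assert (Ha : forall j, rsum a j = wsum b X j).
{ assert (H0 : wsum b X 0 = 0).
  { rewrite <- sum_diag_weight by auto. reflexivity. }
  induction j0 as [|i IH]; [now rewrite H0|]. cbn [rsum]. rewrite IH. unfold a.
  replace (S i - 1)%nat with i by lia. ring. }
assert (HS : forall j t, is_derive (S_ j) t (wsum b X j)).
{ intros i t. rewrite <- Ha. unfold S_. apply (is_derive_rsum (fun n t => a n * (t - Tstart theta n))).
  intros. auto_derive; auto; ring. }
assert (step : forall i t, (1 <= i)%nat -> (i <= X)%nat -> Tstart theta i <= t <= Tstart theta (S i) -> t <= T ->
  Rabs ((S_ i t - Q t) - (S_ i (Tstart theta i) - Q (Tstart theta i))) <=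
  K * Rpower t (1 - theta / 2) - K * Rpower (Tstart theta i) (1 - theta / 2)).
{ intros i t Hi HiX Ht HtT.
  assert (Hi1 : 1 <= INR i) by (apply (le_INR 1); lia).
  apply (Rabs_incr_le (fun t => S_ i t - Q t) (fun t => wsum b X i - P (Rpower (t / (2 * PI)) theta))
   (fun t => K * Rpower t (1 - theta / 2)) (fun t => K * ((1 - theta / 2) * Rpower t (1 - theta / 2 - 1)))); try lra.
  - intros s Hs. assert (Hp := Tstart_pos theta i). apply derR_minus; [apply HS | apply HQ; lra].
  - intros s Hs. assert (Hp := Tstart_pos theta i). apply derR_scal, is_derive_Rpower. lra.
  - intros s Hs. assert (Hp := Tstart_pos theta i).
    set (x := Rpower (s / (2 * PI)) theta).
    assert (Hinv : forall n, (1 <= n)%nat -> Rpower (Tstart theta n / (2 * PI)) theta = INR n).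
    { intros n Hn. unfold Tstart. replace (2 * PI * Rpower (INR n) (/ theta) / (2 * PI)) with (Rpower (INR n) (/ theta)) by (field; lra).
      rewrite Rpower_mult, Rinv_l, Rpower_1; try lra. apply lt_0_INR; lia. }
    assert (Hx : INR i <= x <= INR i + 1).
    { rewrite <- S_INR, <- (Hinv i), <- (Hinv (S i)) by lia. unfold x. split; apply Rle_Rpower_l; try lra; split.
      - apply Rdiv_lt_0_compat; lra.
      - apply Rmult_le_compat_r; [left; apply Rinv_0_lt_compat; lra | lra].
      - apply Rdiv_lt_0_compat; lra.
      - apply Rmult_le_compat_r; [left; apply Rinv_0_lt_compat; lra | lra]. }
    eapply Rle_trans; [apply wsum_real; eauto|].
    assert (Ts6 : 6 <= Tstart theta i).
    { unfold Tstart. assert (1 <= Rpower (INR i) (/ theta)).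
      { apply Rpower_ge_1; [lra|]. left; apply Rinv_0_lt_compat; lra. }
      nra. }
    assert (Ex : Rpower x (- / 2) <= 8 * Rpower s (- (theta / 2))).
    { unfold x. rewrite Rpower_mult. replace (theta * - / 2) with (- (theta / 2)) by field.
      unfold Rdiv at 1. rewrite <- Rpower_mult_distr by (try apply Rinv_0_lt_compat; lra).
      rewrite Rmult_comm. apply Rmult_le_compat_r; [left; apply Rpower_pos|].
      apply Rle_trans with (2 * PI); [|lra].
      replace (Rpower (/ (2 * PI)) (- (theta / 2))) with (Rpower (2 * PI) (theta / 2)).
      - apply Rpower_le_self; lra.
      - unfold Rpower. rewrite ln_Rinv by lra. f_equal. ring. }
    assert (Lx : ln x <= ln T).
    { unfold x. rewrite ln_Rpower. assert (0 <= ln (s / (2 * PI))).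
      { apply ln_nonneg. apply Rle_div_r; [lra|].
        assert (W : Tstart theta 1 <= Tstart theta i).
        { unfold Tstart. apply Rmult_le_compat_l; [lra|]. apply Rle_Rpower_l; [left; apply Rinv_0_lt_compat; lra | simpl; lra]. }
        assert (E1 : Tstart theta 1 = 2 * PI).
        { unfold Tstart, Rpower. simpl. rewrite ln_1, Rmult_0_r, exp_0. ring. }
        lra. }
      assert (ln (s / (2 * PI)) <= ln T).
      { apply ln_le; [apply Rdiv_lt_0_compat; lra|]. apply Rle_div_l; [lra|]. nra. }
      nra. }
    assert (Lx0 := ln_nonneg x ltac:(lra)).
    replace (1 - theta / 2 - 1) with (- (theta / 2)) by ring.
    assert (Gx := Rpower_pos x (- / 2)).
    assert (M1 : Rpower x (- / 2) * (1 + ln x) <= 8 * Rpower s (- (theta / 2)) * (1 + ln T)) by (apply Rmult_le_compat; lra).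
    apply Rle_trans with (2 * (Ca + Da) * (8 * Rpower s (- (theta / 2)) * (1 + ln T))).
    { apply Rmult_le_compat_l; lra. }
    unfold K.
    replace (2 * (Ca + Da) * (8 * Rpower s (- (theta / 2)) * (1 + ln T))) with
      (16 * ((Ca + Da) * (1 + ln T) * Rpower s (- (theta / 2)))) by ring.
    replace (32 * (Ca + Da) * (1 + ln T) * ((1 - theta / 2) * Rpower s (- (theta / 2)))) with
      (32 * (1 - theta / 2) * ((Ca + Da) * (1 + ln T) * Rpower s (- (theta / 2)))) by ring.
    apply Rmult_le_compat_r; [|lra]. apply Rmult_le_pos; [apply Rmult_le_pos; lra | lra]. }
change (forall t, Tstart theta j <= t <= Tstart theta (S j) -> t <= T ->
  Rabs (S_ j t - (Q t - Q (Tstart theta 1))) <= K * (Rpower t (1 - theta / 2) - Rpower (Tstart theta 1) (1 - theta / 2))).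
(* A new term vanishes at its own entrance time, so the Riesz mean is continuous there and
   consecutive intervals can be joined. *)
assert (Hlast : forall i, S_ (S i) (Tstart theta (S i)) = S_ i (Tstart theta (S i))).
{ intros i. unfold S_. cbn [rsum]. ring. }
induction Hj as [|j Hj IH]; intros t Ht HtT.
- assert (E := step 1%nat t (le_n _) HjX Ht HtT).
  assert (E0 : S_ 1%nat (Tstart theta 1) = 0) by (rewrite Hlast; reflexivity).
  rewrite E0 in E.
  replace (S_ 1%nat t - (Q t - Q (Tstart theta 1))) with ((S_ 1%nat t - Q t) - (0 - Q (Tstart theta 1))) by ring.
  lra.
- assert (E := step (S j) t ltac:(lia) HjX Ht HtT).
  assert (Hmono : Tstart theta j <= Tstart theta (S j)).
  { unfold Tstart. apply Rmult_le_compat_l; [lra|]. apply Rle_Rpower_l; [left; apply Rinv_0_lt_compat; lra|].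
    split; [apply lt_0_INR; lia | apply le_INR; lia]. }
  assert (I := IH ltac:(lia) (Tstart theta (S j)) ltac:(lra) ltac:(lra)).
  rewrite Hlast in E.
  replace (S_ (S j) t - (Q t - Q (Tstart theta 1))) with
   ((S_ (S j) t - Q t - (S_ j (Tstart theta (S j)) - Q (Tstart theta (S j)))) +
    (S_ j (Tstart theta (S j)) - (Q (Tstart theta (S j)) - Q (Tstart theta 1)))) by ring.
  eapply Rle_trans; [apply Rabs_triang|]. lra.
Qed.

Lemma M1b1_asymp : exists K, forall T, 8 <= T ->
  Cmod (M1b1 theta (INR b) T - RtoC (Q T))%C <= K * (Rpower T (1 - theta / 2) * (ln T) ^ 2).
Proof.
destruct coef_nonneg as [Hc Hd]. assert (HPI := PI2_3_2). assert (HPI4 := PI_4).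
set (C1 := 80000 * INR b * (1 + ln (INR b))).
assert (Hb1 : 1 <= INR b) by (apply (le_INR 1); lia).
assert (Hlnb := ln_nonneg _ Hb1).
assert (HC1 : 0 <= C1) by (unfold C1; nra).
exists (2 + 2 * C1 + 180 + 64 * (Ca + Da) + Rabs (Q (Tstart theta 1))).
intros T HT.
assert (LT := ln_t_ge_1 T ltac:(lra)).
set (N := Dlen theta T).
assert (HN : (1 <= N)%nat).
{ apply Dlen_spec; try lra; try lia. unfold Tstart, Rpower. simpl. rewrite ln_1, Rmult_0_r, exp_0. lra. }
assert (HN1 : 1 <= INR N) by (apply (le_INR 1); lia).
set (w := Rpower T (1 - theta / 2)).
assert (Hw : 1 <= w).
{ apply Rpower_ge_1; lra. }
destruct (M1b1_reduce theta T b Hth HT Hb) as [X [HX1 [HNX HM]]].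
fold N in HNX, HM. fold C1 in HM.
assert (HNT : INR N <= Rpower T theta).
{ assert (H : Tstart theta N <= T) by (apply (Dlen_spec theta T N); auto; lra).
  assert (Hq : Rpower (INR N) (/ theta) <= T).
  { unfold Tstart in H. nra. }
  replace (INR N) with (Rpower (Rpower (INR N) (/ theta)) theta).
  - apply Rle_Rpower_l; [lra|]. split; [apply Rpower_pos | auto].
  - rewrite Rpower_mult, Rinv_l, Rpower_1; lra. }
assert (Hlog3 : ln T <= ln T ^ 2) by (simpl; nra).
assert (E1 : Rpower (INR N) (/ 2) * sqrt T <= w).
{ rewrite <- (Rpower_sqrt T) by lra.
  apply Rle_trans with (Rpower (Rpower T theta) (/ 2) * Rpower T (/ 2)).
  - apply Rmult_le_compat_r; [left; apply Rpower_pos|]. apply Rle_Rpower_l; lra.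
  - rewrite Rpower_mult, <- Rpower_plus. apply Rle_Rpower; lra. }
(* [3 theta / 2 <= 1 - theta / 2] is again exactly [theta <= 1/2]: the off-diagonal error reaches
   the admissible size at the same threshold as the horizontal sides. *)
assert (E2 : Rpower (INR N) (3 / 2) <= w).
{ apply Rle_trans with (Rpower (Rpower T theta) (3 / 2)); [apply Rle_Rpower_l; lra|].
  rewrite Rpower_mult. apply Rle_Rpower; lra. }
assert (E3 : ln (INR N) <= ln T).
{ apply Rle_trans with (ln (Rpower T theta)); [apply ln_le; lra|]. rewrite ln_Rpower. nra. }
assert (E3' := ln_nonneg _ HN1).
assert (B : 2 + 2 * Rpower (INR N) (/ 2) * (C1 * (sqrt T * ln T ^ 2)) + 36 * (Rpower (INR N) (3 / 2) * (3 + 2 * ln (INR N)))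
  <= (2 + 2 * C1 + 180) * (w * ln T ^ 2)).
{ assert (A1 : 2 * Rpower (INR N) (/ 2) * (C1 * (sqrt T * ln T ^ 2)) <= 2 * C1 * (w * ln T ^ 2)).
  { replace (2 * Rpower (INR N) (/ 2) * (C1 * (sqrt T * ln T ^ 2))) with
     (2 * C1 * ((Rpower (INR N) (/ 2) * sqrt T) * ln T ^ 2)) by ring.
    apply Rmult_le_compat_l; [lra|]. apply Rmult_le_compat_r; lra. }
  assert (A2 : Rpower (INR N) (3 / 2) * (3 + 2 * ln (INR N)) <= w * (5 * ln T ^ 2)).
  { apply Rmult_le_compat; try lra. left; apply Rpower_pos. }
  assert (A3 : 1 <= w * ln T ^ 2) by nra. lra. }
(* The increments of [wsum] are the diagonal coefficients, so the triple sum becomes a Riesz mean in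
   [n] alone. *)
assert (Ediag : rsum (fun n => rsum (fun k => rsum (fun m => (diag_weight b n k m * (T - Tstart theta n))%R) X) X) N =
  rsum (fun n => (wsum b X n - wsum b X (n - 1)) * (T - Tstart theta n)) N).
{ apply rsum_ext. intros n Hn.
  replace (wsum b X n - wsum b X (n - 1)) with (rsum (fun k => rsum (fun m => diag_weight b n k m) X) X).
  - rewrite Rmult_comm, <- rsum_scal. apply rsum_ext. intros k _. rewrite <- rsum_scal.
    apply rsum_ext. intros m _. ring.
  - rewrite <- !sum_diag_weight by auto. destruct n as [|n]; [lia|].
    replace (S n - 1)%nat with n by lia. cbn [rsum]. ring. }
rewrite Ediag in HM. clear Ediag.
assert (HR := riesz_aux X T N HN HNX ltac:(lra) T).
assert (HT1 : Tstart theta N <= T <= Tstart theta (S N)).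
{ split.
  - apply (Dlen_spec theta T N); auto; lra.
  - apply Rnot_lt_le. intros H. assert (H2 : (S N <= N)%nat); [|lia].
    apply Dlen_spec; try lra; lia. }
specialize (HR HT1 (Rle_refl _)). fold w in HR.
set (S0 := rsum _ N) in *.
assert (HR2 : Rabs (S0 - Q T) <= (64 * (Ca + Da) + Rabs (Q (Tstart theta 1))) * (w * ln T ^ 2)).
{ replace (S0 - Q T) with ((S0 - (Q T - Q (Tstart theta 1))) + - Q (Tstart theta 1)) by ring.
  eapply Rle_trans; [apply Rabs_triang|]. rewrite Rabs_Ropp.
  assert (A := Rpower_pos (Tstart theta 1) (1 - theta / 2)).
  assert (A3 : 1 <= w * ln T ^ 2) by nra.
  assert (A4 := Rabs_pos (Q (Tstart theta 1))).
  assert (A5 : 32 * (Ca + Da) * (1 + ln T) * (w - Rpower (Tstart theta 1) (1 - theta / 2)) <= 64 * (Ca + Da) * (w * ln T ^ 2)).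
  { apply Rle_trans with (32 * (Ca + Da) * (1 + ln T) * w).
    - apply Rmult_le_compat_l; [apply Rmult_le_pos; lra | lra].
    - replace (32 * (Ca + Da) * (1 + ln T) * w) with (32 * (Ca + Da) * ((1 + ln T) * w)) by ring.
      replace (64 * (Ca + Da) * (w * ln T ^ 2)) with (32 * (Ca + Da) * ((2 * ln T ^ 2) * w)) by ring.
      apply Rmult_le_compat_l; [lra|]. apply Rmult_le_compat_r; lra. }
  nra. }
replace (M1b1 theta (INR b) T - RtoC (Q T))%C with ((M1b1 theta (INR b) T - RtoC S0) + RtoC (S0 - Q T))%C
  by (rewrite RtoC_minus; ring).
eapply Rle_trans; [apply Cmod_triangle|]. rewrite Cmod_R. lra.
Qed.
End Assembly.

Lemma ln_scaled theta t : 0 < t -> ln (Rpower (t / (2 * PI)) theta) = theta * (ln t - ln (2 * PI)).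
Proof. intros Ht. assert (HPI := PI2_3_2). rewrite ln_Rpower, ln_div by lra. reflexivity. Qed.

Theorem theorem1p4 (theta : R) (Htheta : 0 < theta <= 1 / 2) :
  (forall b : nat, (1 < b)%nat ->
     exists K T0 : R, forall T : R, T0 <= T ->
       Cmod (Cminus (M1b1 theta (INR b) T)
               (RtoC (T * K_b theta (INR b) (ln T)
                      - C_1b1 theta (INR b)
                        * Rpower T (1 - theta * (1 / 2 - 1 / (2 * INR b))))))
       <= K * (Rpower T (1 - theta / 2) * (ln T) ^ 2))
  /\
  (exists K T0 : R, forall T : R, T0 <= T ->
     Cmod (Cminus (M1b1 theta 1 T)
             (RtoC (theta ^ 2 / 2 * T * (ln T) ^ 2 + c1_theta theta * T * ln T + c0_theta theta * T)))
     <= K * (Rpower T (1 - theta / 2) * (ln T) ^ 2)).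
Proof.
assert (HPI := PI2_3_2). assert (Hth : 0 < theta <= / 2) by lra.
split.
- intros b Hb. assert (Hb2 : 2 <= INR b) by (apply (le_INR 2); lia).
  (* [ka x^(-de)], with [de = 1/2 - 1/(2b)], is the secondary term of the summatory function
     [wsum]. *)
  set (be := (INR b + 1) / 2). set (Z0 := zetaR (1 / (2 * INR b) + 1 / 2)).
  set (de := (INR b - 1) / (2 * INR b)). set (ka := 2 / (INR b - 1) * Z0).
  assert (Hde : 0 < de <= / 2).
  { unfold de. split; [apply Rdiv_lt_0_compat; lra|]. apply Rle_div_l; lra. }
  assert (Htd : 0 < 1 - theta * de) by nra.
  assert (Ede : 1 / 2 - 1 / (2 * INR b) = de) by (unfold de; field; lra).
  destruct (M1b1_asymp theta b
    (fun x => zetaR be * (ln x + euler_gamma) + INR b * zeta'R be - ka * Rpower x (- de))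
    (fun x => zetaR be * / x - ka * (- de * Rpower x (- de - 1)))
    (fun t => zetaR be * (theta * (t * (ln t - ln (2 * PI) - 1)) + euler_gamma * t) + INR b * zeta'R be * t
        - ka * Rpower (2 * PI) (theta * de) / (1 - theta * de) * Rpower t (1 - theta * de))
    (INR b * 2 * (4 * Rpower 2 be + 1) + 100 * (2 * Rpower 2 be + 1) * (1 + Rabs euler_gamma) + 100)
    (Rabs (zetaR be) + Rabs (ka * de))) as [K HK]; auto; try lia.
  + intros x Hx. apply derR_minus.
    * auto_derive; [lra | field; lra].
    * apply derR_scal, is_derive_Rpower. lra.
  + intros x Hx.
    assert (L := ln_nonneg x Hx).
    assert (R1 : Rpower x (- de - 1) <= / x).
    { apply Rpower_le_inv; lra. }
    assert (R0 := Rpower_pos x (- de - 1)).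
    replace (zetaR be * / x - ka * (- de * Rpower x (- de - 1))) with (zetaR be * / x + (ka * de) * Rpower x (- de - 1)) by ring.
    eapply Rle_trans; [apply Rabs_triang|]. rewrite (Rabs_mult (zetaR be)), (Rabs_mult (ka * de)), (Rabs_pos_eq (/ x)), (Rabs_pos_eq (Rpower _ _)) by lra.
    assert (A1 := Rabs_pos (zetaR be)). assert (A2 := Rabs_pos (ka * de)).
    apply Rle_trans with ((Rabs (zetaR be) + Rabs (ka * de)) * / x).
    * assert (Rabs (ka * de) * Rpower x (- de - 1) <= Rabs (ka * de) * / x) by (apply Rmult_le_compat_l; lra). lra.
    * apply Rmult_le_compat_l; [lra|]. nra.
  + intros t Ht. rewrite ln_scaled by auto. apply derR_minus.
    * auto_derive; [lra | field; lra].
    * assert (E : Rpower (Rpower (t / (2 * PI)) theta) (- de) = Rpower (2 * PI) (theta * de) * Rpower t (1 - theta * de - 1)).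
      { rewrite Rpower_mult. unfold Rdiv, Rpower. rewrite ln_mult, ln_Rinv by (try apply Rinv_0_lt_compat; lra).
        rewrite <- exp_plus. f_equal. ring. }
      rewrite E.
      replace (ka * (Rpower (2 * PI) (theta * de) * Rpower t (1 - theta * de - 1))) with
       (ka * Rpower (2 * PI) (theta * de) / (1 - theta * de) * ((1 - theta * de) * Rpower t (1 - theta * de - 1))) by (field; lra).
      apply derR_scal, is_derive_Rpower. lra.
  + intros X n Hn HnX. apply wsum_asymp_ge2; auto; lia.
  + exists K, 8. intros T HT. specialize (HK T HT).
    replace (T * K_b theta (INR b) (ln T) - C_1b1 theta (INR b) * Rpower T (1 - theta * (1 / 2 - 1 / (2 * INR b))))
    with (zetaR be * (theta * (T * (ln T - ln (2 * PI) - 1)) + euler_gamma * T) + INR b * zeta'R be * T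
        - ka * Rpower (2 * PI) (theta * de) / (1 - theta * de) * Rpower T (1 - theta * de)); [exact HK|].
    rewrite Ede.
    (* [theta (lambda b + 1) = 2b - theta (b - 1) = 2b (1 - theta de)]: the denominator of the
       constant is the factor [1 - theta de] that comes from integrating [t^(-theta de)]. *)
    assert (EC : C_1b1 theta (INR b) = ka * Rpower (2 * PI) (theta * de) / (1 - theta * de)).
    { unfold C_1b1. rewrite Ede. fold Z0. unfold ka, lambda_theta.
      assert (D : 0 < 2 * INR b - theta * (INR b - 1)).
      { assert (theta * (INR b - 1) <= 1 * (INR b - 1)) by (apply Rmult_le_compat_r; lra). lra. }
      unfold de. field. repeat split; try lra. }
    rewrite EC. unfold K_b, E_b. fold be. ring.
- destruct (M1b1_asymp theta 1
    (fun x => (ln x) ^ 2 / 2 + 2 * euler_gamma * ln x + (euler_gamma ^ 2 + 2 * gamma1))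
    (fun x => (ln x + 2 * euler_gamma) * / x)
    (fun t => t * (theta ^ 2 / 2 * ((ln t - ln (2 * PI)) ^ 2 - 2 * (ln t - ln (2 * PI)) + 2)
       + 2 * euler_gamma * theta * (ln t - ln (2 * PI) - 1) + (euler_gamma ^ 2 + 2 * gamma1)))
    100 (1 + 2 * Rabs euler_gamma)) as [K HK]; auto.
  + intros x Hx. auto_derive; [lra | simpl; field; lra].
  + intros x Hx. assert (Hi : 0 < / x) by (apply Rinv_0_lt_compat; lra). assert (L := ln_nonneg x Hx).
    rewrite Rabs_mult, (Rabs_pos_eq (/ x)) by lra. rewrite <- Rmult_assoc. apply Rmult_le_compat_r; [lra|].
    eapply Rle_trans; [apply Rabs_triang|]. rewrite Rabs_mult, (Rabs_pos_eq (ln x)), (Rabs_pos_eq 2) by lra.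
    assert (A := Rabs_pos euler_gamma). nra.
  + intros t Ht. rewrite ln_scaled by auto. auto_derive; [lra | simpl; field; lra].
  + intros X n Hn HnX. apply wsum_asymp_1; auto.
  + exists K, 8. intros T HT. specialize (HK T HT). simpl INR in HK.
    replace (theta ^ 2 / 2 * T * ln T ^ 2 + c1_theta theta * T * ln T + c0_theta theta * T) with
     (T * (theta ^ 2 / 2 * ((ln T - ln (2 * PI)) ^ 2 - 2 * (ln T - ln (2 * PI)) + 2)
       + 2 * euler_gamma * theta * (ln T - ln (2 * PI) - 1) + (euler_gamma ^ 2 + 2 * gamma1))); [exact HK|].
    (* As [lambda + 1 = 2/theta], one has [F11 = theta] and [F01 = 2 gamma theta - theta^2], the
       lower-order terms produced by integrating powers of the logarithm. *)
    unfold c1_theta, c0_theta, F11, F01, lambda_theta. field. lra.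
Qed.
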